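(* Let $\alpha\in(0,1)$ be irrational with modified continued fraction expansion $\alpha=\cfrac{1}{e_1-\cfrac{1}{e_2-\cfrac{1}{e_3-\cdots}}}$, and suppose that there is $N$ such that the integers $e_j$ satisfy $3\leq e_j\leq N$ for all $j\geq 1$. Let $M_\alpha$ and its smooth Riemannian metric $g_\alpha$ be as in the context. Let $\Gamma:[0,1)\to M_\alpha$ be a smooth curve of finite length with respect to $g_\alpha$, i.e. $\lim_{t\to1}\mathrm{length}_{g_\alpha}\bigl(\Gamma|_{[0,t]}\bigr)<\infty$. Then there exists a point $p\in M_\alpha$ such that $\lim_{t\to 1}\Gamma(t)=p$.
   Context: Continued fraction data. Define integer pairs by $(m_0,n_0)=(0,-1)$, $(m_1,n_1)=(1,0)$ and, for $j\geq 2$, $(m_j,n_j)$ coprime with $m_j>0$ and $\frac{n_j}{m_j}=\cfrac{1}{e_1-\cfrac{1}{e_2-\cdots\cfrac{1}{e_{j-1}}}}$. Set $a_j=\frac{n_{j+1}-n_j}{m_{j+1}-m_j}$ for $j\geq 0$ and $a_{-1}=\infty$. The sequence $(a_j)_{j\ge0}$ is strictly decreasing with $a_0=1$ and limit $\alpha$, and $m_jn_{j+1}-m_{j+1}n_j=1$. The envelope of $\alpha$ is the continuous function $\eta_\alpha:\mathbb{R}\to\mathbb{R}$ with $\eta_\alpha(x)=m_jx-n_j$ for $x\in[a_j,a_{j-1}]$, $j\geq0$ (so $\eta_\alpha(x)=1$ for $x\geq 1$) and $\eta_\alpha(x)=0$ for $x\leq\alpha$. The metric $g_\alpha$. Put $u(x)=\eta_\alpha(x)-\eta_\alpha(2\alpha-x)$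 and, for $y>0$, $$f(x,y)=\int_{\mathbb{R}}\frac{y^2}{2((x-x_1)^2+y^2)^{3/2}}\,u(x_1)\,dx_1 ,$$ $$w=f_x^2+f_y^2-y^{-1}ff_y,\qquad v_1=(f_y,\ xf_y-yf_x),\qquad v_2=(f_x,\ xf_x+yf_y-f).$$ Let $\varepsilon(z',z'')=z_1'z_2''-z_2'z_1''$ on $\mathbb{R}^2$. Let $T^2=\mathbb{R}^2/(2\pi\mathbb{Z})^2$ with linear coordinates $z=(z_1,z_2)$, $dz=(dz_1,dz_2)$, and $$g_\alpha=\frac{|w|}{f^2}\left(dx^2+dy^2+\frac{\varepsilon(v_1,dz)^2+\varepsilon(v_2,dz)^2}{w^2}\right).$$ It is known that $f>0$ and $w>0$ on $D_+=\{(x,y):x>\alpha,\ y>0\}$, that $g_\alpha$ is a smooth Riemannian metric on $D_+\times T^2$, and that it extends (uniquely) to a smooth Riemannian metric, still denoted $g_\alpha$, on the manifold $M_\alpha$ described next. The manifold $M_\alpha$. $S^1_{(m,n)}$ denotes the circle subgroup of $T^2$ generated by $m\partial_{z_1}+n\partial_{z_2}$. Let $\overline{D}_+=D_+\cup\{(x,0):x>\alpha\}$. The boundary $\{(x,0):x>\alpha\}$ is the union of the edges $[a_j,a_{j-1}]$, $j\geq 0$ (for $j=0$, the edge is $[1,\infty)$); the points $a_j$, $j\geq0$, are the corners. $M_\alpha$ is obtained from $\overline{D}_+\times T^2$ by collapsing the circle $S^1_{(m_j,n_j)}$ over each interior point of the edge $[a_j,a_{j-1}]$ and collapsing all of $T^2$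 over each corner. It has a $T^2$-action and a projection $\pi:M_\alpha\to\overline{D}_+$, with $\pi^{-1}(D_+)=D_+\times T^2$. Its smooth structure is the product one over $D_+$. Near an interior point of the edge labelled $(m,n)=(m_j,n_j)$, choose $(p,q)$ so that $(m,n),(p,q)$ is a $\mathbb{Z}$-basis of $\mathbb{Z}^2$ and write $z=s(m,n)+t(p,q)$; then $(x,\,t \bmod 2\pi,\,ye^{is})$ are smooth coordinates. Near the corner $a_j$, write $x-a_j+iy=(r_2+ir_1)^2$ with $r_1,r_2\geq 0$ and $z=s_1(m_j,n_j)+s_2(m_{j+1},n_{j+1})$; then $(r_1e^{is_1},r_2e^{is_2})\in\mathbb{C}^2=\mathbb{R}^4$ are smooth coordinates. *)

(* Defs.v *)
From HB Require Import structures.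
From mathcomp Require Import all_boot all_order all_algebra.
From mathcomp Require Import generic_quotient.
From mathcomp Require Import all_classical all_reals all_analysis.

Set Implicit Arguments.
Unset Strict Implicit.
Unset Printing Implicit Defensive.

Import Order.TTheory GRing.Theory Num.Theory.
Import numFieldNormedType.Exports.

Local Open Scope ring_scope.
Local Open Scope classical_set_scope.

Section ContinuedFraction.
Variable e : nat -> int.

(* [:: k_1; ...; k_r] |-> 1 / (k_1 - 1 / (k_2 - ... 1 / k_r)) *)
Definition mcf (s : seq int) : rat :=
  foldr (fun k q => (k%:~R - q)^-1) 0 s.

(* e is used from index 1 on; e 0 plays no role. *)
Definition mcf_expansion (r : nat) : rat := mcf [seq e i | i <- iota 1 r].

(* (m_j, n_j); [denq] and [numq] are coprime and [denq] is positive. *)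
Definition mn (j : nat) : int * int :=
  match j with
  | 0 => (0, -1)
  | 1 => (1, 0)
  | i.+1 => (denq (mcf_expansion i), numq (mcf_expansion i))
  end.

Definition has_mcf_expansion (R : realType) (alpha : R) : Prop :=
  (ratr (mcf_expansion r) : R) @[r --> \oo] --> alpha.

End ContinuedFraction.

Section Smooth.
Variables (R : realType) (V W : normedModType R).

(* C^k on an open set U of a finite-dimensional V: all iterated directional
   derivatives up to order k exist and are continuous. *)
Fixpoint Ck (k : nat) (U : set V) (f : V -> W) : Prop :=
  match k with
  | 0 => forall x, U x -> {for x, continuous f}
  | k'.+1 => (forall x, U x -> differentiable f x) /\
             forall v, Ck k' U ('D_v f)
  end.

Definition smooth (U : set V) (f : V -> W) : Prop := forall k, Ck k U f.

End Smooth.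

Section Envelope.
Variables (R : realType) (alpha : R) (e : nat -> int).

Definition mR (j : nat) : R := (mn e j).1%:~R.
Definition nR (j : nat) : R := (mn e j).2%:~R.
Definition labelR (j : nat) : R * R := (mR j, nR j).

Definition corner (j : nat) : R := (nR j.+1 - nR j) / (mR j.+1 - mR j).

(* a_{j-1}, with a_{-1} = +oo *)
Definition corner_pred (j : nat) : \bar R :=
  if j is i.+1 then (corner i)%:E else +oo%E.

Definition edge (j : nat) : set R :=
  [set x | ((corner j)%:E <= x%:E <= corner_pred j)%E].

Definition edge_interior (j : nat) : set R :=
  [set x | ((corner j)%:E < x%:E < corner_pred j)%E].

(* For x > alpha, an edge containing x: it is unique unless x is a corner, and
   at a corner the two candidates give the same value of [envelope]. *)
Definition edge_of (x : R) : nat := get [set j | edge j x].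

Definition envelope (x : R) : R :=
  if x <= alpha then 0 else mR (edge_of x) * x - nR (edge_of x).

End Envelope.

Section MetricFormula.
Variables (R : realType) (alpha : R) (e : nat -> int).

Definition bdry_u (x : R) : R :=
  envelope alpha e x - envelope alpha e (2 * alpha - x).

Definition pot_f (x y : R) : R :=
  \int[lebesgue_measure]_x1
    (y ^+ 2 / (2 * ((x - x1) ^+ 2 + y ^+ 2) `^ (3 / 2)) * bdry_u x1).

Definition pot_fx (x y : R) : R := derive1 (pot_f^~ y) x.
Definition pot_fy (x y : R) : R := derive1 (pot_f x) y.

Definition pot_w (x y : R) : R :=
  pot_fx x y ^+ 2 + pot_fy x y ^+ 2 - y^-1 * pot_f x y * pot_fy x y.

Definition vec1 (x y : R) : R * R :=
  (pot_fy x y, x * pot_fy x y - y * pot_fx x y).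
Definition vec2 (x y : R) : R * R :=
  (pot_fx x y, x * pot_fx x y + y * pot_fy x y - pot_f x y).

Definition eps (z z' : R * R) : R := z.1 * z'.2 - z.2 * z'.1.

(* g_alpha at a point of D_+ x T^2 lying over (x, y), evaluated on the tangent
   vector dx d/dx + dy d/dy + dz.1 d/dz1 + dz.2 d/dz2 (squared length). *)
Definition g_alpha (x y dx dy : R) (dz : R * R) : R :=
  `|pot_w x y| / pot_f x y ^+ 2 *
  (dx ^+ 2 + dy ^+ 2 +
   (eps (vec1 x y) dz ^+ 2 + eps (vec2 x y) dz ^+ 2) / pot_w x y ^+ 2).

End MetricFormula.

Section Manifold.
Variables (R : realType) (alpha : R) (e : nat -> int).

Definition Dbar : set (R * R) := [set p | alpha < p.1 /\ 0 <= p.2].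

Definition toric_cover : Type := (set_type Dbar * (R * R))%type.

(* Lie algebra of the subgroup of T^2 collapsed over p \in Dbar. *)
Definition collapsed (p : R * R) : set (R * R) :=
  [set h | if 0 < p.2 then h = 0
           else if `[< exists j, p.1 = corner R e j >] then True
           else exists s : R, h = s *: labelR R e (edge_of e p.1)].

(* Dividing Dbar x R^2 at once by the lattice (2 pi Z)^2 and by the collapsed
   subgroups gives Dbar x T^2 with the circles and tori collapsed. *)
Definition collapse_rel (P Q : toric_cover) : bool :=
  `[< P.1 = Q.1 /\
      exists k l : int,
        collapsed (val P.1) (Q.2 - P.2 + (2 * pi) *: (k%:~R, l%:~R)) >].

Lemma collapsed0 p : collapsed p 0.
Proof.
rewrite /collapsed /=; case: ifP => // _; case: ifP => // _.
by exists 0; rewrite scale0r.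
Qed.

Lemma collapsedB p h h' : collapsed p h -> collapsed p h' -> collapsed p (h - h').
Proof.
rewrite /collapsed /=; case: ifP => _; first by move=> -> ->; rewrite subr0.
case: ifP => // _ [s ->] [s' ->].
by exists (s - s'); rewrite scalerBl.
Qed.

Lemma collapse_rel_equiv : equiv_class_of collapse_rel.
Proof.
have latB (k l k' l' : int) : (2 * pi : R) *: (k%:~R, l%:~R) -
    (2 * pi : R) *: (k'%:~R, l'%:~R) =
    (2 * pi : R) *: ((k - k')%:~R : R, (l - l')%:~R : R).
  by rewrite -scalerBr !rmorphB.
have lat0 : (2 * pi : R) *: ((0 : int)%:~R : R, (0 : int)%:~R : R) = 0.
  exact: scaler0.
have refl P : collapse_rel P P.
  apply/asboolP; split=> //; exists 0, 0.
  by rewrite subrr add0r lat0; exact: collapsed0.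
have right_eucl P Q S : collapse_rel P Q -> collapse_rel P S -> collapse_rel Q S.
  move=> /asboolP[PQ [k [l PQc]]] /asboolP[PS [k' [l' PSc]]].
  apply/asboolP; split; first by rewrite -PQ.
  exists (k' - k), (l' - l); rewrite -PQ -latB.
  have := collapsedB PSc PQc; congr (collapsed _ _).
  by rewrite opprD addrACA opprB; congr (_ + _); rewrite addrA subrK.
have sym P Q : collapse_rel P Q -> collapse_rel Q P.
  by move=> PQ; exact: right_eucl PQ (refl P).
split=> //.
- by move=> P Q; apply/idP/idP; exact: sym.
- by move=> Q P S PQ; exact: right_eucl (sym _ _ PQ).
Qed.

Canonical collapse_equiv := EquivRelPack collapse_rel_equiv.

Definition manifold : Type := quotient_topology {eq_quot collapse_equiv}%qT.

Lemma Dbar_default : (alpha + 1, 0) \in Dbar.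
Proof. by rewrite inE; split=> //=; rewrite ltrDl. Qed.

(* The class of ((x, y), z); meaningful only when (x, y) \in Dbar. *)
Definition mpoint (x y : R) (z : R * R) : manifold :=
  \pi_{eq_quot collapse_equiv}%qT
    (insubd (exist _ (alpha + 1, 0) Dbar_default : set_type Dbar) (x, y), z).

Inductive chart_index : Type :=
| Interior
| Edge of nat & int * int
| Corner of nat.

Definition is_Zbasis (u v : int * int) : Prop :=
  forall w : int * int, exists! ab : int * int,
    w = u *~ ab.1 + v *~ ab.2.

Definition radius (a b : R) : R := Num.sqrt (a ^+ 2 + b ^+ 2).

(* Some s with a + ib = r e^{is}; the choice does not affect [chart_map]
   on [chart_dom]. *)
Definition angle (a b : R) : R :=
  get [set s : R | a = radius a b * cos s /\ b = radius a b * sin s].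

(* The atlas is given by inverse coordinate maps chart_map k, defined on the
   open subsets chart_dom k of R^4.  The coordinates z in [Interior] and t in
   [Edge] range over R instead of R / 2 pi Z, so that these maps are local
   diffeomorphisms onto open subsets of M_alpha, not necessarily injective.
   - Interior: (x, y, z1, z2);
   - Edge j (p, q): (x, t, Re (y e^{is}), Im (y e^{is}));
   - Corner j: (Re (r1 e^{i s1}), Im (r1 e^{i s1}),
                Re (r2 e^{i s2}), Im (r2 e^{i s2})), where
     x - a_j + i y = (r2 + i r1)^2. *)
Definition corner_x (j : nat) (c : 'rV[R]_4) : R :=
  corner R e j + radius (c 0 2) (c 0 3) ^+ 2 - radius (c 0 0) (c 0 1) ^+ 2.
Definition corner_y (c : 'rV[R]_4) : R :=
  2 * radius (c 0 0) (c 0 1) * radius (c 0 2) (c 0 3).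

Definition chart_dom (k : chart_index) : set 'rV[R]_4 :=
  match k with
  | Interior => [set c | alpha < c 0 0 /\ 0 < c 0 1]
  | Edge j pq => [set c | is_Zbasis (mn e j) pq /\ edge_interior e j (c 0 0)]
  | Corner j => [set c |
      ((corner R e j.+1)%:E < (corner_x j c)%:E < corner_pred R e j)%E]
  end.

Definition chart_map (k : chart_index) (c : 'rV[R]_4) : manifold :=
  match k with
  | Interior => mpoint (c 0 0) (c 0 1) (c 0 2, c 0 3)
  | Edge j pq =>
      mpoint (c 0 0) (radius (c 0 2) (c 0 3))
        (angle (c 0 2) (c 0 3) *: labelR R e j +
         c 0 1 *: (pq.1%:~R, pq.2%:~R))
  | Corner j =>
      mpoint (corner_x j c) (corner_y c)
        (angle (c 0 0) (c 0 1) *: labelR R e j +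
         angle (c 0 2) (c 0 3) *: labelR R e j.+1)
  end.

Definition bilin (A : 'M[R]_4) (v w : 'rV[R]_4) : R := (v *m A *m w^T) 0 0.

(* g k c is the Gram matrix of the metric at the point chart_map k c, in the
   coordinates k; [riem_compat] is the transformation law under every
   change of coordinates tau from k to l defined near c. *)
Record riemannian_metric (g : chart_index -> 'rV[R]_4 -> 'M[R]_4) : Prop := {
  riem_smooth : forall k (i j : 'I_4),
    smooth (chart_dom k) (fun c => g k c i j : R);
  riem_sym : forall k c, chart_dom k c -> (g k c)^T = g k c;
  riem_pos : forall k c v, chart_dom k c -> v != 0 -> 0 < bilin (g k c) v v;
  riem_compat : forall k l c (tau : 'rV[R]_4 -> 'rV[R]_4),
    chart_dom k c -> chart_dom l (tau c) -> differentiable tau c ->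
    (\forall c' \near c, chart_map l (tau c') = chart_map k c') ->
    forall v w, bilin (g k c) v w = bilin (g l (tau c)) ('D_v tau c) ('D_w tau c)
}.

Definition extends_g_alpha (g : chart_index -> 'rV[R]_4 -> 'M[R]_4) : Prop :=
  forall c v : 'rV[R]_4, chart_dom Interior c ->
    bilin (g Interior c) v v =
    g_alpha alpha e (c 0 0) (c 0 1) (v 0 0) (v 0 1) (v 0 2, v 0 3).

(* Only the values of Gamma on [0, 1) are relevant.  c is smooth on a two-sided
   neighbourhood of t, so that at t = 0 this is the usual smoothness on a
   half-open interval (existence of a local smooth extension). *)
Definition local_expression (Gamma : R -> manifold) (t : R)
    (k : chart_index) (c : R -> 'rV[R]_4) : Prop :=
  [/\ chart_dom k (c t),
      exists2 I : set R, open_nbhs t I & smooth I c &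
      \forall s \near t, 0 <= s < 1 -> Gamma s = chart_map k (c s)].

Definition smooth_curve (Gamma : R -> manifold) : Prop :=
  forall t, 0 <= t < 1 -> exists k c, local_expression Gamma t k c.

(* |Gamma'(t)|_g, computed in any chart. *)
Definition speed (g : chart_index -> 'rV[R]_4 -> 'M[R]_4)
    (Gamma : R -> manifold) (t : R) : R :=
  get [set v : R | exists k c, local_expression Gamma t k c /\
                     v = Num.sqrt (bilin (g k (c t)) (derive1 c t) (derive1 c t))].

(* length of Gamma restricted to [0, t] *)
Definition curve_length (g : chart_index -> 'rV[R]_4 -> 'M[R]_4)
    (Gamma : R -> manifold) (t : R) : \bar R :=
  (\int[lebesgue_measure]_(s in `[0%R, t]) (speed g Gamma s)%:E)%E.

Definition finite_length (g : chart_index -> 'rV[R]_4 -> 'M[R]_4)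
    (Gamma : R -> manifold) : Prop :=
  exists L : R, curve_length g Gamma t @[t --> 1^'-] --> L%:E.

End Manifold.

(* Main.v *)
(* Let X = x - α, g_j = a_j - α and δ_j = α m_j - n_j.  The odd function u is
   the sum over j of (m_{j+1} - m_j) max(-g_j, min(X, g_j)).  The potential of
   each summand is explicit, and f = 2 X P with
   P = Σ (δ_j - δ_{j+1}) / (ρ_j^+ + ρ_j^-), where ρ_j^± is the distance from
   (x, y) to (α ± g_j, 0).  As P decreases in y and increases along the rotation
   field y ∂_x - X ∂_y, one gets w >= P^2 = f^2 / (4 X^2), hence
   g_α >= (dx^2 + dy^2) / (4 X^2).
   Along a curve of finite length ln X and then ln (1 + y^2) are therefore
   Lipschitz in arc length, so (x, y) converges to a point with x > α, y >= 0.
   Near that point g_α also controls the angular coordinates that are not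
   collapsed there, so these converge modulo 2π; the collapsed ones do not
   matter in the quotient because the torus is compact. *)

Require Import Defs.
From mathcomp Require Import all_boot all_order all_algebra.
From mathcomp Require Import generic_quotient.
From mathcomp Require Import all_classical all_reals all_analysis.
From mathcomp Require Import measurable_realfun ring lra zify.
Import Order.TTheory GRing.Theory Num.Theory.
Import numFieldNormedType.Exports.
Local Open Scope ring_scope.
Local Open Scope classical_set_scope.

Set Implicit Arguments.
Unset Strict Implicit.
Unset Printing Implicit Defensive.

Local Notation radius := Defs.radius.

(** * Convergents *)

(** The bound [3 <= e j] gives [m_{j+1} >= 2 m_j + 1], hence [m_j δ_j <= 2/3 < 1]; this makes δ
    strictly decreasing. As [(m_{j+1} - m_j) g_j = δ_j - δ_{j+1}], the series for [P] has positive
    weights with partial sums at most 1, and it is differentiated termwise through remainder bounds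
    uniform in [j]. The formula for [g_α] lives over [y > 0], while a curve may touch edges and
    corners. The estimates are therefore stated with quantities that are continuous in every chart,
    such as [y^2] in place of [y], and pass to [y = 0] by density. Near an edge the bound on angular
    velocities is not read off the formula: it comes from positive definiteness of the extended
    metric at a single point. The angles have no continuous choice along the curve. Convergence is
    proved for the cosine and sine of the pairing of [z] with a label, and a compactness argument on
    the torus turns this into convergence in the quotient. *)

Lemma numq_denq_div (a b : int) (u v : int) : 0 < b -> u * a + v * b = 1 ->
  numq (a%:~R / b%:~R) = a /\ denq (a%:~R / b%:~R) = b.
Proof.
move=> b0 bez.
have co : coprime `|a| `|b|.
  rewrite -coprimezE; apply/coprimezP; exists (u, v); exact: bez.
split; first by rewrite coprimeq_num // gtr0_sg // mul1r.
by rewrite coprimeq_den // gt_eqF // gtr0_norm.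
Qed.

Section Convergents.
Variable e : nat -> int.
Hypothesis e3 : forall j, (1 <= j)%N -> 3 <= e j.

(** Carrying two consecutive pairs makes the three-term recurrence immediate; [mn] reads its pairs
    off a rational number and has no recursion of its own. *)
Fixpoint convergents (j : nat) : (int * int) * (int * int) :=
  if j is i.+1 then
    let: ((m, n), (m', n')) := convergents i in
    ((m', n'), (e i.+1 * m' - m, e i.+1 * n' - n))
  else ((0, -1), (1, 0)).

Let m j := (convergents j).1.1.
Let n j := (convergents j).1.2.

Let mS j : m j.+2 = e j.+1 * m j.+1 - m j.
Proof. by rewrite /m /=; case: (convergents j) => [[? ?] [? ?]]. Qed.
Let nS j : n j.+2 = e j.+1 * n j.+1 - n j.
Proof. by rewrite /n /=; case: (convergents j) => [[? ?] [? ?]]. Qed.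

Let m_growth j : 0 <= m j /\ 2 * m j + 1 <= m j.+1.
Proof.
elim: j => [|j [m0 IH]] //.
rewrite mS; have := @e3 j.+1 isT; split; first lia.
have : 0 <= (e j.+1 - 3) * m j.+1 by apply: mulr_ge0; lia.
lia.
Qed.

Let det j : m j * n j.+1 - m j.+1 * n j = 1.
Proof. by elim: j => [|j IH] //; rewrite mS nS -IH; ring. Qed.

(** Composing the maps [q |-> 1 / (k - q)] gives a Möbius map of the tail [x] whose coefficients are
    two consecutive convergents. The free tail lets the induction split off the last partial
    quotient; [0 <= x < 1] is preserved by [1 / (e - x)] and keeps the denominators positive. *)
Let fold_conv j (x : rat) : 0 <= x < 1 ->
  foldr (fun k q => (k%:~R - q)^-1) x [seq e i | i <- iota 1 j] =
  ((n j.+1)%:~R - x * (n j)%:~R) / ((m j.+1)%:~R - x * (m j)%:~R).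
Proof.
elim: j x => [|j IH] x /andP[x0 x1]; first by rewrite /= /n /m /=; field.
have e3' : 3 <= (e j.+1)%:~R :> rat by rewrite (ler_int _ 3) e3.
have -> : iota 1 j.+1 = iota 1 j ++ [:: j.+1] by rewrite -(iotaD 1 j 1) addn1.
rewrite map_cat foldr_cat /=.
rewrite IH; last first.
  rewrite invr_ge0 invf_lt1; lra.
have [m0 m1] := m_growth j; have [_ m2] := m_growth j.+1.
rewrite mS nS !(rmorphB, rmorphM) /=.
have m0' : 0 <= (m j)%:~R :> rat by rewrite ler0z.
have m1' : 2 * (m j)%:~R + 1 <= (m j.+1)%:~R :> rat.
  by rewrite -[leLHS](_ : (2 * m j + 1)%:~R = _) ?ler_int // rmorphD rmorphM.
have d1 : 0 < ((e j.+1)%:~R - x - 2) * (m j.+1)%:~R by apply: mulr_gt0; lra.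
by field; apply/andP; split; apply/eqP; lra.
Qed.

(** The determinant identity is a Bezout relation, so the fraction obtained for the tail [0] is
    already reduced. *)
Let mnE j : mn e j.+1 = (m j.+1, n j.+1).
Proof.
have [m0 m1] := m_growth j.
have [nE dE] := @numq_denq_div (n j.+1) (m j.+1) (m j) (- n j)
  ltac:(lia) ltac:(have := det j; lia).
have := @fold_conv j 0 isT; rewrite !mul0r !subr0 => fE.
rewrite -[X in _ = (_, X)]nE -{1}dE -fE.
by case: j {m0 m1 nE dE fE}.
Qed.

Lemma mn_recurrence j :
  mn e j.+2 = (e j.+1 * (mn e j.+1).1 - (mn e j).1,
               e j.+1 * (mn e j.+1).2 - (mn e j).2).
Proof.
by case: j => [|j]; rewrite !mnE mS nS.
Qed.

Lemma mn_growth j : 0 <= (mn e j).1 /\ 2 * (mn e j).1 + 1 <= (mn e j.+1).1.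
Proof. by case: j => [|j]; rewrite ?mnE; [exact: (m_growth 0)| exact: m_growth]. Qed.

Lemma mn_det j : (mn e j).1 * (mn e j.+1).2 - (mn e j.+1).1 * (mn e j).2 = 1.
Proof. by case: j => [|j]; rewrite ?mnE; [exact: (det 0)| exact: det]. Qed.

End Convergents.

(** * The envelope *)

Section Envelope.
Variables (R : realType) (alpha : R) (e : nat -> int).
Hypothesis e3 : forall j, (1 <= j)%N -> 3 <= e j.
Hypothesis alpha_mcf : has_mcf_expansion e alpha.

Local Notation m := (mR R e).
Local Notation n := (nR R e).
Local Notation corner := (corner R e).

Definition defect (j : nat) : R := alpha * m j - n j.
Definition jump (j : nat) : R := m j.+1 - m j.
Definition gap (j : nat) : R := corner j - alpha.

Lemma mR0 : m 0 = 0. Proof. by []. Qed.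

Lemma mR_ge0 j : 0 <= m j.
Proof. by rewrite /mR ler0z; have [] := mn_growth e3 j. Qed.

Lemma mR_growth j : 2 * m j + 1 <= m j.+1.
Proof.
have [_] := mn_growth e3 j.
by rewrite -(ler_int R) rmorphD rmorphM.
Qed.

Lemma mR_gt0 j : 0 < m j.+1.
Proof. have := mR_growth j; have := mR_ge0 j; lra. Qed.

Lemma mR_ge j : j%:R <= m j.
Proof.
elim: j => [|j IH]; first exact: mR_ge0.
have := mR_growth j; have := mR_ge0 j; rewrite -natr1; lra.
Qed.

Lemma mR_rec j : m j.+2 = (e j.+1)%:~R * m j.+1 - m j.
Proof. by rewrite /mR mn_recurrence //= rmorphB rmorphM. Qed.

Lemma nR_rec j : n j.+2 = (e j.+1)%:~R * n j.+1 - n j.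
Proof. by rewrite /nR mn_recurrence //= rmorphB rmorphM. Qed.

Lemma mnR_det j : m j * n j.+1 - m j.+1 * n j = 1.
Proof. by rewrite /mR /nR -!rmorphM -rmorphB mn_det. Qed.

Lemma jump_gt0 j : 0 < jump j.
Proof. rewrite /jump; have := mR_growth j; have := mR_ge0 j; lra. Qed.

Lemma defect_rec j : defect j.+2 = (e j.+1)%:~R * defect j.+1 - defect j.
Proof. by rewrite /defect mR_rec nR_rec; ring. Qed.

Lemma defect0 : defect 0 = 1.
Proof. by rewrite /defect mR0 /nR /= mulr0 sub0r opprK. Qed.

Lemma defect_det j : m j.+1 * defect j - m j * defect j.+1 = 1.
Proof. by rewrite -(mnR_det j) /defect; ring. Qed.

Lemma mcf_ratr j : ratr (mcf_expansion e j) = n j.+1 / m j.+1 :> R.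
Proof. by rewrite /ratr /mR /nR; case: j. Qed.

Let cvg_defect : (defect j.+1 / m j.+1) @[j --> \oo] --> (0 : R).
Proof.
rewrite -(subrr alpha).
have -> : (fun j => defect j.+1 / m j.+1) = (fun j => alpha - ratr (mcf_expansion e j)).
  apply/funext => j; rewrite mcf_ratr /defect; have := mR_gt0 j => m0.
  by field; rewrite gt_eqF.
by apply: cvgB => //; exact: cvg_cst.
Qed.

(** The determinant identity divided by [m j.+1 * m j.+2]. The ratios thus decrease to [0], which
    fixes the sign of [defect]. *)
Let ratio_step j : defect j.+1 / m j.+1 = defect j.+2 / m j.+2 + 1 / (m j.+1 * m j.+2).
Proof.
have := defect_det j.+1; have := mR_gt0 j; have := mR_gt0 j.+1.
move=> m2 m1 d.
have m2' : m j.+2 != 0 by rewrite gt_eqF.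
have m1' : m j.+1 != 0 by rewrite gt_eqF.
rewrite -d; field.
by rewrite m1' m2'.
Qed.

Lemma defect_gt0 j : 0 < defect j.
Proof.
case: j => [|j]; first by rewrite defect0.
suff : 0 < defect j.+1 / m j.+1 by rewrite pmulr_lgt0 // invr_gt0 mR_gt0.
have pos k : 0 < 1 / (m k.+1 * m k.+2) by rewrite divr_gt0 // mulr_gt0 // mR_gt0.
have dec : {homo (fun k => defect k.+1 / m k.+1) : a b / (a <= b)%N >-> b <= a}.
  by apply/nonincreasing_seqP => k; rewrite [leRHS]ratio_step lerDl ltW.
rewrite ratio_step ltr_wpDl //.
apply: (cvgr_to_le cvg_defect).
by exists j.+1 => // k /= jk; exact: dec.
Qed.

(** Telescoping [ratio_step] writes [defect j / m j] as the sum of [1 / (m i * m i.+1)] over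
    [i >= j]. As the [m i] at least double, the sum is at most [(1/2 + 1/8 + ...) / m j ^+ 2],
    whence the constant [2 / 3]. *)
Lemma defect_le j : m j * defect j <= 2 / 3.
Proof.
case: j => [|j]; first by rewrite mR0 mul0r; lra.
(* Subtracting the extremal value leaves a nondecreasing sequence below ratios that tend to [0]; it
   is therefore nonpositive. *)
pose q k := defect k.+1 / m k.+1 - 2 / 3 / m k.+1 ^+ 2.
have incq : {homo q : a b / (a <= b)%N >-> a <= b}.
  apply/nondecreasing_seqP => k; rewrite /q ratio_step.
  have := mR_gt0 k; have := mR_growth k.+1.
  set a := m k.+1; set b := m k.+2 => ab a0.
  have b0 : 0 < b by lra.
  rewrite -subr_ge0.
  have -> : defect k.+2 / b - 2 / 3 / b ^+ 2 -
     (defect k.+2 / b + 1 / (a * b) - 2 / 3 / a ^+ 2) =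
     (2 * b + a) * (b - 2 * a) / (3 * a ^+ 2 * b ^+ 2).
    by field; rewrite !gt_eqF.
  by apply: divr_ge0; [apply: mulr_ge0; lra | rewrite ltW // !mulr_gt0 // exprn_gt0].
have : q j <= 0.
  apply: (cvgr_to_ge cvg_defect).
  exists j => // k /= jk; apply: le_trans (incq _ _ jk) _.
  rewrite /q lerBlDr lerDl divr_ge0 //; last by rewrite exprn_ge0 // ltW // mR_gt0.
have m0 := mR_gt0 j.
have -> : q j = (m j.+1 * defect j.+1 - 2 / 3) / m j.+1 ^+ 2.
  by rewrite /q; field; rewrite gt_eqF.
by rewrite pmulr_lle0 ?invr_gt0 ?exprn_gt0 // subr_le0.
Qed.

(** By [defect_det], [m j.+1 * defect j >= 1], whereas [m j.+1 * defect j.+1 <= 2 / 3]. *)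
Lemma defect_decr j : defect j.+1 < defect j.
Proof.
have m1 := mR_gt0 j.
rewrite -(ltr_pM2l m1); have := defect_det j; have := defect_le j.+1.
have := mulr_ge0 (mR_ge0 j) (ltW (defect_gt0 j.+1)); lra.
Qed.

(** Slope change times half-width of a clamp is a term of a telescoping sum; the summability of the
    potential series rests on this. *)
Lemma gapE j : jump j * gap j = defect j - defect j.+1.
Proof.
have := jump_gt0 j; rewrite /gap /corner /jump /defect => j0.
by field; rewrite gt_eqF.
Qed.

Lemma gap_gt0 j : 0 < gap j.
Proof.
have := gapE j; have := defect_decr j; rewrite -subr_gt0 => d0 g.
by rewrite -(pmulr_rgt0 _ (jump_gt0 j)) g.
Qed.

Lemma gap_decr j : gap j.+1 < gap j.
Proof.
have j0 := jump_gt0 j; have j1 := jump_gt0 j.+1.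
rewrite -(ltr_pM2l j0) -(ltr_pM2l j1).
have -> : jump j.+1 * (jump j * gap j.+1) = jump j * (jump j.+1 * gap j.+1) by ring.
rewrite !gapE -subr_gt0.
(* By the recurrence, the cross difference is [e j.+1 - 2] times the determinant. *)
have -> : jump j.+1 * (defect j - defect j.+1) - jump j * (defect j.+1 - defect j.+2)
  = ((e j.+1)%:~R - 2) * (m j.+1 * defect j - m j * defect j.+1).
  by rewrite /jump defect_rec mR_rec; ring.
rewrite defect_det mulr1 subr_gt0.
by rewrite (ltr_int R 2); have := @e3 j.+1 isT; lia.
Qed.

Lemma gap_le i j : (i <= j)%N -> gap j <= gap i.
Proof. by apply: (nonincreasing_seqP gap).1 => k; rewrite ltW // gap_decr. Qed.

Lemma defect_cvg0 : defect j @[j --> \oo] --> (0 : R).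
Proof.
rewrite -cvg_shiftS.
apply: (@squeeze_cvgr _ _ _ _ (fun=> 0) (@harmonic R)); last 2 first.
- exact: cvg_cst.
- exact: cvg_harmonic.
apply: nearW => j; rewrite ltW ?defect_gt0 //= /harmonic.
have := defect_le j.+1; have := mR_ge j.+1 => jm h.
rewrite -(ler_pM2l (_ : 0 < j.+1%:R)) ?ltr0n // mulfV ?pnatr_eq0 //.
have := ler_wpM2r (ltW (defect_gt0 j.+1)) jm; lra.
Qed.

Lemma gap_cvg0 : gap j @[j --> \oo] --> (0 : R).
Proof.
apply: (@squeeze_cvgr _ _ _ _ (fun=> 0) (@harmonic R)); last 2 first.
- exact: cvg_cst.
- exact: cvg_harmonic.
apply: nearW => j; rewrite ltW ?gap_gt0 //= /harmonic.
rewrite -(ler_pM2l (_ : 0 < j.+1%:R)) ?ltr0n // mulfV ?pnatr_eq0 //.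
have dj : defect j <= 1.
  rewrite -defect0; apply: (nonincreasing_seqP defect).1 (leq0n j) => k.
  exact/ltW/defect_decr.
have := gapE j; have := defect_gt0 j.+1; have := mR_ge j; have := mR_growth j.
have := mR_ge0 j; rewrite /jump -natr1 => m0 mj1 mj d0 g.
have : j%:R + 1 <= m j.+1 - m j by lra.
by move/(ler_wpM2r (ltW (gap_gt0 j))); lra.
Qed.

Lemma cornerE j : corner j = alpha + gap j.
Proof. by rewrite /gap addrC subrK. Qed.

Lemma corner_gt j : alpha < corner j.
Proof. by rewrite cornerE ltrDl gap_gt0. Qed.

Lemma corner_le i j : (i <= j)%N -> corner j <= corner i.
Proof. by move=> ij; rewrite !cornerE lerD2l gap_le. Qed.

(** The least [j] with [corner j <= x] works. Minimality makes the right end strict, so only the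
    left end of the edge can be a corner equal to [x]. *)
Lemma exists_edge x : alpha < x -> exists2 j, edge e j x & (x%:E < corner_pred R e j)%E.
Proof.
move=> ax.
have ex : exists j, corner j <= x.
  have x0 : 0 < x - alpha by rewrite subr_gt0.
  move: (gap_cvg0) => /cvgr0_norm_le /(_ _ x0)[k _ /(_ k (leqnn k)) /=].
  rewrite gtr0_norm ?gap_gt0 // => h; exists k; rewrite cornerE; lra.
case: (ex_minnP ex) => j jx jmin; exists j; last first.
  case: j jx jmin => [|j] jx jmin /=; first exact: ltry.
  by rewrite lte_fin ltNge; apply/negP => /jmin; rewrite ltnn.
rewrite /edge /= lee_fin jx /=; case: j jx jmin => [|j] jx jmin /=; first exact: leey.
by rewrite lee_fin leNgt; apply/negP => /ltW/jmin; rewrite ltnn.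
Qed.

Lemma edge_of_edge x : alpha < x -> edge e (edge_of e x) x.
Proof.
move=> /exists_edge[j ej _]; exact: (@getI _ [set j | edge e j x] j).
Qed.

Lemma edge_of_interior j (x : R) : edge_interior e j x -> edge_of e x = j.
Proof.
move=> xj.
have ax : alpha < x.
  by move: xj => /andP[+ _]; rewrite lte_fin; apply: lt_trans (corner_gt j).
have := edge_of_edge ax; set i := edge_of e x => xi.
apply/eqP; rewrite eqn_leq; apply/andP; split; rewrite leqNgt; apply/negP.
- case: i xi => [|i] // /andP[_] /= + ji; rewrite lee_fin => xi.
  move: xj => /andP[+ _]; rewrite lte_fin; apply/negP; rewrite -leNgt.
  exact: le_trans xi (@corner_le j i ji).
- move=> ij; case: j xj ij => [|j] // /andP[_] /= + ij; rewrite lte_fin => xj.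
  move: xi => /andP[+ _]; rewrite lee_fin; apply/negP; rewrite -ltNge.
  exact: lt_le_trans xj (@corner_le i j ij).
Qed.

Lemma interior_not_corner j i (x : R) : edge_interior e j x -> x != corner i.
Proof.
move=> /andP[]; rewrite lte_fin => h1 h2; apply/eqP => xi; move: h1 h2; rewrite xi.
case: (leqP j i) => [ij|]; first by rewrite ltNge corner_le.
case: j => [|j] //= ij _; rewrite lte_fin ltNge corner_le //.
Qed.

(** Written with absolute values because the kernel has an explicit integral against [|t - a|]. *)
Definition clamp (s x : R) : R := (`|x + s| - `|x - s|) / 2.

Lemma clamp_min s x : 0 <= s -> 0 <= x -> clamp s x = Num.min x s.
Proof.
move=> s0 x0; rewrite /clamp ger0_norm; last lra.
by case: (leP x s) => xs; [rewrite ler0_norm|rewrite ger0_norm]; lra.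
Qed.

Lemma clampN s x : clamp s (- x) = - clamp s x.
Proof.
by rewrite /clamp -mulNr opprB -(normrN (- x + s)) -(normrN (- x - s)) !opprD !opprK.
Qed.

(* [u] is the sum of the clamps of [x - alpha] to [[- gap j, gap j]] with the
   weights [jump j]; a partial sum misses at most [defect N]. *)
Definition clamp_sum (N : nat) (x : R) : R := \sum_(i < N) jump i * clamp (gap i) x.

(** Partial sums increase in [N], while partial sum plus [defect] decreases, since a clamp adds at
    most [jump k * gap k = defect k - defect k.+1]. From the index of the edge of [x] on, the latter
    is constant and equal to the envelope, which is thus squeezed. *)
Lemma envelope_approx N x : alpha < x ->
  clamp_sum N (x - alpha) <= envelope alpha e x <= clamp_sum N (x - alpha) + defect N.
Proof.
move=> ax; rewrite /envelope [x <= alpha]leNgt ax /=.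
have := edge_of_edge ax; set j := edge_of e x => /andP[]; rewrite lee_fin => jx xj.
have X0 : 0 <= x - alpha by lra.
pose S := clamp_sum^~ (x - alpha).
have SS k : S k.+1 = S k + jump k * Num.min (x - alpha) (gap k).
  by rewrite /S /clamp_sum big_ord_recr /= clamp_min // ltW // gap_gt0.
have min0 k : 0 <= Num.min (x - alpha) (gap k) by rewrite le_min X0 ltW // gap_gt0.
have incS : {homo S : a b / (a <= b)%N >-> a <= b}.
  by apply/nondecreasing_seqP => k; rewrite SS lerDl mulr_ge0 // ltW // jump_gt0.
have decR : {homo (fun k => S k + defect k) : a b / (a <= b)%N >-> b <= a}.
  apply/nonincreasing_seqP => k; rewrite SS.
  have := ler_wpM2l (ltW (jump_gt0 k)) (_ : Num.min (x - alpha) (gap k) <= gap k).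
  by rewrite ge_min lexx orbT gapE => /(_ isT); lra.
(* Before [j] every [gap] is at least [x - alpha]: no clamp cuts, and the jumps telescope. *)
have Sj k : (k <= j)%N -> S k = m k * (x - alpha).
  elim: k => [|k IH] kj; first by rewrite /S /clamp_sum big_ord0 mR0 mul0r.
  rewrite SS IH 1?ltnW // /jump min_l; first ring.
  clear IH; clearbody j; case: j kj xj {jx} => [|i] // ki; rewrite lee_fin cornerE => xi.
  have := gap_le (ki : (k <= i)%N); lra.
(* From [j] on every clamp is saturated and adds exactly what [defect] loses. *)
have Sk k : (j <= k)%N -> S k + defect k = m j * x - n j.
  elim: k => [|k IH].
    by rewrite leqn0 => /eqP j0; rewrite j0 (Sj 0%N) // defect0 mR0 /nR /=; ring.
  rewrite leq_eqVlt => /predU1P[<-|jk]; first by rewrite Sj // /defect; ring.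
  rewrite -(IH jk) SS min_r; first by rewrite gapE; ring.
  move: jx; rewrite cornerE; have := gap_le (jk : (j <= k)%N); lra.
have := Sk (maxn j N) (leq_maxl j N).
have := incS _ _ (leq_maxr j N); have := decR _ _ (leq_maxr j N).
rewrite -/(S N); have := defect_gt0 (maxn j N); move=> h1 h2 h3 h4.
apply/andP; split; lra.
Qed.

Lemma clamp_sumN N x : clamp_sum N (- x) = - clamp_sum N x.
Proof.
by rewrite /clamp_sum -sumrN; apply: eq_bigr => i _; rewrite clampN mulrN.
Qed.

(** Both functions are odd about [alpha], and to its right the reflected envelope vanishes. *)
Lemma bdry_u_approx N x :
  `|bdry_u alpha e x - clamp_sum N (x - alpha)| <= defect N.
Proof.
have pos y : alpha < y -> `|bdry_u alpha e y - clamp_sum N (y - alpha)| <= defect N.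
  move=> ay; rewrite /bdry_u {2}/envelope ifT ?subr0; last lra.
  have /andP[h1 h2] := envelope_approx N ay; rewrite ler_norml; apply/andP; split; last lra.
  have := defect_gt0 N; lra.
case: (ltgtP alpha x) => [/pos //|xa|<-].
- have -> : bdry_u alpha e x = - bdry_u alpha e (2 * alpha - x).
      have xx : 2 * alpha - (2 * alpha - x) = x by lra.
    by rewrite /bdry_u xx; lra.
  have := pos (2 * alpha - x); have -> : 2 * alpha - x - alpha = - (x - alpha) by lra.
  by rewrite clamp_sumN opprK -normrN opprD; apply; lra.
- have c0 : clamp_sum N 0 = 0 by have := clamp_sumN N 0; rewrite oppr0; lra.
  rewrite /bdry_u (_ : 2 * alpha - alpha = alpha) ?subrr; last lra.
  by rewrite c0 subrr normr0 ltW // defect_gt0.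
Qed.

End Envelope.

(** * The potential *)

Section Radius.
Variable R : realType.
Implicit Types a b h x y : R.

Lemma is_derive_cvg (f : R -> R) x l : is_derive x 1 f l -> f t @[t --> x] --> f x.
Proof.
move=> [df _].
have : {for x, continuous f} by apply: differentiable_continuous; exact/derivable1_diffP.
by [].
Qed.

Lemma radius_ge0 a b : 0 <= radius a b.
Proof. exact: sqrtr_ge0. Qed.

Lemma radius_sqr a b : radius a b ^+ 2 = a ^+ 2 + b ^+ 2.
Proof. by rewrite sqr_sqrtr // addr_ge0 // sqr_ge0. Qed.

Lemma radiusC a b : radius a b = radius b a.
Proof. by rewrite /radius addrC. Qed.

Lemma radiusN a b : radius (- a) b = radius a b.
Proof. by rewrite /radius sqrrN. Qed.

Lemma normr_le_radius a b : `|a| <= radius a b.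
Proof.
by rewrite -sqrtr_sqr; apply: ler_wsqrtr; rewrite lerDl sqr_ge0.
Qed.

Lemma le_radius a b : a <= radius a b.
Proof. exact: le_trans (ler_norm _) (normr_le_radius _ _). Qed.

Lemma radius_gt0 a b : 0 < b -> 0 < radius a b.
Proof. by move=> b0; rewrite radiusC (lt_le_trans b0) // le_radius. Qed.

Lemma is_derive_radius y x : 0 < y ->
  is_derive x 1 (fun t => radius t y) (x / radius x y).
Proof.
move=> y0; rewrite /radius.
have s0 : 0 < x ^+ 2 + y ^+ 2 by rewrite ltr_wpDl ?sqr_ge0 // exprn_gt0.
have sq : is_derive x 1 (fun t : R => t ^+ 2 + y ^+ 2) (2 * x).
  by apply: is_derive_eq; rewrite /GRing.scale /=; ring.
have := @is_derive1_comp _ Num.sqrt (fun t : R => t ^+ 2 + y ^+ 2) x _ _ (is_derive1_sqrt s0) sq.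
move=> h; apply: is_derive_eq; have := sqrtr_gt0 (x ^+ 2 + y ^+ 2); rewrite s0 => r0.
by field; rewrite gt_eqF.
Qed.

End Radius.

(** * The kernel of the potential and its integral against [|t - a|] *)

Section Kernel.
Variable R : realType.
Implicit Types a b h x y t : R.
Notation mu := (@lebesgue_measure R).

Definition pot_kernel x y t : R := y ^+ 2 / (2 * ((x - t) ^+ 2 + y ^+ 2) `^ (3 / 2)).

Lemma kernelE x y t : pot_kernel x y t = y ^+ 2 / (2 * radius (t - x) y ^+ 3).
Proof.
have s0 : 0 <= (x - t) ^+ 2 + y ^+ 2 by rewrite addr_ge0 ?sqr_ge0.
rewrite /pot_kernel (mulrC 3) powRrM powR12_sqrt // powR_mulrn ?sqrtr_ge0 //.
by rewrite /radius -(sqrrN (t - x)) opprB.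
Qed.

Lemma kernel_ge0 x y t : 0 <= pot_kernel x y t.
Proof.
by rewrite kernelE divr_ge0 ?sqr_ge0 // mulr_ge0 // exprn_ge0 // radius_ge0.
Qed.

Lemma continuous_kernel x y : 0 < y -> continuous (pot_kernel x y).
Proof.
move=> y0; have -> : pot_kernel x y = (fun t => y ^+ 2 / (2 * radius (t - x) y ^+ 3)).
  by apply/funext => t; rewrite kernelE.
move=> t; have r0 : 0 < radius (t - x) y by exact: radius_gt0.
apply: cvgM; first exact: cvg_cst.
apply: cvgV; first by rewrite gt_eqF // mulr_gt0 // exprn_gt0.
apply: cvgM; first exact: cvg_cst.
apply: (@cvg_comp _ _ _ (fun t => radius (t - x) y) (fun r : R => r ^+ 3)); last exact: exprn_continuous.
apply: (@cvg_comp _ _ _ (fun t => t - x) (fun r : R => radius r y)).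
  by apply: cvgB; [exact: cvg_id|exact: cvg_cst].
exact: is_derive_cvg (is_derive_radius (t - x) y0).
Qed.

Let half x y a : 0 < y ->
  (\int[mu]_(t in `[a, +oo[) (pot_kernel x y t * `|t - a|)%:E =
   ((radius (x - a) y + (x - a)) / 2)%:E)%E.
Proof.
move=> y0; set b := a - x.
(* With [s = t - x] and [r = radius s y], primitives of [y^2 s / r^3] and [y^2 / r^3] are
   [- y^2 / r] and [s / r]. *)
pose F t : R := (- y ^+ 2 - b * (t - x)) / (2 * radius (t - x) y).
have dF t : is_derive t 1 F (pot_kernel x y t * (t - a)).
  have r0 : 0 < radius (t - x) y by exact: radius_gt0.
  have sq := radius_sqr (t - x) y.
  have dr : is_derive t 1 (fun t => radius (t - x) y) ((t - x) / radius (t - x) y).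
    have := @is_derive1_comp _ (fun s => radius s y) (fun t => t - x) t _ 1 (is_derive_radius (t - x) y0).
    by rewrite mulr1; apply; apply: is_derive_eq; rewrite subr0.
  have r2 : 2 * radius (t - x) y != 0 by rewrite mulf_neq0 ?gt_eqF.
  have dn : is_derive t 1 (fun t => - y ^+ 2 - b * (t - x)) (- b).
    by apply: is_derive_eq; rewrite /GRing.scale /=; ring.
  have d2 : is_derive t 1 (fun t => 2 * radius (t - x) y) (2 * ((t - x) / radius (t - x) y)).
    by apply: is_derive_eq; rewrite /GRing.scale /=; ring.
  have dv := @is_deriveV _ (fun t => 2 * radius (t - x) y) t _ 1 r2 d2.
  apply: is_derive_eq; rewrite kernelE /GRing.scale /=.
  have -> : t - a = (t - x) - b by rewrite /b; ring.
  set r := radius _ _ in r0 sq *.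
  have -> : y ^+ 2 = r ^+ 2 - (t - x) ^+ 2 by rewrite sq; ring.
  by field; rewrite gt_eqF.
have Flim : F t @[t --> +oo%R] --> - b / 2.
  apply/cvgrPdist_le => eps eps0; near=> t.
  have t1 : 1 <= t - x by rewrite lerBrDr; near: t; apply: nbhs_pinfty_ge; rewrite num_real.
  have tC : (y ^+ 2 + `|b| * y ^+ 2) / eps <= t - x.
    by rewrite lerBrDr; near: t; apply: nbhs_pinfty_ge; rewrite num_real.
  rewrite /F; set s := t - x in t1 tC *.
  have r0 : 0 < radius s y by exact: radius_gt0.
  have rs : s <= radius s y by exact: le_radius.
  have sq := radius_sqr s y; set r := radius s y in r0 rs sq *.
  have -> : - b / 2 - (- y ^+ 2 - b * s) / (2 * r) = (y ^+ 2 - b * (r - s)) / (2 * r).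
    by field; rewrite gt_eqF.
  rewrite normrM [X in _ * X]gtr0_norm; last by rewrite invr_gt0 mulr_gt0.
  rewrite ler_pdivrMr; last by rewrite mulr_gt0.
  (* From [(r - s) * (r + s) = y ^+ 2] and [s >= 1]. *)
  have rsy : 0 <= r - s <= y ^+ 2 by nra.
  apply: (@le_trans _ _ (y ^+ 2 + `|b| * y ^+ 2)).
    apply: le_trans (ler_normB _ _) _; rewrite (ger0_norm (sqr_ge0 y)) lerD2l normrM.
    by apply: ler_wpM2l => //; rewrite ger0_norm; lra.
  rewrite ler_pdivrMr // in tC.
  apply: le_trans tC _; rewrite mulrC; apply: ler_wpM2l; [exact: ltW|lra].
have -> : ((radius (x - a) y + (x - a)) / 2)%:E = ((- b / 2)%:E - (F a)%:E)%E.
  rewrite -EFinB; congr EFin.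
  rewrite /F -/b -(radiusN (x - a)) opprB -/b.
  have r0 : 0 < radius b y by exact: radius_gt0.
  have sq := radius_sqr b y; set r := radius b y in r0 sq *.
  have -> : - y ^+ 2 - b * b = - r ^+ 2 by rewrite sq; ring.
  by rewrite /b; field; rewrite gt_eqF.
have cf : continuous (fun t => pot_kernel x y t * (t - a)).
  by move=> t; apply: cvgM; [exact: continuous_kernel|apply: cvgB; [exact: cvg_id|exact: cvg_cst]].
have cF : continuous F.
  by move=> t; exact: is_derive_cvg (dF t).
rewrite -(@ge0_continuous_FTC2y _ (fun t => pot_kernel x y t * (t - a)) F a (- b / 2)) //.
- apply: eq_integral => t; rewrite inE /= in_itv /= andbT => at_.
  by rewrite ger0_norm // subr_ge0.
- by move=> t at_; rewrite mulr_ge0 ?kernel_ge0 // subr_ge0.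
- exact: continuous_subspaceT.
- exact/cvg_at_right_filter/cF.
- by move=> t _; rewrite derive1E; have [_ ->] := dF t.
Unshelve. all: by end_near. Qed.

(** The half-lines contribute [(r + (x - a)) / 2] and [(r - (x - a)) / 2], the left one after the
    reflection [t |-> - t]. Boundary data [|t - a|] thus has as potential the distance to
    [(a, 0)]. *)
Lemma integral_kernel_abs x y a : 0 < y ->
  (\int[mu]_t (pot_kernel x y t * `|t - a|)%:E = (radius (x - a) y)%:E)%E.
Proof.
move=> y0.
have cf : continuous (fun t => pot_kernel x y t * `|t - a|).
  move=> t; apply: cvgM; first exact: continuous_kernel.
  by apply: cvg_norm; apply: cvgB; [exact: cvg_id|exact: cvg_cst].
have mf : measurable_fun [set: R] (fun t => pot_kernel x y t * `|t - a|).
  exact: continuous_measurable_fun.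
have f0 t : 0 <= pot_kernel x y t * `|t - a| by rewrite mulr_ge0 ?kernel_ge0.
rewrite -(setUv `[a, +oo[) ge0_integral_setU //=; last 4 first.
- exact: measurableC.
- by rewrite setUv; exact/measurable_EFinP.
- by move=> t _; rewrite lee_fin.
- exact/disj_setPCl.
rewrite half // setCitvr integral_itv_bndo_bndc; last exact/measurable_EFinP/measurable_funTS.
have := @ge0_integration_by_substitutionNy R (fun t => pot_kernel x y t * `|t - a|) (- a).
rewrite opprK => -> //; last exact: continuous_subspaceT.
rewrite [X in (_ + X)%E](_ : _ = ((radius (- x - - a) y + (- x - - a)) / 2)%:E); last first.
  rewrite -half //; apply: eq_integral => t _ /=.
  congr (_ * _)%:E; last by rewrite -normrN opprD !opprK.
  by rewrite !kernelE -(radiusN (- t - x)) opprD opprK.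
rewrite -EFinD; congr EFin.
have -> : - x - - a = - (x - a) by ring.
by rewrite radiusN; lra.
Qed.

Lemma integrable_kernel_abs x y a : 0 < y ->
  mu.-integrable setT (fun t => (pot_kernel x y t * `|t - a|)%:E).
Proof.
move=> y0; apply/integrableP; split.
  apply/measurable_EFinP; apply: continuous_measurable_fun => t.
  apply: cvgM; first exact: continuous_kernel.
  by apply: cvg_norm; apply: cvgB; [exact: cvg_id|exact: cvg_cst].
rewrite [X in (X < _)%E](_ : _ = (radius (x - a) y)%:E) ?ltry //.
rewrite -(integral_kernel_abs x a y0); apply: eq_integral => t _ /=.
by rewrite ger0_norm // mulr_ge0 ?kernel_ge0.
Qed.

Lemma integrable_kernel x y : 0 < y ->
  mu.-integrable setT (fun t => (pot_kernel x y t)%:E).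
Proof.
move=> y0.
(* This dominates the bare kernel by two integrands already known to be integrable. *)
have sep t : 1 <= `|t - 0| + `|t - 1|.
  have := ler_normB (t - 0) (t - 1).
  by rewrite (_ : t - 0 - (t - 1) = 1) ?normr1 //; ring.
apply: (@le_integrable _ _ _ mu setT _ _ (fun t => (pot_kernel x y t * `|t - 0|)%:E + (pot_kernel x y t * `|t - 1|)%:E)%E) => //.
- by apply/measurable_EFinP; apply: continuous_measurable_fun; exact: continuous_kernel.
- move=> t _ /=.
  have h a : 0 <= pot_kernel x y t * `|t - a| by rewrite mulr_ge0 ?kernel_ge0.
  rewrite (ger0_norm (kernel_ge0 _ _ _)) (ger0_norm (addr_ge0 (h 0) (h 1))).
  rewrite lee_fin -mulrDr ler_peMr ?kernel_ge0 //.
- by apply: integrableD => //; exact: integrable_kernel_abs.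
Qed.

End Kernel.

(** * Second-order remainders with explicit constants *)

Section Remainders.
Variable R : realType.
Implicit Types a b h s x y : R.

Lemma radius_lipschitz a b h : 0 < radius a b -> `|radius (a + h) b - radius a b| <= `|h|.
Proof.
move=> r0; have r1 := radius_ge0 (a + h) b.
have s0 := radius_sqr a b; have s1 := radius_sqr (a + h) b.
have r01 : 0 < radius (a + h) b + radius a b by lra.
rewrite -(ler_pM2r r01) -[X in `|_| * X <= _]gtr0_norm // -normrM.
have -> : (radius (a + h) b - radius a b) * (radius (a + h) b + radius a b) = (a + (a + h)) * h.
  by rewrite -subr_sqr s0 s1; ring.
rewrite normrM mulrC; apply: ler_wpM2l => //; apply: le_trans (ler_normD _ _) _.
by rewrite addrC; apply: lerD; exact: normr_le_radius.
Qed.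

(** Comparing squares gives the exact remainder [(h^2 - D^2) / (2 r)], where [D] is the increment of
    the radius, and [|D| <= |h|]. *)
Lemma radius_remainder a b h : 0 < radius a b ->
  `|radius (a + h) b - radius a b - h * (a / radius a b)| <= h ^+ 2 / (2 * radius a b).
Proof.
move=> r0; have lip := radius_lipschitz h r0.
have s0 := radius_sqr a b; have s1 := radius_sqr (a + h) b.
set D := radius (a + h) b - radius a b in lip *.
have rD : radius (a + h) b = radius a b + D by rewrite /D; ring.
have -> : D - h * (a / radius a b) = (h ^+ 2 - D ^+ 2) / (2 * radius a b).
  apply: (mulIf (_ : 2 * radius a b != 0)); first by rewrite mulf_neq0 ?gt_eqF.
  rewrite divfK ?mulf_neq0 ?gt_eqF //.
  have -> : (D - h * (a / radius a b)) * (2 * radius a b) = 2 * D * radius a b - 2 * h * a.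
    by field; rewrite gt_eqF.
  by move: s1; rewrite rD sqrrD s0 => e1; lra.
rewrite normrM [X in _ * X]gtr0_norm ?invr_gt0 ?mulr_gt0 //.
apply: ler_wpM2r; first by rewrite invr_ge0 mulr_ge0 // ltW.
have : D ^+ 2 <= h ^+ 2 by rewrite -[D ^+ 2]real_normK ?num_real // -[h ^+ 2]real_normK ?num_real // ler_sqr ?nnegrE.
by move=> h1; rewrite ger0_norm; have := sqr_ge0 D; lra.
Qed.

(** The constant involves only [m] and [A]; this uniformity is what allows summation over all terms
    of the series. *)
Lemma inv_remainder (m A S0 S1 S' h : R) : 0 < m -> m <= S0 -> m <= S1 ->
  `|S1 - S0| <= 2 * `|h| -> `|S1 - S0 - h * S'| <= A * h ^+ 2 ->
  `|S1^-1 - S0^-1 - h * (- S' / S0 ^+ 2)| <= (A / m ^+ 2 + 4 / m ^+ 3) * h ^+ 2.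
Proof.
move=> m0 mS0 mS1 lip rem.
have S00 : 0 < S0 by lra.
have S10 : 0 < S1 by lra.
have -> : S1^-1 - S0^-1 - h * (- S' / S0 ^+ 2) =
  - (S1 - S0 - h * S') / S0 ^+ 2 + (S1 - S0) ^+ 2 / (S0 ^+ 2 * S1).
  by field; rewrite !gt_eqF.
apply: le_trans (ler_normD _ _) _; rewrite mulrDl; apply: lerD.
  rewrite normrM normrN [X in _ * X]gtr0_norm ?invr_gt0 ?exprn_gt0 // mulrAC.
  apply: ler_pM => //; first by rewrite invr_ge0 exprn_ge0 // ltW.
  by rewrite lef_pV2 ?posrE ?exprn_gt0 // ler_sqr // nnegrE ltW.
rewrite ger0_norm; last by rewrite divr_ge0 ?sqr_ge0 // mulr_ge0 ?sqr_ge0 // ltW.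
rewrite [leRHS]mulrAC; apply: ler_pM.
- exact: sqr_ge0.
- by rewrite invr_ge0 mulr_ge0 ?sqr_ge0 // ltW.
- rewrite -[(S1 - S0) ^+ 2]real_normK ?num_real // -[h ^+ 2]real_normK ?num_real //.
  by have := normr_ge0 (S1 - S0); nra.
- rewrite lef_pV2 ?posrE ?mulr_gt0 ?exprn_gt0 // exprSr.
  by apply: ler_pM => //; [exact: sqr_ge0|exact: ltW|rewrite ler_sqr // nnegrE ltW].
Qed.

Lemma is_derive_quadratic (F : R -> R) (t D r M : R) : 0 < r -> 0 <= M ->
  (forall h, `|h| < r -> `|F (t + h) - F t - h * D| <= M * h ^+ 2) ->
  is_derive t 1 F D.
Proof.
move=> r0 M0 q.
have lim : h^-1 *: (F (h *: (1 : R) + t) - F t) @[h --> 0^'] --> D.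
  apply/cvgrPdist_le => eps eps0; near=> h.
  have h0 : h != 0 by near: h; exact: nbhs_dnbhs_neq.
  have hr : `|h| < r by near: h; apply: dnbhs0_lt.
  have hM : (M + 1) * `|h| <= eps.
    rewrite mulrC -ler_pdivlMr; last lra.
    by near: h; apply: dnbhs0_le; rewrite divr_gt0 //; lra.
  rewrite distrC /GRing.scale /= mulr1.
  have -> : h^-1 * (F (h + t) - F t) - D = h^-1 * (F (t + h) - F t - h * D).
    by rewrite (addrC h t); field.
  rewrite normrM normfV ler_pdivrMl ?normr_gt0 //.
  apply: le_trans (q _ hr) _; rewrite -[h ^+ 2]real_normK ?num_real //.
  have := normr_ge0 h; set u := `|h| in hM *; nra.
apply: DeriveDef; first by apply/cvg_ex; exists D.
exact: cvg_lim lim.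
Unshelve. all: by end_near. Qed.

End Remainders.

(** * Series of bounded terms against summable weights *)

Section WeightedSums.
Variables (R : realType) (w : nat -> R) (C0 : R).
Hypothesis w_ge0 : forall j, 0 <= w j.
Hypothesis w_bound : forall N, \sum_(j < N) w j <= C0.
Implicit Types (c d : nat -> R).

Definition wsum c (N : nat) : R := \sum_(j < N) w j * c j.
Definition wlim c : R := limn (wsum c).

Let wsum_cvg_ge0 c B : (forall j, 0 <= c j <= B) -> cvgn (wsum c).
Proof.
move=> cB; apply: nondecreasing_is_cvgn.
  apply/nondecreasing_seqP => N; rewrite /wsum big_ord_recr /= lerDl mulr_ge0 //.
  by have /andP[] := cB N.
exists (C0 * B) => _ [N _ <-]; apply: (@le_trans _ _ ((\sum_(j < N) w j) * B)).
  rewrite mulr_suml; apply: ler_sum => j _; apply: ler_wpM2l => //.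
  by have /andP[] := cB j.
apply: ler_wpM2r => //; have /andP[h1 h2] := cB 0%N; exact: le_trans h1 h2.
Qed.

Lemma wsum_cvg c B : (forall j, `|c j| <= B) -> wsum c N @[N --> \oo] --> wlim c.
Proof.
move=> cB; have B0 : 0 <= B := le_trans (normr_ge0 _) (cB 0%N).
suff : cvgn (wsum c) by [].
(* Shifting by the bound reduces to nonnegative terms, whose weighted sums are monotone. *)
have h1 : cvgn (wsum (fun j => c j + B)).
  apply: (@wsum_cvg_ge0 _ (2 * B)) => j; have := cB j; rewrite ler_norml => /andP[? ?].
  by apply/andP; split; lra.
have h2 : cvgn (wsum (fun=> B)) by apply: (@wsum_cvg_ge0 _ B) => j; rewrite lexx andbT.
have -> : wsum c = wsum (fun j => c j + B) - wsum (fun=> B).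
  apply/funext => N; rewrite /wsum /= fctE -sumrB; apply: eq_bigr => j _; ring.
exact: is_cvgB.
Qed.

Lemma wlim_le c d B : (forall j, `|c j| <= B) -> (forall j, `|d j| <= B) ->
  (forall j, c j <= d j) -> wlim c <= wlim d.
Proof.
move=> cB dB cd; apply: (ler_cvg_to (wsum_cvg cB) (wsum_cvg dB)).
by apply: nearW => N; apply: ler_sum => j _; exact: ler_wpM2l.
Qed.

Lemma wlim_comb c d B (k : R) : (forall j, `|c j| <= B) -> (forall j, `|d j| <= B) ->
  wlim (fun j => c j + k * d j) = wlim c + k * wlim d.
Proof.
move=> cB dB; apply: cvg_lim => //.
have -> : wsum (fun j => c j + k * d j) = (fun N => wsum c N + k * wsum d N).
  apply/funext => N; rewrite /wsum mulr_sumr -big_split /=.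
  by apply: eq_bigr => j _; ring.
apply: cvgD; first exact: wsum_cvg cB.
by apply: cvgM; [exact: cvg_cst|exact: wsum_cvg dB].
Qed.

Lemma wlim_norm c B : (forall j, `|c j| <= B) -> `|wlim c| <= C0 * B.
Proof.
move=> cB.
have cv : `|wsum c N| @[N --> \oo] --> `|wlim c| by apply: cvg_norm; exact: wsum_cvg cB.
apply: (cvgr_to_le cv); apply: nearW => N.
have B0 : 0 <= B := le_trans (normr_ge0 _) (cB 0%N).
apply: le_trans (ler_norm_sum _ _ _) _.
apply: (@le_trans _ _ ((\sum_(j < N) w j) * B)); last exact: ler_wpM2r.
rewrite mulr_suml; apply: ler_sum => j _; rewrite normrM ger0_norm //.
exact: ler_wpM2l.
Qed.

(** A quadratic remainder uniform in the index survives summation, with constant [C0 * M]; that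
    already determines the derivative of the limit. *)
Lemma wlim_derive (c : R -> nat -> R) d t r B M : 0 < r ->
  (forall h j, `|h| < r -> `|c (t + h) j| <= B) -> (forall j, `|d j| <= B) ->
  (forall h j, `|h| < r -> `|c (t + h) j - c t j - h * d j| <= M * h ^+ 2) ->
  is_derive t 1 (fun s => wlim (c s)) (wlim d).
Proof.
move=> r0 cB dB q.
have M0 : 0 <= M.
  have hr : `|r / 2| < r by rewrite gtr0_norm; lra.
  have := le_trans (normr_ge0 _) (q _ 0%N hr).
  by rewrite pmulr_lge0 // exprn_gt0; lra.
have C00 : 0 <= C0 by have := w_bound 0; rewrite big_ord0.
apply: (is_derive_quadratic r0 (mulr_ge0 C00 M0)) => h hr.
have c0B j : `|c t j| <= B by rewrite -[t]addr0; apply: cB; rewrite normr0.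
have B0 : 0 <= B := le_trans (normr_ge0 _) (dB 0%N).
have -> : wlim (c (t + h)) - wlim (c t) - h * wlim d =
   wlim (fun j => c (t + h) j - c t j - h * d j).
  have e1 := wlim_comb (-1) (fun j => cB h j hr) c0B.
  rewrite (_ : wlim (fun j => c (t + h) j - c t j - h * d j) =
    wlim (fun j => (c (t + h) j + -1 * c t j) + (- h) * d j)); last first.
    by congr wlim; apply/funext => j; ring.
  rewrite (@wlim_comb _ d (B + B)) ?e1; first ring.
  - move=> j; apply: le_trans (ler_normD _ _) _; apply: lerD; first exact: cB.
    by rewrite normrM normrN1 mul1r.
  - by move=> j; apply: le_trans (dB j) _; lra.
rewrite -mulrA; apply: wlim_norm => j; exact: q.
Qed.

End WeightedSums.

(** * The potential as a weighted series *)

Section Potential.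
Variables (R : realType) (alpha : R) (e : nat -> int).
Hypothesis e3 : forall j, (1 <= j)%N -> 3 <= e j.
Hypothesis alpha_mcf : has_mcf_expansion e alpha.
Notation mu := (@lebesgue_measure R).

Local Notation gap := (gap alpha e).
Local Notation defect := (defect alpha e).
Local Notation jump := (@jump R e).

Definition weight (j : nat) : R := defect j - defect j.+1.

Lemma weight_gt0 j : 0 < weight j.
Proof. by rewrite subr_gt0 defect_decr. Qed.

Lemma sum_weight N : \sum_(j < N) weight j = 1 - defect N.
Proof.
elim: N => [|N IH]; first by rewrite big_ord0 defect0 subrr.
by rewrite big_ord_recr /= IH /weight; ring.
Qed.

Lemma sum_weight_le N : \sum_(j < N) weight j <= 1.
Proof. by rewrite sum_weight; have := defect_gt0 e3 alpha_mcf N; lra. Qed.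

Definition inv_sum_radius (s x y : R) : R := (radius (x + s) y + radius (x - s) y)^-1.

(** Rationalization: the squared radii differ by [4 * x * s]. The factor [x] comes out and a
    positive quotient remains. *)
Lemma radius_diff s x y : 0 < y ->
  (radius (x + s) y - radius (x - s) y) / 2 = 2 * x * s * inv_sum_radius s x y.
Proof.
move=> y0; rewrite /inv_sum_radius.
have r1 := @radius_gt0 _ (x + s) _ y0; have r2 := @radius_gt0 _ (x - s) _ y0.
have q1 := radius_sqr (x + s) y; have q2 := radius_sqr (x - s) y.
move: r1 r2 q1 q2; set a := radius _ _; set b := radius _ _ => r1 r2 q1 q2.
have -> : 2 * x * s = (a ^+ 2 - b ^+ 2) / 2 by rewrite q1 q2; field.
by field; rewrite gt_eqF // addr_gt0.
Qed.

Let clamp_kernel x y s t : pot_kernel x y t * clamp s (t - alpha) =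
  2^-1 * (pot_kernel x y t * `|t - (alpha - s)|) - 2^-1 * (pot_kernel x y t * `|t - (alpha + s)|).
Proof.
rewrite /clamp (_ : t - (alpha - s) = t - alpha + s); last ring.
by rewrite (_ : t - (alpha + s) = t - alpha - s); [field|ring].
Qed.

Let integrable_clamp x y s : 0 < y ->
  mu.-integrable setT (EFin \o (fun t => pot_kernel x y t * clamp s (t - alpha))).
Proof.
move=> y0.
rewrite (_ : EFin \o _ = (fun t => (2^-1)%:E * (pot_kernel x y t * `|t - (alpha - s)|)%:E -
  (2^-1)%:E * (pot_kernel x y t * `|t - (alpha + s)|)%:E)%E); last first.
  by apply/funext => t; rewrite /= clamp_kernel.
by apply: integrableB => //; apply: integrableZl => //; exact: integrable_kernel_abs.
Qed.

Let Rintegral_abs x y a : 0 < y ->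
  \int[mu]_t (pot_kernel x y t * `|t - a|) = radius (x - a) y.
Proof. by move=> y0; rewrite /Rintegral integral_kernel_abs. Qed.

Let integral_clamp x y s : 0 < y ->
  \int[mu]_t (pot_kernel x y t * clamp s (t - alpha)) =
  2 * (x - alpha) * s * inv_sum_radius s (x - alpha) y.
Proof.
move=> y0; rewrite -radius_diff //.
under eq_Rintegral do rewrite clamp_kernel.
have hi a : mu.-integrable setT (EFin \o (fun t => 2^-1 * (pot_kernel x y t * `|t - a|))).
  rewrite (_ : EFin \o _ = (fun t => (2^-1)%:E * (pot_kernel x y t * `|t - a|)%:E)%E) //.
  by apply: integrableZl => //; exact: integrable_kernel_abs.
rewrite RintegralB // !RintegralZl //; try exact: integrable_kernel_abs.
rewrite !Rintegral_abs // (_ : x - (alpha - s) = x - alpha + s); last ring.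
rewrite (_ : x - (alpha + s) = x - alpha - s); last ring.
by field.
Qed.

Let integrable_clamp_sum x y N : 0 < y ->
  mu.-integrable setT (EFin \o (fun t => pot_kernel x y t * clamp_sum alpha e N (t - alpha))).
Proof.
move=> y0.
elim: N => [|N IH].
  rewrite (_ : EFin \o _ = (cst 0%E)) ?integrable0 //.
  by apply/funext => t; rewrite /= /clamp_sum big_ord0 mulr0.
rewrite (_ : EFin \o _ = ((fun t => (pot_kernel x y t * clamp_sum alpha e N (t - alpha))%:E)
  \+ (fun t => (jump N)%:E * (pot_kernel x y t * clamp (gap N) (t - alpha))%:E))%E); last first.
  apply/funext => t; rewrite /= /clamp_sum big_ord_recr /= -EFinM -EFinD mulrDr.
  by congr (_ + _)%:E; ring.
by apply: integrableD => //; apply: integrableZl => //; exact: integrable_clamp.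
Qed.

Let integral_clamp_sum x y N : 0 < y ->
  \int[mu]_t (pot_kernel x y t * clamp_sum alpha e N (t - alpha)) =
  2 * (x - alpha) * wsum weight (fun j => inv_sum_radius (gap j) (x - alpha) y) N.
Proof.
move=> y0; elim: N => [|N IH].
  rewrite /wsum big_ord0 mulr0.
  under eq_Rintegral do rewrite /clamp_sum big_ord0 mulr0.
  by rewrite /Rintegral integral0.
under eq_Rintegral => t _.
  rewrite /clamp_sum big_ord_recr /= -/(clamp_sum alpha e N (t - alpha)) mulrDr.
  rewrite (mulrCA (pot_kernel x y t)).
  over.
rewrite RintegralD //; last 2 first.
- exact: integrable_clamp_sum.
- rewrite (_ : EFin \o _ = (fun t => (jump N)%:E * (pot_kernel x y t * clamp (gap N) (t - alpha))%:E)%E) //.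
  by apply: integrableZl => //; exact: integrable_clamp.
rewrite IH RintegralZl //; last exact: integrable_clamp.
rewrite integral_clamp // /wsum big_ord_recr /= [X in _ = _ * (_ + X * _)]/weight -gapE //.
by ring.
Qed.

(** [edge_of] is a choice, so measurability is obtained from the approximation by continuous clamp
    sums. *)
Lemma measurable_bdry_u : measurable_fun setT (bdry_u alpha e).
Proof.
have clamp_cont s : continuous (fun t : R => clamp s (t - alpha)).
  have c a : continuous (fun t : R => `|t - alpha + a|).
    move=> t; apply: cvg_norm; apply: cvgD; last exact: cvg_cst.
    by apply: cvgB; [exact: cvg_id|exact: cvg_cst].
  move=> t; apply: cvgM; last exact: cvg_cst.
  by apply: cvgB; exact: c.
refine (@measurable_fun_cvg _ R R setT (fun N t => clamp_sum alpha e N (t - alpha)) _ _ _) => [N|t _].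
  apply: measurable_sum => i; apply: measurable_funM => //.
  exact: continuous_measurable_fun.
apply/cvgrPdist_le => eps eps0; near=> N.
apply: le_trans (bdry_u_approx e3 alpha_mcf N t) _.
rewrite -(ger0_norm (ltW (defect_gt0 e3 alpha_mcf N))); near: N.
by move/cvgr0_norm_le : (defect_cvg0 e3 alpha_mcf); apply.
Unshelve. all: by end_near. Qed.

Lemma bdry_u_norm_le1 x : `|bdry_u alpha e x| <= 1.
Proof.
have := bdry_u_approx e3 alpha_mcf 0 x.
by rewrite /clamp_sum big_ord0 subr0 defect0.
Qed.

(** [bdry_u] is everywhere within [defect N] of the clamp sum, and the kernel has finite mass. *)
Lemma pot_f_cvg x y : 0 < y ->
  2 * (x - alpha) * wsum weight (fun j => inv_sum_radius (gap j) (x - alpha) y) N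
    @[N --> \oo] --> pot_f alpha e x y.
Proof.
move=> y0.
have iK : mu.-integrable setT (EFin \o pot_kernel x y) by exact: integrable_kernel.
have iu : mu.-integrable setT (EFin \o (fun t => pot_kernel x y t * bdry_u alpha e t)).
  apply: (@le_integrable _ _ _ mu setT _ _ (EFin \o pot_kernel x y)) => //.
    apply/measurable_EFinP; apply: measurable_funM measurable_bdry_u.
    by apply: continuous_measurable_fun; exact: continuous_kernel.
  by move=> t _ /=; rewrite lee_fin normrM ler_piMr // bdry_u_norm_le1.
have K0 : 0 <= \int[mu]_t pot_kernel x y t by apply: Rintegral_ge0 => t _; exact: kernel_ge0.
apply/cvgrPdist_le => eps eps0; near=> N.
rewrite -integral_clamp_sum // /pot_f -RintegralB //; last exact: integrable_clamp_sum.
have iB := integrableB measurableT iu (integrable_clamp_sum x N y0).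
apply: le_trans (le_normr_Rintegral _ _) _ => //.
apply: (@le_trans _ _ (\int[mu]_t (pot_kernel x y t * defect N))).
  apply: le_Rintegral => //.
  - exact: (integrable_norm iB).
  - rewrite (_ : EFin \o _ = (fun t => (pot_kernel x y t)%:E * (defect N)%:E)%E) //.
    exact: integrableZr.
  - move=> t _; rewrite -mulrBr normrM ger0_norm ?kernel_ge0 //.
    by apply: ler_wpM2l; [exact: kernel_ge0|exact: bdry_u_approx].
rewrite RintegralZr //.
(* The [+ 1] avoids dividing by the mass, known here only to be nonnegative. *)
have dN : defect N <= eps / (\int[mu]_t pot_kernel x y t + 1).
  have d0 : 0 <= defect N by apply/ltW/defect_gt0.
  rewrite -(ger0_norm d0); near: N.
  by move/cvgr0_norm_le : (defect_cvg0 e3 alpha_mcf); apply; rewrite divr_gt0 //; lra.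
rewrite ler_pdivlMr in dN; last lra.
apply: le_trans dN; rewrite mulrC; apply: ler_wpM2l; first exact/ltW/defect_gt0.
by rewrite lerDl.
Unshelve. all: by end_near. Qed.

End Potential.

(** * Comparison of the metric with the hyperbolic one *)

Section SumRadius.
Variable R : realType.
Implicit Types s x y h : R.

Definition sum_radius s x y : R := radius (x + s) y + radius (x - s) y.
Definition sum_radius_x s x y : R :=
  (x + s) / radius (x + s) y + (x - s) / radius (x - s) y.
Definition sum_radius_y s x y : R := y / radius (x + s) y + y / radius (x - s) y.
Definition inv_sum_radius_x s x y : R := - sum_radius_x s x y / sum_radius s x y ^+ 2.
Definition inv_sum_radius_y s x y : R := - sum_radius_y s x y / sum_radius s x y ^+ 2.

Lemma sum_radius_ge s x y : 2 * y <= sum_radius s x y.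
Proof.
have := le_radius y (x + s); have := le_radius y (x - s).
by rewrite !(radiusC y) /sum_radius; lra.
Qed.

Lemma inv_sum_radius_bound s x y : 0 < y -> `|inv_sum_radius s x y| <= (2 * y)^-1.
Proof.
move=> y0; have h := sum_radius_ge s x y.
rewrite /inv_sum_radius -/(sum_radius s x y) ger0_norm ?invr_ge0; last lra.
by rewrite lef_pV2 ?posrE //; lra.
Qed.

Lemma ratio_radius_bound x y : 0 < y -> `|x / radius x y| <= 1.
Proof.
move=> y0; have r0 := radius_gt0 x y0.
by rewrite normrM normfV (gtr0_norm r0) ler_pdivrMr // mul1r normr_le_radius.
Qed.

Let inv_sq_bound (t S y : R) : 0 < y -> `|t| <= 2 -> 2 * y <= S ->
  `|- t / S ^+ 2| <= (2 * y ^+ 2)^-1.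
Proof.
move=> y0 t2 yS; have S0 : 0 < S by lra.
rewrite normrM normrN normfV (ger0_norm (sqr_ge0 S)) ler_pdivrMr ?exprn_gt0 //.
apply: le_trans t2 _; rewrite mulrC ler_pdivlMr ?mulr_gt0 ?exprn_gt0 //.
have -> : 2 * (2 * y ^+ 2) = (2 * y) ^+ 2 by ring.
by rewrite ler_sqr ?nnegrE //; lra.
Qed.

Lemma inv_sum_radius_x_bound s x y : 0 < y ->
  `|inv_sum_radius_x s x y| <= (2 * y ^+ 2)^-1.
Proof.
move=> y0; apply: inv_sq_bound => //; last exact: sum_radius_ge.
apply: le_trans (ler_normD _ _) _.
have := ratio_radius_bound (x + s) y0; have := ratio_radius_bound (x - s) y0; lra.
Qed.

Lemma inv_sum_radius_y_bound s x y : 0 < y ->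
  `|inv_sum_radius_y s x y| <= (2 * y ^+ 2)^-1.
Proof.
move=> y0; apply: inv_sq_bound => //; last exact: sum_radius_ge.
have b z : `|y / radius z y| <= 1.
  have r0 := radius_gt0 z y0.
  by rewrite gtr0_norm ?divr_gt0 // ler_pdivrMr // mul1r radiusC le_radius.
by apply: le_trans (ler_normD _ _) _; have := b (x + s); have := b (x - s); lra.
Qed.

(** In [inv_remainder], [m = 2 * y] bounds both sums of radii from below, and [A = y^-1] adds the
    constant [1 / (2 y)] of each radius. *)
Lemma inv_sum_radius_remainder_x s x y h : 0 < y ->
  `|inv_sum_radius s (x + h) y - inv_sum_radius s x y - h * inv_sum_radius_x s x y|
    <= (y^-1 / (2 * y) ^+ 2 + 4 / (2 * y) ^+ 3) * h ^+ 2.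
Proof.
move=> y0; rewrite /inv_sum_radius -!/(sum_radius _ _ _).
apply: inv_remainder; [lra|exact: sum_radius_ge|exact: sum_radius_ge| |].
  rewrite /sum_radius (_ : x + h + s = x + s + h); last ring.
  rewrite (_ : x + h - s = x - s + h); last ring.
  rewrite opprD addrACA; apply: le_trans (ler_normD _ _) _.
  have := radius_lipschitz h (radius_gt0 (x + s) y0).
  by have := radius_lipschitz h (radius_gt0 (x - s) y0); lra.
have b z : h ^+ 2 / (2 * radius z y) <= 2^-1 * (y^-1 * h ^+ 2).
  have r0 := radius_gt0 z y0.
  rewrite mulrC mulrA; apply: ler_wpM2r; first exact: sqr_ge0.
  rewrite -invfM lef_pV2 ?posrE ?mulr_gt0 // ler_pM2l //.
  by rewrite radiusC le_radius.
have := radius_remainder h (radius_gt0 (x + s) y0).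
have := radius_remainder h (radius_gt0 (x - s) y0).
move/le_trans => /(_ _ (b _)) r1; move/le_trans => /(_ _ (b _)) r2.
rewrite /sum_radius /sum_radius_x (_ : x + h + s = x + s + h); last ring.
rewrite (_ : x + h - s = x - s + h); last ring.
rewrite (_ : _ - _ - _ = (radius (x + s + h) y - radius (x + s) y - h * ((x + s) / radius (x + s) y))
  + (radius (x - s + h) y - radius (x - s) y - h * ((x - s) / radius (x - s) y))); last ring.
by apply: le_trans (ler_normD _ _) _; lra.
Qed.

(** For [|h| < y / 2] the height [y + h] stays above [y / 2], so [m = y] is a common lower bound.
    The symmetry [radiusC] reduces variation in [y] to variation in [x]. *)
Lemma inv_sum_radius_remainder_y s x y h : 0 < y -> `|h| < y / 2 ->
  `|inv_sum_radius s x (y + h) - inv_sum_radius s x y - h * inv_sum_radius_y s x y|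
    <= (y^-1 / y ^+ 2 + 4 / y ^+ 3) * h ^+ 2.
Proof.
move=> y0; rewrite ltr_norml => /andP[hy1 hy2]; rewrite /inv_sum_radius -!/(sum_radius _ _ _).
apply: inv_remainder => //.
- by have := sum_radius_ge s x y; lra.
- by have := sum_radius_ge s x (y + h); lra.
- rewrite /sum_radius opprD addrACA; apply: le_trans (ler_normD _ _) _.
  have := radius_gt0 (x + s) y0; have := radius_gt0 (x - s) y0.
  rewrite !(radiusC _ y) !(radiusC _ (y + h)).
  by move=> /(radius_lipschitz h) ? /(radius_lipschitz h) ?; lra.
have b z : h ^+ 2 / (2 * radius z y) <= 2^-1 * (y^-1 * h ^+ 2).
  have r0 := radius_gt0 z y0.
  rewrite mulrC mulrA; apply: ler_wpM2r; first exact: sqr_ge0.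
  rewrite -invfM lef_pV2 ?posrE ?mulr_gt0 // ler_pM2l //.
  by rewrite radiusC le_radius.
have rem z : `|radius z (y + h) - radius z y - h * (y / radius z y)| <= 2^-1 * (y^-1 * h ^+ 2).
  apply: le_trans (b z); have := radius_gt0 z y0.
  by rewrite !(radiusC z) => /(radius_remainder h).
have r1 := rem (x + s); have r2 := rem (x - s).
rewrite /sum_radius /sum_radius_y.
rewrite (_ : _ - _ - _ = (radius (x + s) (y + h) - radius (x + s) y - h * (y / radius (x + s) y))
  + (radius (x - s) (y + h) - radius (x - s) y - h * (y / radius (x - s) y))); last ring.
by apply: le_trans (ler_normD _ _) _; lra.
Qed.

Lemma inv_sum_radius_y_le0 s x y : 0 < y -> inv_sum_radius_y s x y <= 0.
Proof.
move=> y0; rewrite /inv_sum_radius_y mulNr oppr_le0 divr_ge0 ?sqr_ge0 //.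
by rewrite addr_ge0 // divr_ge0 ?radius_ge0 // ltW.
Qed.

(* The rotation field [y d/dx - x d/dy] decreases the sum of the distances to
   the foci [(s, 0)] and [(- s, 0)]. *)
Lemma inv_sum_radius_rotation s x y : 0 < s -> 0 < x -> 0 < y ->
  x * inv_sum_radius_y s x y <= y * inv_sum_radius_x s x y.
Proof.
move=> s0 x0 y0; rewrite /inv_sum_radius_y /inv_sum_radius_x !mulrA.
apply: ler_wpM2r; first by rewrite invr_ge0 sqr_ge0.
rewrite !mulrN lerN2 -subr_ge0 /sum_radius_x /sum_radius_y.
have r1 := radius_gt0 (x + s) y0; have r2 := radius_gt0 (x - s) y0.
have r12 : radius (x - s) y <= radius (x + s) y.
  apply: ler_wsqrtr; rewrite lerD2r -subr_ge0.
  have -> : (x + s) ^+ 2 - (x - s) ^+ 2 = 4 * x * s by ring.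
  by rewrite !mulr_ge0 // ltW.
move: r1 r2 r12; set a := radius _ _; set b := radius _ _ => r1 r2 r12.
have -> : x * (y / a + y / b) - y * ((x + s) / a + (x - s) / b) = y * s * (b^-1 - a^-1).
  by field; rewrite !gt_eqF.
apply: mulr_ge0; first by rewrite mulr_ge0 // ltW.
by rewrite subr_ge0 lef_pV2.
Qed.

End SumRadius.

Section PotentialEstimate.
Variables (R : realType) (alpha : R) (e : nat -> int).
Hypothesis e3 : forall j, (1 <= j)%N -> 3 <= e j.
Hypothesis alpha_mcf : has_mcf_expansion e alpha.

Local Notation gap := (gap alpha e).
Local Notation weight := (weight alpha e).
Local Notation wlim := (wlim weight).
Local Notation W0 := (fun j => ltW (weight_gt0 e3 alpha_mcf j)).
Local Notation W1 := (sum_weight_le e3 alpha_mcf).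

Definition pot_ratio (x y : R) := wlim (fun j => inv_sum_radius (gap j) (x - alpha) y).
Definition pot_ratio_x (x y : R) := wlim (fun j => inv_sum_radius_x (gap j) (x - alpha) y).
Definition pot_ratio_y (x y : R) := wlim (fun j => inv_sum_radius_y (gap j) (x - alpha) y).

Lemma pot_fE x y : 0 < y -> pot_f alpha e x y = 2 * (x - alpha) * pot_ratio x y.
Proof.
move=> y0; rewrite -(cvg_lim (@Rhausdorff R) (pot_f_cvg e3 alpha_mcf y0)).
apply: cvg_lim => //.
apply: cvgM; first exact: cvg_cst.
apply: (wsum_cvg W0 W1) => j; exact: inv_sum_radius_bound.
Qed.

Lemma pot_ratio_gt0 x y : 0 < y -> 0 < pot_ratio x y.
Proof.
move=> y0.
pose c j := inv_sum_radius (gap j) (x - alpha) y.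
have c0 j : 0 <= c j.
  by rewrite /c invr_ge0 addr_ge0 // radius_ge0.
apply: (@lt_le_trans _ _ (wsum weight c 1)).
  rewrite /wsum big_ord_recl big_ord0 addr0 mulr_gt0 ?weight_gt0 //.
  by rewrite invr_gt0 addr_gt0 // radius_gt0.
have cv : wsum weight c N @[N --> \oo] --> pot_ratio x y.
  by apply: (wsum_cvg W0 W1) => j; exact: inv_sum_radius_bound.
apply: (cvgr_to_ge cv); exists 1%N => // N /= N1.
have inc : {homo wsum weight c : a b / (a <= b)%N >-> a <= b}.
  apply/nondecreasing_seqP => k; rewrite /wsum big_ord_recr /= lerDl.
  by rewrite mulr_ge0 // ltW ?weight_gt0.
exact: inc.
Qed.

Lemma is_derive_pot_ratio_x (x y : R) : 0 < y ->
  is_derive x 1 (fun x : R => pot_ratio x y) (pot_ratio_x x y).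
Proof.
move=> y0; set B := Num.max (2 * y)^-1 (2 * y ^+ 2)^-1.
apply: (@wlim_derive _ _ _ W0 W1 _ _ _ 1 B) => //.
- by move=> h j _; rewrite le_max inv_sum_radius_bound.
- by move=> j; rewrite le_max inv_sum_radius_x_bound ?orbT.
- move=> h j _; rewrite (_ : x + h - alpha = x - alpha + h); last ring.
  exact: inv_sum_radius_remainder_x.
Qed.

Lemma is_derive_pot_ratio_y (x y : R) : 0 < y ->
  is_derive y 1 (pot_ratio x) (pot_ratio_y x y).
Proof.
move=> y0; set B := Num.max y^-1 (2 * y ^+ 2)^-1.
apply: (@wlim_derive _ _ _ W0 W1 _ _ _ (y / 2) B).
- by rewrite divr_gt0.
- move=> h j; rewrite ltr_norml => /andP[h1 h2]; rewrite le_max.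
  apply/orP; left; have yh : 0 < y + h by lra.
  apply: le_trans (inv_sum_radius_bound _ _ yh) _.
  by rewrite lef_pV2 ?posrE //; lra.
- by move=> j; rewrite le_max inv_sum_radius_y_bound ?orbT.
- by move=> h j hr; exact: inv_sum_radius_remainder_y.
Qed.

Lemma pot_fxE x y : 0 < y ->
  pot_fx alpha e x y = 2 * pot_ratio x y + 2 * (x - alpha) * pot_ratio_x x y.
Proof.
move=> y0; rewrite /pot_fx derive1E.
rewrite (_ : pot_f alpha e ^~ y = (fun x => 2 * (x - alpha) * pot_ratio x y)); last first.
  by apply/funext => z; rewrite pot_fE.
have d1 := is_derive_pot_ratio_x x y0.
have d2 : is_derive x 1 (fun x : R => 2 * (x - alpha)) 2.
  by apply: is_derive_eq; rewrite /GRing.scale /=; ring.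
have d3 : is_derive x 1 (fun x => 2 * (x - alpha) * pot_ratio x y)
  (2 * (x - alpha) * pot_ratio_x x y + pot_ratio x y * 2) by exact: is_deriveM.
by rewrite derive_val; ring.
Qed.

Lemma pot_fyE x y : 0 < y -> pot_fy alpha e x y = 2 * (x - alpha) * pot_ratio_y x y.
Proof.
move=> y0; rewrite /pot_fy derive1E.
have d1 := is_derive_pot_ratio_y x y0.
have d2 : is_derive y 1 (fun y => 2 * (x - alpha) * pot_ratio x y)
    (2 * (x - alpha) * pot_ratio_y x y).
  by apply: is_derive_eq; rewrite /GRing.scale /=; ring.
have d3 : is_derive y 1 (pot_f alpha e x) (2 * (x - alpha) * pot_ratio_y x y).
  apply: near_eq_is_derive d2; near=> z.
  by rewrite pot_fE //; near: z; exact: lt_nbhsr.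
by rewrite derive_val.
Unshelve. all: by end_near. Qed.

Lemma pot_ratio_y_le0 x y : 0 < y -> pot_ratio_y x y <= 0.
Proof.
move=> y0.
have -> : 0 = wlim (fun=> 0).
  rewrite (_ : wlim (fun=> 0) = limn (fun=> 0 : R)); first by rewrite lim_cst.
  by congr (limn _); apply/funext => N; rewrite /wsum big1 // => j _; rewrite mulr0.
apply: (@wlim_le _ _ _ W0 W1 _ _ (2 * y ^+ 2)^-1).
- by move=> j; exact: inv_sum_radius_y_bound.
- by move=> j; rewrite normr0 invr_ge0 mulr_ge0 // sqr_ge0.
- by move=> j; exact: inv_sum_radius_y_le0.
Qed.

Lemma pot_ratio_rotation x y : alpha < x -> 0 < y ->
  (x - alpha) * pot_ratio_y x y <= y * pot_ratio_x x y.
Proof.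
move=> ax y0; have X0 : 0 < x - alpha by rewrite subr_gt0.
set b := (2 * y ^+ 2)^-1.
have bx j := inv_sum_radius_x_bound (gap j) (x - alpha) y0.
have by_ j := inv_sum_radius_y_bound (gap j) (x - alpha) y0.
have z0 (j : nat) : `|(0 : R)| <= b by rewrite normr0 invr_ge0 mulr_ge0 // sqr_ge0.
have wz : wlim (fun=> 0) = 0.
  rewrite (_ : wlim (fun=> 0) = limn (fun=> 0 : R)); first by rewrite lim_cst.
  by congr (limn _); apply/funext => N; rewrite /wsum big1 // => j _; rewrite mulr0.
have := @wlim_comb _ _ _ W0 W1 (fun=> 0) _ b (x - alpha) z0 by_.
have := @wlim_comb _ _ _ W0 W1 (fun=> 0) _ b y z0 bx.
rewrite wz !add0r => <- <-.
have scale k (c : nat -> R) : 0 < k -> (forall j, `|c j| <= b) ->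
    forall j, `|0 + k * c j| <= k * b.
  by move=> k0 cb j; rewrite add0r normrM gtr0_norm // ler_pM2l.
apply: (@wlim_le _ _ _ W0 W1 _ _ (Num.max ((x - alpha) * b) (y * b))).
- by move=> j; rewrite le_max; apply/orP; left; exact: (scale _ _ X0 by_ j).
- by move=> j; rewrite le_max; apply/orP; right; exact: (scale _ _ y0 bx j).
- by move=> j; rewrite !add0r inv_sum_radius_rotation // gap_gt0.
Qed.

(** Put [q = - X P_y / y >= 0]. Then [w = (2 P + 2 X P_x)^2 + (2 X P_y)^2 + 4 X P q], and the
    rotation inequality says [P_x >= - q]. If [X P_x >= - P / 2], the first square is at least
    [P^2]; otherwise [X q > P / 2] and the last term exceeds [2 P^2]. *)
Lemma pot_w_ge x y : alpha < x -> 0 < y ->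
  0 < pot_f alpha e x y /\
  pot_f alpha e x y ^+ 2 <= 4 * (x - alpha) ^+ 2 * pot_w alpha e x y.
Proof.
move=> ax y0; have X0 : 0 < x - alpha by rewrite subr_gt0.
have P0 := pot_ratio_gt0 x y0; have rot := pot_ratio_rotation ax y0.
have Py := pot_ratio_y_le0 x y0.
rewrite /pot_w pot_fxE // pot_fyE // pot_fE //.
move: X0 P0 rot Py; set X := x - alpha; set P := pot_ratio x y.
set Px := pot_ratio_x x y; set Py := pot_ratio_y x y => X0 P0 rot Py0.
split; first by rewrite !mulr_gt0.
rewrite exprMn (exprMn _ 2) (_ : 2 ^+ 2 = 4 :> R) -?natrX //.
apply: ler_wpM2l; first by rewrite mulr_ge0 // sqr_ge0.
set q := - (X * Py / y).
have q0 : 0 <= q by rewrite oppr_ge0 pmulr_lle0 ?invr_gt0 // pmulr_rle0.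
have Pxq : - q <= Px by rewrite opprK ler_pdivrMr // (mulrC Px).
have -> : y^-1 * (2 * X * P) * (2 * X * Py) = - (4 * X * P * q).
  by rewrite /q; field; rewrite gt_eqF.
have h1 : 0 <= (2 * X * Py) ^+ 2 by exact: sqr_ge0.
have h2 : 0 <= X * P * q by rewrite !mulr_ge0 // ltW.
have h3 : - (X * q) <= X * Px by rewrite -mulrN ler_pM2l.
case: (leP (- (P / 2)) (X * Px)) => h.
  have : P ^+ 2 <= (2 * P + 2 * X * Px) ^+ 2 by rewrite ler_sqr ?nnegrE; nra.
  lra.
have h4 : P * (P / 2) <= P * (X * q) by apply: ler_wpM2l; lra.
have h5 := sqr_ge0 (2 * P + 2 * X * Px).
rewrite [P ^+ 2]expr2; lra.
Qed.

(* A hyperbolic metric for which [x = alpha] is infinitely far away. *)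
Lemma g_alpha_ge x y dx dy dz : alpha < x -> 0 < y ->
  dx ^+ 2 + dy ^+ 2 <= 4 * (x - alpha) ^+ 2 * g_alpha alpha e x y dx dy dz.
Proof.
move=> ax y0; have [f0 fw] := pot_w_ge ax y0.
have X0 : 0 < 4 * (x - alpha) ^+ 2 by rewrite mulr_gt0 // exprn_gt0 // subr_gt0.
have f20 : 0 < pot_f alpha e x y ^+ 2 by rewrite exprn_gt0.
have h : 1 <= 4 * (x - alpha) ^+ 2 * (`|pot_w alpha e x y| / pot_f alpha e x y ^+ 2).
  rewrite mulrA ler_pdivlMr // mul1r; apply: le_trans fw _.
  by apply: ler_wpM2l; [exact: ltW|exact: ler_norm].
rewrite /g_alpha mulrA.
have s0 : 0 <= dx ^+ 2 + dy ^+ 2 by rewrite addr_ge0 // sqr_ge0.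
apply: (@le_trans _ _ (4 * (x - alpha) ^+ 2 * (`|pot_w alpha e x y| / pot_f alpha e x y ^+ 2) * (dx ^+ 2 + dy ^+ 2))).
  by rewrite ler_peMl.
apply: ler_wpM2l; first lra.
by rewrite lerDl divr_ge0 ?sqr_ge0 // addr_ge0 // sqr_ge0.
Qed.

End PotentialEstimate.

(** * Angles and points of the manifold *)

Section Angles.
Variable R : realType.
Implicit Types a b s t x : R.

Lemma cos_sin_int_period x (k : int) :
  cos (x + 2 * pi * k%:~R) = cos x /\ sin (x + 2 * pi * k%:~R) = sin x.
Proof.
have nat_case (n : nat) (y : R) : cos (y + 2 * pi * n%:R) = cos y /\ sin (y + 2 * pi * n%:R) = sin y.
  have -> : y + 2 * pi * n%:R = y + pi *+ 2 *+ n.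
    by congr (_ + _); rewrite -mulrnA -[RHS]mulr_natr natrM; ring.
  split; [exact: (periodicn (@cosD2pi R))|exact: (periodicn (@sinD2pi R))].
case: k => n; first exact: nat_case.
have [h1 h2] := nat_case n.+1 (x + 2 * pi * (Negz n)%:~R).
rewrite -h1 -h2 NegzE mulrNz -addrA -mulrDr addNr mulr0 addr0.
by split.
Qed.

(** Modulo [2 pi] the difference is some [r] in [[0, 2 pi)] with [cos r = 1]. Hence
    [sin (r / 2) = 0] with [r / 2] in [[0, pi)], which forces [r = 0]. *)
Lemma cos_sin_inj s t : cos s = cos t -> sin s = sin t ->
  exists k : int, s = t + 2 * pi * k%:~R.
Proof.
move=> cst sst; have pi0 := pi_gt0 R.
set k := Num.floor ((s - t) / (2 * pi)); exists k.
have /andP[k1 k2] := floor_itv ((s - t) / (2 * pi)).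
rewrite -/k in k1 k2; have pp : 0 < 2 * pi :> R by rewrite mulr_gt0.
rewrite ler_pdivlMr // in k1; rewrite ltr_pdivrMr // in k2.
pose r := s - (t + 2 * pi * k%:~R).
have r0 : 0 <= r by rewrite /r; lra.
have r2 : r < 2 * pi by move: k2; rewrite /r intrD; lra.
have cr : cos r = 1.
  rewrite /r cosB; have [-> ->] := cos_sin_int_period t k.
  by rewrite cst sst -!expr2 cos2Dsin2.
have : cos r = 1 - 2 * sin (r / 2) ^+ 2.
  have -> : cos r = cos ((r / 2) *+ 2) by congr cos; rewrite -mulr_natr; field.
  by rewrite cos_mulr2n -(mulr_natr (cos _ ^+ 2)); have := cos2Dsin2 (r / 2); lra.
rewrite cr => h.
have s0 : sin (r / 2) = 0.
  by apply/eqP; rewrite -sqrf_eq0; apply/eqP; lra.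
have : r = 0.
  apply/eqP; rewrite eq_le r0 andbT leNgt; apply/negP => rp.
  by have := @sin_gt0_pi _ (r / 2); rewrite s0 ltxx => hh; suff : false by []; apply: hh; lra.
by rewrite /r; lra.
Qed.

Lemma polar_exists a b : exists s, a = radius a b * cos s /\ b = radius a b * sin s.
Proof.
have [r0|r0] := eqVneq (radius a b) 0.
  exists 0; rewrite r0 !mul0r; have := radius_sqr a b; rewrite r0 expr0n /= => /esym/eqP.
  by rewrite paddr_eq0 ?sqr_ge0 // !sqrf_eq0 => /andP[/eqP -> /eqP ->].
have rp : 0 < radius a b by rewrite lt0r r0 radius_ge0.
have aR : -1 <= a / radius a b <= 1.
  rewrite -ler_norml normrM normfV (gtr0_norm rp) ler_pdivrMr // mul1r.
  exact: normr_le_radius.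
have c1 : cos (acos (a / radius a b)) = a / radius a b by rewrite acosK // in_itv.
have s1 : sin (acos (a / radius a b)) = `|b| / radius a b.
  rewrite sin_acos // -[radius a b in RHS](gtr0_norm rp) -normfV -normrM -sqrtr_sqr.
  congr Num.sqrt; rewrite !expr_div_n; have := radius_sqr a b => h.
  by rewrite -[1](divff (_ : radius a b ^+ 2 != 0)) ?expf_neq0 // -mulrBl h addrC addKr.
case: (leP 0 b) => b0.
  by exists (acos (a / radius a b)); rewrite c1 s1 ger0_norm // !(mulrC (radius a b)) !divfK.
exists (- acos (a / radius a b)); rewrite cosN sinN c1 s1 ltr0_norm // mulNr opprK.
by rewrite !(mulrC (radius a b)) !divfK.
Qed.

Lemma angleP a b : a = radius a b * cos (angle a b) /\ b = radius a b * sin (angle a b).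
Proof.
have [s hs] := polar_exists a b.
exact: (@getI _ [set s : R | a = radius a b * cos s /\ b = radius a b * sin s] s).
Qed.

Lemma sin_atan x : sin (atan x) = x * cos (atan x).
Proof.
have c0 : cos (atan x) != 0.
  by rewrite gt_eqF // cos_gt0_pihalf // atan_gtNpi2 atan_ltpi2.
by have := atanK x; rewrite /tan => {2}<-; rewrite divfK.
Qed.

(** The argument of [(a + i b) / (a0 + i b0)] added to the angle of the base point: a smooth branch
    on the half-plane where the inner product with [(a0, b0)] is positive. [angle] is a mere choice
    and carries no continuity. *)
Definition angle_branch a0 b0 a b : R :=
  angle a0 b0 + atan ((a0 * b - b0 * a) / (a0 * a + b0 * b)).

Lemma angle_branch_polar a0 b0 a b : 0 < a0 * a + b0 * b ->
  a = radius a b * cos (angle_branch a0 b0 a b) /\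
  b = radius a b * sin (angle_branch a0 b0 a b).
Proof.
move=> u0; rewrite /angle_branch cosD sinD.
have [ha hb] := angleP a0 b0.
set c0 := cos (angle a0 b0) in ha hb *; set s0 := sin (angle a0 b0) in ha hb *.
set u := a0 * a + b0 * b in u0 *; set w := a0 * b - b0 * a.
have q0 := radius_sqr a0 b0; have q := radius_sqr a b.
have r0 : 0 < radius a0 b0.
  rewrite lt0r radius_ge0 andbT; apply/eqP => r0; move: q0 u0; rewrite r0 expr0n /= => /esym/eqP.
  rewrite paddr_eq0 ?sqr_ge0 // !sqrf_eq0 /u => /andP[/eqP -> /eqP ->].
  by rewrite !mul0r addr0 ltxx.
have r1 : 0 < radius a b.
  rewrite lt0r radius_ge0 andbT; apply/eqP => r1; move: q u0; rewrite r1 expr0n /= => /esym/eqP.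
  rewrite paddr_eq0 ?sqr_ge0 // !sqrf_eq0 /u => /andP[/eqP -> /eqP ->].
  by rewrite !mulr0 addr0 ltxx.
set r := radius a b in r1 q *; set p := radius a0 b0 in r0 q0 ha hb *.
have uw : 1 + (w / u) ^+ 2 = (p * r / u) ^+ 2.
  rewrite !exprMn q0 q /w /u; field; rewrite gt_eqF //.
have ca : cos (atan (w / u)) = u / (p * r).
  rewrite cos_atan uw sqrtr_sqr gtr0_norm ?invf_div //.
  by rewrite divr_gt0 // mulr_gt0.
rewrite sin_atan ca.
have p0 : p != 0 by rewrite gt_eqF.
have rn : r != 0 by rewrite gt_eqF.
have un : u != 0 by rewrite gt_eqF.
have ce : c0 = a0 / p by rewrite {1}ha mulrC mulKf.
have se : s0 = b0 / p by rewrite {1}hb mulrC mulKf.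
have d0 : a0 ^+ 2 + b0 ^+ 2 != 0 by rewrite -q0 expf_neq0.
have e1 : r * (c0 * (u / (p * r)) - s0 * (w / u * (u / (p * r)))) = a.
  have -> : r * (c0 * (u / (p * r)) - s0 * (w / u * (u / (p * r)))) = (a0 * u - b0 * w) / p ^+ 2.
    by rewrite ce se; field; rewrite p0 rn un.
  by rewrite q0 /u /w; field.
have e2 : r * (s0 * (u / (p * r)) + c0 * (w / u * (u / (p * r)))) = b.
  have -> : r * (s0 * (u / (p * r)) + c0 * (w / u * (u / (p * r)))) = (b0 * u + a0 * w) / p ^+ 2.
    by rewrite ce se; field; rewrite p0 rn un.
  by rewrite q0 /u /w; field.
by rewrite e1 e2.
Qed.

Lemma angle_branchP a0 b0 a b : 0 < a0 * a + b0 * b ->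
  exists k : int, angle a b = angle_branch a0 b0 a b + 2 * pi * k%:~R.
Proof.
move=> h; have [a1 b1] := angle_branch_polar h; have [a2 b2] := angleP a b.
have r0 : radius a b != 0.
  apply/eqP => r0; move: h a2 b2; rewrite r0 !mul0r => + a3 b3.
  by rewrite a3 b3 !mulr0 addr0 ltxx.
by apply: cos_sin_inj; apply: (mulfI r0); rewrite -?a1 -?b1 -?a2 -?b2.
Qed.

Lemma angle_branch_base a b : angle_branch a b a b = angle a b.
Proof. by rewrite /angle_branch (mulrC b a) subrr mul0r atan0 addr0. Qed.

End Angles.

(** * Points of the quotient and their representatives *)

Section Points.
Variables (R : realType) (alpha : R) (e : nat -> int).

Let coverE (x y : R) (h : (x, y) \in Dbar alpha) :
  val (insubd (exist _ (alpha + 1, 0) (Dbar_default alpha) : set_type (Dbar alpha)) (x, y)) = (x, y).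
Proof. by rewrite insubdK. Qed.

Lemma mpoint_eqP (x y x' y' : R) (z z' : R * R) : alpha < x -> 0 <= y -> alpha < x' -> 0 <= y' ->
  (mpoint alpha e x y z = mpoint alpha e x' y' z') <->
  [/\ x = x', y = y' & exists k l : int,
    collapsed e (x, y) (z' - z + (2 * pi) *: (k%:~R, l%:~R))].
Proof.
move=> ax y0 ax' y0'.
have m1 : (x, y) \in Dbar alpha by rewrite inE.
have m2 : (x', y') \in Dbar alpha by rewrite inE.
rewrite /mpoint; split.
  move=> /eqmodP /asboolP[/= h1 [k [l h2]]].
  have := congr1 val h1; rewrite !coverE // => -[-> ->]; split => //.
  exists k, l; move: h2; rewrite coverE // => h2.
  by have := congr1 val h1; rewrite !coverE // => -[<- <-].
move=> [<- <- [k [l h]]]; apply/eqmodP/asboolP; split => //=.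
by exists k, l; rewrite coverE.
Qed.

Lemma mpoint_surj (P : manifold alpha e) :
  exists x y z, [/\ alpha < x, 0 <= y & P = mpoint alpha e x y z].
Proof.
elim/quotW : P => -[[[x y] xy] z]; have := xy; rewrite inE => -[/= ax y0].
exists x, y, z; split => //; rewrite /mpoint.
suff <- : (exist _ (x, y) xy : set_type (Dbar alpha)) =
  insubd (exist _ (alpha + 1, 0) (Dbar_default alpha) : set_type (Dbar alpha)) (x, y) by [].
by apply/val_inj; rewrite coverE.
Qed.

End Points.

(** * Differentials in the charts *)

Section HasDifferential.
Variables (R : realType) (V : normedModType R).
Implicit Types (f g : V -> R) (c v : V) (df dg : V -> R).

(** [df] is a bare function, so formulas for the differential can be exchanged pointwise. *)
Definition has_differential f c df :=
  differentiable f c /\ forall v, 'D_v f c = df v.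

Lemma has_differential_eq f c df df' : has_differential f c df -> df =1 df' ->
  has_differential f c df'.
Proof. by move=> [f1 f2] h; split => // v; rewrite f2 h. Qed.

Lemma has_differential_is_derive f c df v : has_differential f c df -> is_derive c v f (df v).
Proof. by move=> [f1 f2]; apply: DeriveDef; [exact: diff_derivable|]. Qed.

Lemma has_differential_cvg f c df : has_differential f c df -> f x @[x --> c] --> f c.
Proof. by move=> [f1 _]; have := differentiable_continuous f1. Qed.

Lemma has_differential_cst (k : R) c : has_differential (fun=> k) c (fun=> 0).
Proof. by split; [exact: differentiable_cst|move=> v; rewrite derive_val]. Qed.

Lemma has_differentialD f g c df dg : has_differential f c df -> has_differential g c dg ->
  has_differential (fun x => f x + g x) c (fun v => df v + dg v).
Proof.
move=> hf hg; split; first exact: differentiableD hf.1 hg.1.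
move=> v; have h1 := has_differential_is_derive v hf.
by have h2 := has_differential_is_derive v hg; rewrite derive_val.
Qed.

Lemma has_differentialN f c df : has_differential f c df ->
  has_differential (fun x => - f x) c (fun v => - df v).
Proof.
move=> hf; split; first exact: differentiableN hf.1.
by move=> v; have h1 := has_differential_is_derive v hf; rewrite derive_val.
Qed.

Lemma has_differentialM f g c df dg : has_differential f c df -> has_differential g c dg ->
  has_differential (fun x => f x * g x) c (fun v => f c * dg v + g c * df v).
Proof.
move=> hf hg; split; first exact: differentiableM hf.1 hg.1.
move=> v; have h1 := has_differential_is_derive v hf.
have h2 := has_differential_is_derive v hg.
by have h3 := is_deriveM h1 h2; rewrite derive_val.
Qed.

Lemma has_differential_comp (h : R -> R) f c df (l : R) : has_differential f c df ->
  is_derive (f c) 1 h l -> has_differential (fun x => h (f x)) c (fun v => l * df v).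
Proof.
move=> [f1 f2] [h1 h2]; have dh : differentiable h (f c) by exact/derivable1_diffP.
split; first exact: differentiable_comp.
move=> v; have dc : differentiable (h \o f) c by exact: differentiable_comp.
rewrite (deriveE v dc) diff_comp // /=; rewrite -(deriveE v f1) f2.
rewrite -[df v]mulr1 -[df v * 1]/(df v *: (1 : R)) linearZ /= -deriveE // h2.
by rewrite /GRing.scale /= !mulr1 mulrC.
Qed.

Lemma has_differential_curve f (c : R -> V) s df : has_differential f (c s) df ->
  derivable c s 1 -> is_derive s 1 (fun t => f (c t)) (df ('D_1 c s)).
Proof.
move=> [f1 f2] c1; have dc : differentiable c s by exact/derivable1_diffP.
have dfc : differentiable (f \o c) s by exact: differentiable_comp.
apply: DeriveDef; first exact: diff_derivable.
by rewrite -[LHS]/('D_(1 : R) (f \o c) s) deriveE // diff_comp //= -deriveE // -deriveE // f2.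
Qed.

End HasDifferential.

Lemma has_differential_coord (R : realType) n (c : 'rV[R]_n.+1) (i : 'I_n.+1) :
  has_differential (fun c : 'rV[R]_n.+1 => c 0 i : R) c (fun v => v 0 i).
Proof.
have d : differentiable (fun c : 'rV[R]_n.+1 => c 0 i : R) c by exact: differentiable_coord.
split => // v.
have := @derive_mx _ _ _ _ id c v (@derivable_id _ _ c v).
by move/matrixP => /(_ 0 i); rewrite mxE derive_id.
Qed.

Lemma differentiable_rV (R : realType) (V : normedModType R) n (f : V -> 'rV[R]_n.+1) c :
  (forall i, differentiable (fun x => f x 0 i : R) c) -> differentiable f c.
Proof.
move=> h; have -> : f = \sum_(i < n.+1) (fun x => f x 0 i *: delta_mx 0 i).
  by apply/funext => x; rewrite fct_sumE {1}[f x]row_sum_delta.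
apply: differentiable_sum => i; exact: differentiableZl.
Qed.

(** * Branches of the angles of a chart *)

Section AngleBranch.
Variable R : realType.
Implicit Types (c v : 'rV[R]_4).

Definition angle_at (c0 c : 'rV[R]_4) (i k : 'I_4) : R :=
  angle_branch (c0 0 i) (c0 0 k) (c 0 i) (c 0 k).

(* At the origin the quotient is [x / 0 = 0], and [angle_at] is constant. *)
Definition dangle (c v : 'rV[R]_4) (i k : 'I_4) : R :=
  (c 0 i * v 0 k - c 0 k * v 0 i) / radius (c 0 i) (c 0 k) ^+ 2.

Lemma has_differential_angle_at c0 i k :
  has_differential (fun c => angle_at c0 c i k) c0 (fun v => dangle c0 v i k).
Proof.
rewrite /angle_at /angle_branch /dangle.
set a := c0 0 i; set b := c0 0 k.
have [r0|r0] := eqVneq (radius a b) 0.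
  have := radius_sqr a b; rewrite r0 expr0n /= => /esym/eqP.
  rewrite paddr_eq0 ?sqr_ge0 // !sqrf_eq0 => /andP[/eqP a0 /eqP b0].
  rewrite a0 b0; apply: has_differential_eq; last by move=> v /=; rewrite invr0 mulr0.
  rewrite (_ : (fun c : 'rV[R]_4 => _) = (fun=> angle 0 0 + atan 0)); first exact: has_differential_cst.
  by apply/funext => c; rewrite !mul0r addr0 invr0 mulr0.
have d0 : a * a + b * b != 0 by rewrite -!expr2 -radius_sqr expf_neq0.
have hn : has_differential (fun c : 'rV[R]_4 => a * c 0 k - b * c 0 i) c0
    (fun v => a * v 0 k - b * v 0 i).
  have h1 := has_differentialM (has_differential_cst a c0) (has_differential_coord c0 k).
  have h2 := has_differentialM (has_differential_cst b c0) (has_differential_coord c0 i).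
  apply: has_differential_eq (has_differentialD h1 (has_differentialN h2)) _ => v /=.
  by ring.
have hd : has_differential (fun c : 'rV[R]_4 => a * c 0 i + b * c 0 k) c0
    (fun v => a * v 0 i + b * v 0 k).
  have h1 := has_differentialM (has_differential_cst a c0) (has_differential_coord c0 i).
  have h2 := has_differentialM (has_differential_cst b c0) (has_differential_coord c0 k).
  apply: has_differential_eq (has_differentialD h1 h2) _ => v /=.
  by ring.
have hV := has_differential_comp hd (is_deriveV (f := id) d0 (is_derive_id _ _)).
have hq := has_differentialM hn hV.
(* At the base point the argument of [atan] is [0], where [atan] has derivative [1]. *)
have q0 : (a * c0 0 k - b * c0 0 i) * id (a * c0 0 i + b * c0 0 k)^-1 = 0.
  by rewrite -/a -/b /= (mulrC b a) subrr mul0r.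
have ha := has_differential_comp hq (is_derive1_atan _).
have hs := has_differentialD (has_differential_cst (angle a b) c0) ha.
apply: has_differential_eq hs _ => v /=.
rewrite q0 -/a -/b radius_sqr expr0n /= addr0 invr1 mul1r add0r.
rewrite (mulrC b a) subrr mul0r add0r mulrC -!expr2.
by [].
Qed.

Lemma angle_at_near c0 i k : radius (c0 0 i) (c0 0 k) != 0 ->
  \forall c \near c0, exists K : int,
    angle ((c : 'rV[R]_4) 0 i) (c 0 k) = angle_at c0 c i k + 2 * pi * K%:~R.
Proof.
move=> r0.
have cont : c0 0 i * (c : 'rV[R]_4) 0 i + c0 0 k * c 0 k @[c --> c0] --> radius (c0 0 i) (c0 0 k) ^+ 2.
  have M (j : 'I_4) := has_differentialM (has_differential_cst (c0 0 j) c0) (has_differential_coord c0 j).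
  by rewrite radius_sqr !expr2; exact: has_differential_cvg (has_differentialD (M i) (M k)).
have : \forall c \near c0, 0 < c0 0 i * (c : 'rV[R]_4) 0 i + c0 0 k * c 0 k.
  by apply: (cvgr_gt _ cont); rewrite exprn_even_gt0.
by apply: filterS => c; exact: angle_branchP.
Qed.

End AngleBranch.

(** * The coordinates [x], [y], [z] expressed in the charts *)

Section Charts.
Variables (R : realType) (alpha : R) (e : nat -> int).
Hypothesis e3 : forall j, (1 <= j)%N -> 3 <= e j.
Hypothesis alpha_mcf : has_mcf_expansion e alpha.
Implicit Types (k : chart_index) (c v : 'rV[R]_4).

Definition chart_x k c : R :=
  if k is Corner j then corner_x e j c else c 0 0.

Definition chart_y k c : R :=
  match k with
  | Interior => c 0 1
  | Edge _ _ => radius (c 0 2) (c 0 3)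
  | Corner _ => corner_y c
  end.

(** The square of [chart_y]: polynomial in every chart, hence differentiable also where [y = 0]. *)
Definition chart_q k c : R :=
  match k with
  | Interior => c 0 1 * c 0 1
  | Edge _ _ => c 0 2 * c 0 2 + c 0 3 * c 0 3
  | Corner _ => 4 * ((c 0 0 * c 0 0 + c 0 1 * c 0 1) * (c 0 2 * c 0 2 + c 0 3 * c 0 3))
  end.

(** One template for the chosen angles, for their branches based at a point, and for the
    differentials of the angles; in the last use [c] is a tangent vector. *)
Definition pair_of (f : 'I_4 -> 'I_4 -> R) k c : R * R :=
  match k with
  | Interior => (c 0 2, c 0 3)
  | Edge j pq => f 2 3 *: labelR R e j + c 0 1 *: (pq.1%:~R, pq.2%:~R)
  | Corner j => f 0 1 *: labelR R e j + f 2 3 *: labelR R e j.+1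
  end.

Definition chart_z k c := pair_of (fun i l => angle (c 0 i) (c 0 l)) k c.
Definition chart_z_at c0 k c := pair_of (angle_at c0 c) k c.

Definition dchart_x k c v : R :=
  if k is Corner _ then 2 * (c 0 2 * v 0 2 + c 0 3 * v 0 3) - 2 * (c 0 0 * v 0 0 + c 0 1 * v 0 1)
  else v 0 0.

Definition dchart_q k c v : R :=
  match k with
  | Interior => 2 * (c 0 1 * v 0 1)
  | Edge _ _ => 2 * (c 0 2 * v 0 2 + c 0 3 * v 0 3)
  | Corner _ => 8 * ((c 0 0 * v 0 0 + c 0 1 * v 0 1) * (c 0 2 * c 0 2 + c 0 3 * c 0 3)
      + (c 0 0 * c 0 0 + c 0 1 * c 0 1) * (c 0 2 * v 0 2 + c 0 3 * v 0 3))
  end.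

Definition dchart_z k c v := pair_of (dangle c v) k v.

Lemma chart_mapE k c : chart_map alpha e k c =
  mpoint alpha e (chart_x k c) (chart_y k c) (chart_z k c).
Proof. by case: k. Qed.

Lemma chart_qE k c : chart_q k c = chart_y k c ^+ 2.
Proof.
case: k => [|j pq|j] /=; first by rewrite expr2.
  by rewrite radius_sqr !expr2.
by rewrite /corner_y !exprMn !radius_sqr !expr2; ring.
Qed.

Lemma chart_dom_x k c : chart_dom alpha e k c -> alpha < chart_x k c.
Proof.
case: k => [|j pq|j] /=; first by case.
  case=> _ /andP[+ _]; rewrite lte_fin; apply: lt_trans; exact: corner_gt.
move=> /andP[+ _]; rewrite lte_fin; apply: lt_trans; exact: corner_gt.
Qed.

Lemma chart_dom_y k c : chart_dom alpha e k c -> 0 <= chart_y k c.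
Proof.
case: k => [|j pq|j] /=; first by case=> _ /ltW.
  by move=> _; exact: radius_ge0.
by move=> _; rewrite /corner_y !mulr_ge0 // radius_ge0.
Qed.

Lemma has_differential_chart_x k c : has_differential (chart_x k) c (dchart_x k c).
Proof.
case: k => [|j pq|j]; [exact: has_differential_coord..|].
rewrite /chart_x (_ : corner_x e j = fun c : 'rV[R]_4 => corner R e j +
  (c 0 2 * c 0 2 + c 0 3 * c 0 3) + - (c 0 0 * c 0 0 + c 0 1 * c 0 1)); last first.
  by apply/funext => c'; rewrite /corner_x !radius_sqr -!expr2.
have sq i := has_differentialM (has_differential_coord c i) (has_differential_coord c i).
have h := has_differentialD (has_differentialD (has_differential_cst (corner R e j) c)
  (has_differentialD (sq 2) (sq 3))) (has_differentialN (has_differentialD (sq 0) (sq 1))).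
by apply: has_differential_eq h _ => v /=; ring.
Qed.

Lemma has_differential_chart_q k c : has_differential (chart_q k) c (dchart_q k c).
Proof.
have sq i := has_differentialM (has_differential_coord c i) (has_differential_coord c i).
case: k => [|j pq|j].
- by apply: has_differential_eq (sq 1) _ => v /=; ring.
- by apply: has_differential_eq (has_differentialD (sq 2) (sq 3)) _ => v /=; ring.
- have h := has_differentialM (has_differential_cst 4 c) (has_differentialM
    (has_differentialD (sq 0) (sq 1)) (has_differentialD (sq 2) (sq 3))).
  by apply: has_differential_eq h _ => v /=; ring.
Qed.

Lemma has_differential_chart_y k c : 0 < chart_y k c ->
  has_differential (chart_y k) c (fun v => dchart_q k c v / (2 * chart_y k c)).
Proof.
move=> y0.
have q0 : 0 < chart_q k c by rewrite chart_qE exprn_gt0.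
have h := has_differential_comp (has_differential_chart_q k c) (is_derive1_sqrt q0).
have sE : Num.sqrt (chart_q k c) = chart_y k c by rewrite chart_qE sqrtr_sqr gtr0_norm.
case: k y0 q0 h sE => [|j pq|j] y0 q0 h sE.
- apply: has_differential_eq (has_differential_coord c 1) _ => v /=.
  by rewrite /= in y0; field; rewrite gt_eqF.
- have -> : chart_y (Edge j pq) = (fun c => Num.sqrt (chart_q (Edge j pq) c)).
    by apply/funext => c'; rewrite chart_qE sqrtr_sqr ger0_norm //= radius_ge0.
  by apply: has_differential_eq h _ => v; rewrite sE mulrC.
- have -> : chart_y (Corner j) = (fun c => Num.sqrt (chart_q (Corner j) c)).
    apply/funext => c'; rewrite chart_qE sqrtr_sqr ger0_norm //= /corner_y.
    by rewrite !mulr_ge0 // radius_ge0.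
  by apply: has_differential_eq h _ => v; rewrite sE mulrC.
Qed.

(** Free coefficients cover both components of [z] and its pairing with a label. *)
Lemma has_differential_chart_z k c (l1 l2 : R) :
  has_differential (fun c' => l1 * (chart_z_at c k c').1 + l2 * (chart_z_at c k c').2) c
    (fun v => l1 * (dchart_z k c v).1 + l2 * (dchart_z k c v).2).
Proof.
have K (a : R) := has_differential_cst a c.
have X i := has_differential_coord c i.
have A i l := has_differential_angle_at c i l.
have D := has_differentialD; have M := has_differentialM.
rewrite /chart_z_at /dchart_z /pair_of; case: k => [|j pq|j] /=.
- apply: has_differential_eq (D _ _ _ _ _ _ _ (M _ _ _ _ _ _ _ (K l1) (X 2)) (M _ _ _ _ _ _ _ (K l2) (X 3))) _.
  by move=> v /=; ring.
- have Z (p r : R) := D _ _ _ _ _ _ _ (M _ _ _ _ _ _ _ (A 2 3) (K p)) (M _ _ _ _ _ _ _ (X 1) (K r)).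
  apply: has_differential_eq (D _ _ _ _ _ _ _ (M _ _ _ _ _ _ _ (K l1) (Z _ _)) (M _ _ _ _ _ _ _ (K l2) (Z _ _))) _.
  by move=> v /=; rewrite /GRing.scale /=; ring.
- have Z (p r : R) := D _ _ _ _ _ _ _ (M _ _ _ _ _ _ _ (A 0 1) (K p)) (M _ _ _ _ _ _ _ (A 2 3) (K r)).
  apply: has_differential_eq (D _ _ _ _ _ _ _ (M _ _ _ _ _ _ _ (K l1) (Z _ _)) (M _ _ _ _ _ _ _ (K l2) (Z _ _))) _.
  by move=> v /=; rewrite /GRing.scale /=; ring.
Qed.

End Charts.

(** * Quadratic forms depending continuously on a point *)

Section Bilin.
Variable R : realType.
Implicit Types (A : 'M[R]_4) (v w : 'rV[R]_4).

Lemma bilinE A v w : bilin A v w = \sum_j \sum_i v 0 i * A i j * w 0 j.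
Proof.
rewrite /bilin mxE; apply: eq_bigr => j _; rewrite !mxE mulr_suml.
by apply: eq_bigr.
Qed.

Lemma bilin_scale A (a : R) v : bilin A (a *: v) (a *: v) = a ^+ 2 * bilin A v v.
Proof.
rewrite !bilinE mulr_sumr; apply: eq_bigr => j _; rewrite mulr_sumr.
by apply: eq_bigr => i _; rewrite !mxE; ring.
Qed.

Lemma cvg_bilin T (F : set_system T) (FF : Filter F) (A : T -> 'M[R]_4)
    (v : T -> 'rV[R]_4) A0 v0 :
  (forall i j, A x i j @[x --> F] --> A0 i j) ->
  (forall i, v x 0 i @[x --> F] --> v0 0 i) ->
  bilin (A x) (v x) (v x) @[x --> F] --> bilin A0 v0 v0.
Proof.
move=> hA hv; rewrite bilinE.
under eq_fun do rewrite bilinE.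
apply: cvg_big => [|j _]; first exact: add_continuous.
apply: cvg_big => [|i _]; first exact: add_continuous.
by apply: cvgM => //; apply: cvgM.
Qed.

Lemma normr_coord_le v i : `|v 0 i| <= `|v|.
Proof.
rewrite [leRHS]/Num.Def.normr /= mx_normrE.
exact: (le_bigmax _ (fun ij : 'I_1 * 'I_4 => `|v ij.1 ij.2|) (0, i)).
Qed.

(** The minimum of the form at [x0] on the compact unit sphere of the sup norm survives small
    changes of the matrix; homogeneity carries the bound to all vectors. *)
Lemma positive_definite_near (X : topologicalType) (x0 : X) (G : X -> 'M[R]_4) :
  (forall i j, G x i j @[x --> x0] --> G x0 i j) ->
  (forall v, v != 0 -> 0 < bilin (G x0) v v) ->
  exists2 kappa : R, 0 < kappa &
    \forall x \near x0, forall v i, kappa * v 0 i ^+ 2 <= bilin (G x) v v.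
Proof.
move=> contG pos.
pose S : set 'rV[R]_4 := [set v | `|v| = 1].
have S0 : S !=set0.
  exists (const_mx 1); rewrite /S /= [LHS]/Num.Def.normr /= mx_normrE.
  apply/eqP; rewrite eq_le; apply/andP; split.
    by apply: bigmax_le => // -[i j] _; rewrite mxE normr1.
  have := le_bigmax 0 (fun ij : 'I_1 * 'I_4 => `|(const_mx 1 : 'rV[R]_4) ij.1 ij.2|) (0, 0).
  by rewrite /= mxE normr1.
have Scompact : compact S.
  apply: bounded_closed_compact.
    by exists 1; split; [exact: num_real|move=> M M1 v /= ->; exact: ltW].
  rewrite (_ : S = (fun v : 'rV[R]_4 => `|v|) @^-1` [set 1]) //.
  apply: preimage_closed; last exact: closed_eq.
  by move=> v _; exact: norm_continuous.
have cS : {within S, continuous (fun v => bilin (G x0) v v)}.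
  apply: continuous_subspaceT => v.
  apply: (@cvg_bilin _ (nbhs v) _ (fun=> G x0) id) => [i j|i]; first exact: cvg_cst.
  exact: coord_continuous.
have [v0 v0S vmin] := EVT_min_rV S0 Scompact cS.
set mu := bilin (G x0) v0 v0 in vmin.
have mu0 : 0 < mu.
  by apply: pos; rewrite -normr_gt0; move: v0S; rewrite inE => /= ->.
exists (mu / 2); first by rewrite divr_gt0.
(* Sixteen entries, each moved by at most [mu / 32], move the form on the unit sphere by at most
   [mu / 2]. *)
have near_entry : \forall x \near x0, forall i j, `|G x i j - G x0 i j| <= mu / 32.
  have m32 : 0 < mu / 32 by rewrite divr_gt0.
  have h i j : \forall x \near x0, `|G x i j - G x0 i j| <= mu / 32.
    by have /cvgrPdist_le/(_ _ m32) := contG i j; apply: filterS => x; rewrite distrC.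
  by apply: filter_forall => i; apply: filter_forall => j; exact: h.
apply: filterS near_entry => x hx.
have unit_bound w : `|w| = 1 -> mu / 2 <= bilin (G x) w w.
  move=> w1; have wS : w \in S by rewrite inE.
  have := vmin _ wS; rewrite -/mu => h.
  suff : `|bilin (G x) w w - bilin (G x0) w w| <= mu / 2.
    by rewrite ler_norml => /andP[]; lra.
  rewrite !bilinE -sumrB; apply: le_trans (ler_norm_sum _ _ _) _.
  have -> : mu / 2 = \sum_(j < 4) (mu / 8).
    by rewrite sumr_const card_ord -[_ *+ 4]mulr_natl; field.
  apply: ler_sum => j _; rewrite -sumrB; apply: le_trans (ler_norm_sum _ _ _) _.
  have -> : mu / 8 = \sum_(j < 4) (mu / 32).
    by rewrite sumr_const card_ord -[_ *+ 4]mulr_natl; field.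
  apply: ler_sum => i _.
  rewrite (_ : _ - _ = w 0 i * (G x i j - G x0 i j) * w 0 j); last ring.
  rewrite !normrM; have := hx i j; have := normr_coord_le w i; have := normr_coord_le w j.
  rewrite w1 => h1 h2 h3.
  rewrite -[leRHS]mulr1; apply: ler_pM => //; rewrite -[leRHS]mul1r; exact: ler_pM.
move=> v i; have [->|v_neq0] := eqVneq v 0.
  by rewrite mxE expr0n mulr0 bilinE big1 // => j _; rewrite big1 // => l _; rewrite mxE !mul0r.
have nv0 : 0 < `|v| by rewrite normr_gt0.
have -> : v = `|v| *: (`|v|^-1 *: v) by rewrite scalerA divff ?scale1r // gt_eqF.
rewrite bilin_scale mxE; set w := `|v|^-1 *: v.
have w1 : `|w| = 1 by rewrite /w normrZ normfV normr_id mulVf // gt_eqF.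
rewrite exprMn mulrCA; apply: ler_wpM2l; first exact: sqr_ge0.
apply: le_trans (unit_bound _ w1).
rewrite -[leRHS]mulr1; apply: ler_wpM2l; first lra.
have := normr_coord_le w i; rewrite w1 => h.
by rewrite -[_ ^+ 2]real_normK ?num_real // expr_le1.
Qed.

End Bilin.

(** * The metric in the charts *)

Lemma near_point (T : topologicalType) (x : T) (P : T -> Prop) :
  (forall y, P y) -> \forall y \near x, P y.
Proof. by move=> h; exact: (@filterE _ (nbhs x)). Qed.

Lemma cvg_sqr (R : realType) (T : Type) (F : set_system T) {FF : Filter F} (f : T -> R) (l : R) :
  f x @[x --> F] --> l -> f x ^+ 2 @[x --> F] --> l ^+ 2.
Proof. by move=> h; rewrite expr2; exact: cvgM. Qed.

Section ChartLimits.
Variables (R : realType) (e : nat -> int) (T : Type) (F : set_system T) (FF : Filter F).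
Variables (c v : T -> 'rV[R]_4) (c0 v0 : 'rV[R]_4).
Hypothesis cvg_c : forall i, c x 0 i @[x --> F] --> c0 0 i.
Hypothesis cvg_v : forall i, v x 0 i @[x --> F] --> v0 0 i.
Implicit Types k : chart_index.

Let cst_ (a : R) : a @[_ --> F] --> a. Proof. exact: cvg_cst. Qed.
Let dot (i j : 'I_4) := cvgD (cvgM (@cvg_c i) (@cvg_v i)) (cvgM (@cvg_c j) (@cvg_v j)).
Let sq (i j : 'I_4) := cvgD (cvgM (@cvg_c i) (@cvg_c i)) (cvgM (@cvg_c j) (@cvg_c j)).

(** The general filter serves two limits: towards a point of a chart with a fixed vector, and along
    a curve with its velocity. *)
Lemma cvg_dchart_x k : dchart_x k (c x) (v x) @[x --> F] --> dchart_x k c0 v0.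
Proof.
case: k => [|j pq|j]; [exact: cvg_v..|].
rewrite /dchart_x; exact: (cvgB (cvgM (@cst_ 2) (@dot 2 3)) (cvgM (@cst_ 2) (@dot 0 1))).
Qed.

Lemma cvg_dchart_q k : dchart_q k (c x) (v x) @[x --> F] --> dchart_q k c0 v0.
Proof.
case: k => [|j pq|j].
- exact: (cvgM (@cst_ 2) (cvgM (@cvg_c 1) (@cvg_v 1))).
- exact: (cvgM (@cst_ 2) (@dot 2 3)).
- exact: (cvgM (@cst_ 8) (cvgD (cvgM (@dot 0 1) (@sq 2 3)) (cvgM (@sq 0 1) (@dot 2 3)))).
Qed.

Lemma cvg_dangle i j : radius (c0 0 i) (c0 0 j) != 0 ->
  dangle (c x) (v x) i j @[x --> F] --> dangle c0 v0 i j.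
Proof.
move=> r0.
have n : c x 0 i * v x 0 j - c x 0 j * v x 0 i @[x --> F] --> c0 0 i * v0 0 j - c0 0 j * v0 0 i.
  exact: cvgB (cvgM (@cvg_c i) (@cvg_v j)) (cvgM (@cvg_c j) (@cvg_v i)).
have d : radius (c x 0 i) (c x 0 j) ^+ 2 @[x --> F] --> radius (c0 0 i) (c0 0 j) ^+ 2.
  rewrite radius_sqr; under eq_fun do rewrite radius_sqr.
  exact: (cvgD (cvg_sqr (@cvg_c i)) (cvg_sqr (@cvg_c j))).
have q0 : radius (c0 0 i) (c0 0 j) ^+ 2 != 0 by rewrite expf_neq0.
have dV : (radius (c x 0 i) (c x 0 j) ^+ 2)^-1 @[x --> F] --> (radius (c0 0 i) (c0 0 j) ^+ 2)^-1.
  exact: cvgV.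
exact: (cvgM n dV).
Qed.

End ChartLimits.

(** * Labels and the determinant pairing *)

Section Labels.
Variables (R : realType) (e : nat -> int).
Hypothesis e3 : forall j, (1 <= j)%N -> 3 <= e j.
Local Notation L := (labelR R e).
Implicit Types z : R * R.

Lemma epsD z z1 z2 (a b : R) : eps z (a *: z1 + b *: z2) = a * eps z z1 + b * eps z z2.
Proof. by rewrite /eps /= /GRing.scale /=; ring. Qed.

Lemma epsvv z : eps z z = 0.
Proof. by rewrite /eps mulrC subrr. Qed.

Lemma eps_succ j : eps (L j) (L j.+1) = 1.
Proof. by rewrite /eps /= (mulrC (nR R e j)); exact: mnR_det. Qed.

Lemma eps_label_int j i : exists K : int, eps (L j) (L i) = K%:~R.
Proof.
exists ((mn e j).1 * (mn e i).2 - (mn e j).2 * (mn e i).1).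
by rewrite /eps /= /mR /nR rmorphB !rmorphM.
Qed.

Lemma pair_mulz (a b s : int) : (a, b) *~ s = (a * s, b * s) :> (int * int)%type.
Proof.
have nat_case (n : nat) : (a, b) *+ n = (a * n%:Z, b * n%:Z) :> (int * int)%type.
  elim: n => [|n IH]; first by rewrite mulr0n !mulr0.
  by rewrite mulrS IH; congr pair; rewrite /= intS; ring.
case: s => n; first exact: nat_case.
rewrite -[LHS]/(- ((a, b) *+ n.+1)) nat_case NegzE.
by congr pair; rewrite /= mulrN.
Qed.

(** Cramer's rule with determinant [1]; it makes the next label available as the second basis vector
    of the chart [Edge j]. *)
Lemma is_Zbasis_succ j : is_Zbasis (mn e j) (mn e j.+1).
Proof.
have det := mn_det e3 j; move: det; case: (mn e j) (mn e j.+1) => [a b] [c d] /= det w.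
have solve (s t : int) : w = (a, b) *~ s + (c, d) *~ t <-> w = (a * s + c * t, b * s + d * t).
  suff -> : (a, b) *~ s + (c, d) *~ t = (a * s + c * t, b * s + d * t) by [].
  by rewrite !pair_mulz.
case: w solve => w1 w2 solve; exists (w1 * d - c * w2, a * w2 - w1 * b); split => /=.
  apply/solve; congr pair.
    by rewrite -[LHS]mulr1 -det; ring.
  by rewrite -[LHS]mulr1 -det; ring.
move=> [s t] /= /solve[-> ->]; congr pair.
  by rewrite -[RHS]mulr1 -det; ring.
by rewrite -[RHS]mulr1 -det; ring.
Qed.

End Labels.

Section Metric.
Variables (R : realType) (alpha : R) (e : nat -> int).
Hypothesis e3 : forall j, (1 <= j)%N -> 3 <= e j.
Hypothesis alpha_mcf : has_mcf_expansion e alpha.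
Variable g : chart_index -> 'rV[R]_4 -> 'M[R]_4.
Hypothesis g_riem : riemannian_metric alpha e g.
Hypothesis g_ext : extends_g_alpha alpha e g.
Implicit Types (k : chart_index) (c v : 'rV[R]_4) (z : R * R).

Local Notation chart_x := (chart_x e).
Local Notation dom := (chart_dom alpha e).

Definition lattice_eq z z' := exists K L : int, z' - z + (2 * pi) *: (K%:~R, L%:~R) = 0.

Lemma mpoint_lattice x y z z' : alpha < x -> 0 <= y -> lattice_eq z z' ->
  mpoint alpha e x y z = mpoint alpha e x y z'.
Proof.
move=> ax y0 [K [L h]]; apply/mpoint_eqP => //; split => //.
by exists K, L; rewrite h; exact: collapsed0.
Qed.

Lemma near_chart_dom k c : dom k c -> \forall c' \near c, dom k c'.
Proof.
have cx : chart_x k c' @[c' --> c] --> chart_x k c.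
  exact: has_differential_cvg (has_differential_chart_x e k c).
have near_gt a : (a%:E < (chart_x k c)%:E)%E -> \forall c' \near c, (a%:E < (chart_x k c')%:E)%E.
  by rewrite lte_fin => h; apply: filterS (cvgr_gt _ cx _ h) => c'; rewrite lte_fin.
have near_lt j : ((chart_x k c)%:E < corner_pred R e j)%E ->
    \forall c' \near c, ((chart_x k c')%:E < corner_pred R e j)%E.
  case: j => [|j] /=; first by move=> _; apply: near_point => c'; exact: ltry.
  by rewrite lte_fin => h; apply: filterS (cvgr_lt _ cx _ h) => c'; rewrite lte_fin.
case: k cx near_gt near_lt => [|j pq|j] cx near_gt near_lt /=.
- move=> [h1 h2]; have := near_gt alpha; rewrite !lte_fin => /(_ h1) n1.
  have n2 : \forall c' \near c, 0 < (c' : 'rV[R]_4) 0 1.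
    exact: (cvgr_gt _ (has_differential_cvg (has_differential_coord c 1)) _ h2).
  by apply: filterS2 n1 n2 => c'; rewrite lte_fin.
- move=> [zb /andP[h1 h2]]; apply: filterS2 (near_gt _ h1) (near_lt _ h2) => c' h3 h4.
  by split => //; apply/andP.
- move=> /andP[h1 h2]; apply: filterS2 (near_gt _ h1) (near_lt _ h2) => c' h3 h4.
  exact/andP.
Qed.

(** A chosen angle and its branch differ by [2 pi K], and [K] times a label is integral. For [y > 0]
    every angle of the chart is defined at [c]. *)
Lemma chart_z_near k c : 0 < chart_y k c ->
  \forall c' \near c, lattice_eq (chart_z_at e c k c') (chart_z e k c').
Proof.
case: k => [|j pq|j] /= y0.
- by apply: near_point => c'; exists 0, 0; rewrite subrr add0r scaler0.
- have r0 : radius (c 0 2) (c 0 3) != 0 by rewrite gt_eqF.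
  apply: filterS (angle_at_near r0) => c' [K hK].
  exists (- K * (mn e j).1), (- K * (mn e j).2).
  rewrite /chart_z_at /chart_z /pair_of hK !rmorphM !rmorphN /=.
  by congr pair; rewrite /= /GRing.scale /= /labelR /mR /nR /=; ring.
- have r0 : radius (c 0 0) (c 0 1) != 0.
    by apply/eqP => r0; move: y0; rewrite /corner_y r0 mulr0 mul0r ltxx.
  have r1 : radius (c 0 2) (c 0 3) != 0.
    by apply/eqP => r1; move: y0; rewrite /corner_y r1 mulr0 ltxx.
  apply: filterS2 (angle_at_near r0) (angle_at_near r1) => c' [K hK] [L hL].
  exists (- K * (mn e j).1 - L * (mn e j.+1).1), (- K * (mn e j).2 - L * (mn e j.+1).2).
  rewrite /chart_z_at /chart_z /pair_of hK hL !rmorphB !rmorphM !rmorphN /=.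
  by congr pair; rewrite /= /GRing.scale /= /labelR /mR /nR /=; ring.
Qed.

Lemma angle_at_base c i l : angle_at c c i l = angle (c 0 i) (c 0 l).
Proof. exact: angle_branch_base. Qed.

Lemma chart_z_base k c : chart_z_at e c k c = chart_z e k c.
Proof. by case: k => [|j pq|j]; rewrite /chart_z_at /chart_z /pair_of ?angle_at_base. Qed.

(** The transformation law for the local map [tau] into the chart [Interior]. Using the branches
    based at [c] makes [tau] differentiable there; [dchart_q / (2 * chart_y)] is the differential of
    [y]. *)
Lemma metric_chartE k c v : dom k c -> 0 < chart_y k c ->
  bilin (g k c) v v = g_alpha alpha e (chart_x k c) (chart_y k c)
    (dchart_x k c v) (dchart_q k c v / (2 * chart_y k c)) (dchart_z e k c v).
Proof.
move=> kc y0.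
pose tau c' : 'rV[R]_4 := \row_i nth 0
  [:: chart_x k c'; chart_y k c'; (chart_z_at e c k c').1; (chart_z_at e c k c').2] i.
pose dtau v : 'rV[R]_4 := \row_i nth 0
  [:: dchart_x k c v; dchart_q k c v / (2 * chart_y k c);
      (dchart_z e k c v).1; (dchart_z e k c v).2] i.
have hz1 : has_differential (fun c' => (chart_z_at e c k c').1) c (fun v => (dchart_z e k c v).1).
  rewrite (_ : (fun c' => _) = (fun c' => 1 * (chart_z_at e c k c').1 + 0 * (chart_z_at e c k c').2)).
    by apply: has_differential_eq (has_differential_chart_z e k c 1 0) _ => w; ring.
  by apply/funext => c'; ring.
have hz2 : has_differential (fun c' => (chart_z_at e c k c').2) c (fun v => (dchart_z e k c v).2).
  rewrite (_ : (fun c' => _) = (fun c' => 0 * (chart_z_at e c k c').1 + 1 * (chart_z_at e c k c').2)).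
    by apply: has_differential_eq (has_differential_chart_z e k c 0 1) _ => w; ring.
  by apply/funext => c'; ring.
have htau i : has_differential (fun c' => tau c' 0 i) c (fun v => dtau v 0 i).
  have -> : (fun c' => tau c' 0 i) = (fun c' => nth 0
    [:: chart_x k c'; chart_y k c'; (chart_z_at e c k c').1; (chart_z_at e c k c').2] i).
    by apply/funext => c'; rewrite mxE.
  apply: (@has_differential_eq _ _ _ _ (fun v => nth 0
    [:: dchart_x k c v; dchart_q k c v / (2 * chart_y k c);
      (dchart_z e k c v).1; (dchart_z e k c v).2] i)); last by move=> w; rewrite mxE.
  case: i => -[|[|[|[|i]]]] //= _.
  - exact: has_differential_chart_x.
  - exact: has_differential_chart_y.
have dtauc : differentiable tau c by apply: differentiable_rV => i; exact: (htau i).1.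
have Dtau : 'D_v tau c = dtau v.
  rewrite derive_mx; last exact: diff_derivable.
  by apply/matrixP => i j; rewrite mxE (ord1 i) (htau j).2.
have tau_dom : dom Interior (tau c).
  by rewrite /= !mxE /=; split => //; exact: chart_dom_x kc.
have near_eq : \forall c' \near c, chart_map alpha e Interior (tau c') = chart_map alpha e k c'.
  apply: filterS2 (near_chart_dom kc) (chart_z_near y0) => c' kc' zc'.
  rewrite !chart_mapE /= !mxE /= -surjective_pairing.
  by apply: mpoint_lattice => //; [exact: chart_dom_x kc'|exact: chart_dom_y kc'].
have gE := riem_compat g_riem kc tau_dom dtauc near_eq v v.
rewrite Dtau in gE; rewrite gE (g_ext (dtau v) tau_dom).
have [t0 t1] : tau c 0 0 = chart_x k c /\ tau c 0 1 = chart_y k c by rewrite !mxE.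
have [d0 d1] : dtau v 0 0 = dchart_x k c v /\
  dtau v 0 1 = dchart_q k c v / (2 * chart_y k c) by rewrite !mxE.
have d23 : (dtau v 0 2, dtau v 0 3) = dchart_z e k c v.
  by rewrite !mxE -surjective_pairing.
by rewrite t0 t1 d0 d1 d23.
Qed.

(** Inequalities proved from the formula, hence over [y > 0], are carried to the edges and corners
    by this density argument. *)
Lemma chart_dense (F G : 'rV[R]_4 -> R) k c : dom k c ->
  F c' @[c' --> c] --> F c -> G c' @[c' --> c] --> G c ->
  (\forall c' \near c, dom k c' -> 0 < chart_y k c' -> F c' <= G c') -> F c <= G c.
Proof.
move=> kc cF cG FG.
(* Moving along [(1, 1, 1, 1)] makes all coordinates nonzero for small [eps != 0], hence all radii
   positive. *)
pose path (eps : R) : 'rV[R]_4 := c + eps *: const_mx 1.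
have path0 : path eps @[eps --> (0 : R)^'] --> c.
  have -> : nbhs c = nbhs (path 0) by rewrite /path scale0r addr0.
  apply: cvg_within_filter; apply: cvgD; first exact: cvg_cst.
  by apply: cvgZ; [exact: cvg_id|exact: cvg_cst].
have coord_neq0 (i : 'I_4) : \forall eps \near (0 : R)^', path eps 0 i != 0.
  have [ci0|ci0] := eqVneq (c 0 i) 0.
    near=> eps; rewrite !mxE ci0 add0r mulr1; near: eps; exact: nbhs_dnbhs_neq.
  have hc : path eps 0 i @[eps --> (0 : R)^'] --> c 0 i.
    exact: (cvg_comp _ _ path0 (has_differential_cvg (has_differential_coord c i))).
  exact: (cvgr_neq0 _ hc ci0).
have near_y : \forall eps \near (0 : R)^', dom k (path eps) -> 0 < chart_y k (path eps).
  have rpos a b : a != 0 -> 0 < radius a b :> R.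
    by move=> a0; rewrite (lt_le_trans _ (normr_le_radius a b)) // normr_gt0.
  near=> eps; case: (k) => [|j pq|j] /=; first by case.
    by move=> _; apply: rpos; near: eps; exact: coord_neq0.
  move=> _; rewrite /corner_y !mulr_gt0 //; apply: rpos; near: eps; exact: coord_neq0.
have le_path : \forall eps \near (0 : R)^', F (path eps) <= G (path eps).
  have n1 : \forall eps \near (0 : R)^', dom k (path eps) by exact: path0 _ (near_chart_dom kc).
  have n2 : \forall eps \near (0 : R)^', dom k (path eps) -> 0 < chart_y k (path eps) ->
    F (path eps) <= G (path eps) by exact: path0 _ FG.
  apply: filterS3 n1 n2 near_y => eps h1 h2 h3; exact: h2 h1 (h3 h1).
exact: (ler_cvg_to (cvg_comp _ _ path0 cF) (cvg_comp _ _ path0 cG) le_path).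
Unshelve. all: by end_near. Qed.

Lemma cvg_metric k c i j : dom k c -> g k c' i j @[c' --> c] --> g k c i j.
Proof. by move=> kc; have [sm _ _ _] := g_riem; have := sm k i j 0%N c kc. Qed.

Lemma cvg_bilin_metric k c v : dom k c ->
  bilin (g k c') v v @[c' --> c] --> bilin (g k c) v v.
Proof.
move=> kc; apply: (@cvg_bilin _ _ (nbhs c) _ (g k) (fun=> v)) => [i j|i].
  exact: cvg_metric.
exact: cvg_cst.
Qed.

Lemma bilin_metric_ge0 k c v : dom k c -> 0 <= bilin (g k c) v v.
Proof.
move=> kc; have [->|v0] := eqVneq v 0; last exact/ltW/(riem_pos g_riem).
by rewrite bilinE big1 // => j _; rewrite big1 // => i _; rewrite mxE !mul0r.
Qed.

Let coord_cvg c (i : 'I_4) : (c' : 'rV[R]_4) 0 i @[c' --> c] --> c 0 i.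
Proof. exact: has_differential_cvg (has_differential_coord c i). Qed.

Let const_cvg c v (i : 'I_4) : (v : 'rV[R]_4) 0 i @[c' --> c] --> v 0 i.
Proof. exact: has_differential_cvg (has_differential_cst (v 0 i) c). Qed.

Let near_dchart_x k c v : dchart_x k c' v @[c' --> c] --> dchart_x k c v.
Proof. exact: (@cvg_dchart_x R _ (nbhs c) _ id (fun=> v) c v (@coord_cvg c) (@const_cvg c v) k). Qed.

Let near_dchart_q k c v : dchart_q k c' v @[c' --> c] --> dchart_q k c v.
Proof. exact: (@cvg_dchart_q R _ (nbhs c) _ id (fun=> v) c v (@coord_cvg c) (@const_cvg c v) k). Qed.

Let cvg_factor k c : 4 * (chart_x k c' - alpha) ^+ 2 @[c' --> c] --> 4 * (chart_x k c - alpha) ^+ 2.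
Proof.
have X := has_differentialD (has_differential_chart_x e k c) (has_differential_cst (- alpha) c).
exact: has_differential_cvg (has_differentialM (has_differential_cst 4 c) (has_differentialM X X)).
Qed.

Lemma dchart_x_le k c v : dom k c ->
  dchart_x k c v ^+ 2 <= 4 * (chart_x k c - alpha) ^+ 2 * bilin (g k c) v v.
Proof.
move=> kc; apply: (chart_dense (F := fun c => dchart_x k c v ^+ 2)
  (G := fun c => 4 * (chart_x k c - alpha) ^+ 2 * bilin (g k c) v v) kc).
- exact: (cvg_sqr (@near_dchart_x k c v)).
- exact: (cvgM (@cvg_factor k c) (@cvg_bilin_metric k c v kc)).
- apply: near_point => c' kc' y0; rewrite metric_chartE //.
  apply: le_trans (g_alpha_ge e3 alpha_mcf _ _ _ (chart_dom_x e3 alpha_mcf kc') y0).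
  by rewrite lerDl sqr_ge0.
Qed.

(** Through [dq = 2 y dy] the bound on [dy] becomes one whose sides are continuous across
    [y = 0]. *)
Lemma dchart_q_le k c v : dom k c ->
  dchart_q k c v ^+ 2 <= 4 * chart_q k c * (4 * (chart_x k c - alpha) ^+ 2 * bilin (g k c) v v).
Proof.
move=> kc; apply: (chart_dense (F := fun c => dchart_q k c v ^+ 2)
  (G := fun c => 4 * chart_q k c * (4 * (chart_x k c - alpha) ^+ 2 * bilin (g k c) v v)) kc).
- exact: (cvg_sqr (@near_dchart_q k c v)).
- have hq := has_differential_cvg (has_differentialM (has_differential_cst 4 c) (has_differential_chart_q k c)).
  exact: (cvgM hq (cvgM (@cvg_factor k c) (@cvg_bilin_metric k c v kc))).
- apply: near_point => c' kc' y0; rewrite metric_chartE // chart_qE.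
  set dq := dchart_q _ _ _; set y := chart_y _ _ in y0 *.
  have := g_alpha_ge e3 alpha_mcf (dchart_x k c' v) (dq / (2 * y)) (dchart_z e k c' v)
    (chart_dom_x e3 alpha_mcf kc') y0.
  set G := 4 * _ * _ => h.
  have h' : (dq / (2 * y)) ^+ 2 <= G by apply: le_trans h; rewrite lerDr sqr_ge0.
  have -> : dq ^+ 2 = 4 * y ^+ 2 * (dq / (2 * y)) ^+ 2 by field; rewrite gt_eqF.
  by apply: ler_wpM2l => //; rewrite mulr_ge0 // sqr_ge0.
Qed.

End Metric.

(** * Control of the angular coordinates *)

Section Regular.
Variables (R : realType) (e : nat -> int).
Local Notation L := (labelR R e).
Implicit Types (k : chart_index) (c v : 'rV[R]_4).

(* The angular coordinate [eps (L j) z] makes sense near [c]: the angles that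
   are undefined at [c] do not enter it. *)
Definition regular (j : nat) k c : Prop :=
  match k with
  | Interior => True
  | Edge i _ => eps (L j) (L i) = 0 \/ radius (c 0 2) (c 0 3) != 0
  | Corner i => (eps (L j) (L i) = 0 \/ radius (c 0 0) (c 0 1) != 0) /\
                (eps (L j) (L i.+1) = 0 \/ radius (c 0 2) (c 0 3) != 0)
  end.

(** The differential of an angle undefined at the limit enters with coefficient [0]. *)
Lemma cvg_eps_dchart_z (T : Type) (F : set_system T) {FF : Filter F}
    (c v : T -> 'rV[R]_4) (c0 v0 : 'rV[R]_4) j k :
  (forall i, c x 0 i @[x --> F] --> c0 0 i) ->
  (forall i, v x 0 i @[x --> F] --> v0 0 i) -> regular j k c0 ->
  eps (L j) (dchart_z e k (c x) (v x)) @[x --> F] --> eps (L j) (dchart_z e k c0 v0).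
Proof.
move=> hc hv.
have ang i l (a : R) : a = 0 \/ radius (c0 0 i) (c0 0 l) != 0 ->
    dangle (c x) (v x) i l * a @[x --> F] --> dangle c0 v0 i l * a.
  move=> [->|r0].
    by rewrite mulr0; under eq_fun do rewrite mulr0; exact: cvg_cst.
  by apply: cvgM; [exact: cvg_dangle|exact: cvg_cst].
case: k => [_|i pq /= h|i /= [h1 h2]]; rewrite /dchart_z /pair_of.
- have n : (L j).1 * v x 0 3 - (L j).2 * v x 0 2 @[x --> F] --> (L j).1 * v0 0 3 - (L j).2 * v0 0 2.
    by apply: cvgB; apply: cvgM => //; exact: cvg_cst.
  exact: n.
- rewrite epsD; under eq_fun do rewrite epsD.
  by apply: cvgD; [exact: ang|apply: cvgM => //; exact: cvg_cst].
- rewrite epsD; under eq_fun do rewrite epsD.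
  by apply: cvgD; exact: ang.
Qed.

End Regular.

Section FiberControl.
Variables (R : realType) (alpha : R) (e : nat -> int).
Hypothesis e3 : forall j, (1 <= j)%N -> 3 <= e j.
Hypothesis alpha_mcf : has_mcf_expansion e alpha.
Variable g : chart_index -> 'rV[R]_4 -> 'M[R]_4.
Hypothesis g_riem : riemannian_metric alpha e g.
Hypothesis g_ext : extends_g_alpha alpha e g.
Implicit Types (k : chart_index) (c v : 'rV[R]_4).

Local Notation chart_x := (chart_x e).
Local Notation dom := (chart_dom alpha e).
Local Notation L := (labelR R e).

(* The condition for [eps (L j) z] to be well defined modulo [2 pi] at the
   points of the manifold over [(x, y)]. *)
Definition visible (j : nat) (x y : R) := alpha < x /\ (0 < y \/ y = 0 /\ edge_interior e j x).

Lemma near_edge_interior j (x : R) : edge_interior e j x -> \forall x' \near x, edge_interior e j x'.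
Proof.
move=> /andP[h1 h2]; have n1 : \forall x' \near x, corner R e j < x'.
  by rewrite lte_fin in h1; exact: lt_nbhsr.
have n2 : \forall x' \near x, (x'%:E < corner_pred R e j)%E.
  case: (j) h2 => [|i] /= h2; first by apply: near_point => x'; exact: ltry.
  by rewrite lte_fin in h2; exact: lt_nbhsl.
by apply: filterS2 n1 n2 => x' h3 h4; apply/andP; rewrite lte_fin.
Qed.

Lemma near_visible j x y : visible j x y ->
  \forall p \near (x, y), alpha < p.1 -> 0 <= p.2 -> visible j p.1 p.2.
Proof.
move=> [ax [y0|[-> ex]]].
  exists (setT, [set y' | 0 < y']) => /=; first by split; [exact: filterT|exact: lt_nbhsr].
  by move=> [x' y'] /= [_ y0'] ax' _; split => //; left.
exists ([set x' | edge_interior e j x'], setT) => /=.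
  by split; [exact: near_edge_interior|exact: filterT].
move=> [x' y'] /= [ex' _] ax'; rewrite le_eqVlt => /predU1P[<-|y0']; split => //; last by left.
by right.
Qed.

(** An angle undefined at [c] puts the point on the boundary piece where its circle collapses.
    Visibility forces that piece to be the edge [j], so the label in question is [L j] and pairs to
    [0] with itself; corners are excluded. *)
Lemma visible_regular j k c : dom k c -> visible j (chart_x k c) (chart_y k c) -> regular e j k c.
Proof.
move=> kc [_ vis]; case: k kc vis => [|i pq|i] //=.
  move=> [_ ci] [r0|[r0 cj]]; first by right; rewrite gt_eqF.
  left; rewrite -(edge_of_interior e3 alpha_mcf ci) (edge_of_interior e3 alpha_mcf cj).
  exact: epsvv.
set r1 := radius (c 0 0) (c 0 1); set r2 := radius (c 0 2) (c 0 3).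
have r10 : 0 <= r1 := radius_ge0 _ _; have r20 : 0 <= r2 := radius_ge0 _ _.
move=> /andP[h1 h2] vis.
have [r1E|r1N] := eqVneq r1 0; have [r2E|r2N] := eqVneq r2 0.
- case: vis => [|[_ cj]]; first by rewrite /corner_y -/r1 r1E mulr0 mul0r ltxx.
  have := @interior_not_corner R alpha e e3 j i _ cj.
  by rewrite /corner_x -/r1 -/r2 r1E r2E expr0n /= subr0 addr0 eqxx.
- case: vis => [|[_ cj]]; first by rewrite /corner_y -/r1 r1E mulr0 mul0r ltxx.
  have ci : edge_interior e i (corner_x e i c).
    apply/andP; split => //; rewrite lte_fin /corner_x -/r1 -/r2 r1E expr0n /= subr0 ltrDl.
    by rewrite exprn_gt0 // lt0r r2N.
  split; last by right.
  by left; rewrite -(edge_of_interior e3 alpha_mcf ci) (edge_of_interior e3 alpha_mcf cj) epsvv.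
- case: vis => [|[_ cj]]; first by rewrite /corner_y -/r2 r2E mulr0 ltxx.
  have ci : edge_interior e i.+1 (corner_x e i c).
    apply/andP; split => //=; rewrite lte_fin /corner_x -/r1 -/r2 r2E expr0n /= addr0 ltrBlDr ltrDl.
    by rewrite exprn_gt0 // lt0r r1N.
  split; first by right.
  by left; rewrite -(edge_of_interior e3 alpha_mcf ci) (edge_of_interior e3 alpha_mcf cj) epsvv.
- by split; right.
Qed.

Lemma metric_positive_near k c : dom k c -> exists2 kappa : R, 0 < kappa &
  \forall c' \near c, forall v i, kappa * v 0 i ^+ 2 <= bilin (g k c') v v.
Proof.
move=> kc; apply: (@positive_definite_near R _ c (g k)) => [i l|v v0].
  exact: (@cvg_metric _ _ _ _ g_riem k c i l kc).
by have [_ _ pos _] := g_riem; exact: pos.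
Qed.

Let rowv (a b p q : R) : 'rV[R]_4 := \row_i nth 0 [:: a; b; p; q] i.

Let cvg_rowv x y (h : R * R -> 'rV[R]_4) :
  (forall i, h p 0 i @[p --> (x, y)] --> h (x, y) 0 i) -> h p @[p --> (x, y)] --> h (x, y).
Proof.
move=> hi; apply/cvgrPdist_le => eps eps0; near=> p.
rewrite [leLHS]/Num.Def.normr /= mx_normrE; apply: bigmax_le; first exact: ltW.
move=> [i l] _; rewrite !mxE /= (ord1 i); move: l; near: p; apply: filter_forall => l.
by have /cvgrPdist_le/(_ _ eps0) := hi l.
Unshelve. all: by end_near. Qed.

(* The metric is positive definite at a point over [(x, y)], and [g_alpha] does
   not depend on [z]. *)
Lemma g_alpha_fiber_bound j x y : visible j x y ->
  exists2 kappa : R, 0 < kappa & \forall p \near (x, y), 0 < p.2 ->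
    forall dx dy dz, kappa * eps (L j) dz ^+ 2 <= g_alpha alpha e p.1 p.2 dx dy dz.
Proof.
have fst_cvg (a b : R) : p.1 @[p --> (a, b)] --> a by exact: cvg_fst.
have snd_cvg (a b : R) : p.2 @[p --> (a, b)] --> b by exact: cvg_snd.
move=> [ax [y0|[-> ex]]].
- pose h (p : R * R) := rowv p.1 p.2 0 0.
  have hc : h p @[p --> (x, y)] --> h (x, y).
    apply: cvg_rowv => -[[|[|[|[|i]]]] hi] //=; under eq_fun do rewrite mxE /=; rewrite mxE /=.
    + exact: fst_cvg.
    + exact: snd_cvg.
    + exact: cvg_cst.
    + exact: cvg_cst.
  have kc : dom Interior (h (x, y)) by rewrite /= !mxE.
  have [kappa k0 kP] := metric_positive_near kc.
  set m1 := `|(L j).1|; set m2 := `|(L j).2|.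
  have M0 : 0 < 2 * (m1 ^+ 2 + m2 ^+ 2) + 1.
    by rewrite ltr_wpDl // mulr_ge0 // addr_ge0 // sqr_ge0.
  (* From [(a - b)^2 <= 2 (a^2 + b^2)] for the determinant; the [+ 1] keeps the denominator positive
     without inspecting the label. *)
  exists (kappa / (2 * (m1 ^+ 2 + m2 ^+ 2) + 1)); first by rewrite divr_gt0.
  have near1 : \forall p \near (x, y), forall v i, kappa * v 0 i ^+ 2 <= bilin (g Interior (h p)) v v.
    exact: hc _ kP.
  have near2 : \forall p \near (x, y), alpha < (p : R * R).1 by exact: (cvgr_gt _ (fst_cvg x y)).
  apply: filterS2 near1 near2 => -[x' y'] /= kP' ax' y0' dx dy dz.
  have kc' : dom Interior (h (x', y')) by rewrite /= !mxE.
  have := g_ext (rowv dx dy dz.1 dz.2) kc'; rewrite !mxE /= -surjective_pairing => <-.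
  set B := bilin _ _ _.
  have b1 := kP' (rowv dx dy dz.1 dz.2) 2; have b2 := kP' (rowv dx dy dz.1 dz.2) 3.
  rewrite -/B !mxE /= in b1 b2.
  rewrite mulrAC ler_pdivrMr //.
  have s1 : eps (L j) dz ^+ 2 <= 2 * ((L j).1 ^+ 2 * dz.2 ^+ 2 + (L j).2 ^+ 2 * dz.1 ^+ 2).
    rewrite /eps; set a := _ * _; set b := _ * _.
    rewrite -!exprMn -/a -/b -subr_ge0.
    by rewrite (_ : _ - _ = (a + b) ^+ 2) ?sqr_ge0 //; ring.
  rewrite /m1 /m2 !real_normK ?num_real //.
  have B0 : 0 <= B by apply: le_trans b1; rewrite mulr_ge0 ?sqr_ge0 // ltW.
  have t1 := ler_wpM2l (sqr_ge0 (L j).1) b2; have t2 := ler_wpM2l (sqr_ge0 (L j).2) b1.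
  have t3 := ler_wpM2l (ltW k0) s1.
  by apply: le_trans t3 _; lra.
- pose h (p : R * R) := rowv p.1 0 p.2 0.
  pose k := Edge j (mn e j.+1).
  have hc : h p @[p --> (x, 0)] --> h (x, 0).
    apply: cvg_rowv => -[[|[|[|[|i]]]] hi] //=; under eq_fun do rewrite mxE /=; rewrite mxE /=.
    + exact: fst_cvg.
    + exact: cvg_cst.
    + exact: snd_cvg.
    + exact: cvg_cst.
  have kc : dom k (h (x, 0)) by split; [exact: is_Zbasis_succ|rewrite /= !mxE].
  have [kappa k0 kP] := metric_positive_near kc.
  exists kappa => //.
  have near1 : \forall p \near (x, 0 : R), forall v i, kappa * v 0 i ^+ 2 <= bilin (g k (h p)) v v.
    exact: hc _ kP.
  have near2 : \forall p \near (x, 0 : R), edge_interior e j (p : R * R).1.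
    exact: (fst_cvg x 0 _ (near_edge_interior ex)).
  apply: filterS2 near1 near2 => -[x' y'] /= kP' ex' y0' dx dy dz.
  have kc' : dom k (h (x', y')) by split; [exact: is_Zbasis_succ|rewrite /= !mxE].
  (* Here [dz = s L_j + t L_{j+1}]. At the chart point with [y e^{is} = y'] real, the angular
     velocity [s] becomes the last component [y' * s], and [t] is itself a coordinate of [v]. *)
  pose t := eps (L j) dz; pose s := eps dz (L j.+1).
  pose v := rowv dx t dy (y' * s).
  have yE : chart_y k (h (x', y')) = y'.
    by rewrite /= !mxE /= /Defs.radius expr0n /= addr0 sqrtr_sqr gtr0_norm.
  have := metric_chartE e3 alpha_mcf g_riem g_ext v kc'.
  rewrite yE => /(_ y0').
  have -> : dchart_q k (h (x', y')) v / (2 * y') = dy.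
    by rewrite /= !mxE /=; field; rewrite gt_eqF.
  have -> : dchart_z e k (h (x', y')) v = dz.
    have det := eps_succ R e3 j; rewrite /eps in det.
    have pq : ((mn e j.+1).1%:~R, (mn e j.+1).2%:~R) = L j.+1 by [].
    rewrite /dchart_z /k /pair_of pq /dangle {pq}; clear k kc kP kc' yE kP'.
    move: (L j) (L j.+1) @s @t @v det => Lj Lj' s t v det.
    rewrite !mxE /= /Defs.radius expr0n /= addr0 sqr_sqrtr ?sqr_ge0 //.
    have -> : (y' * (y' * s) - 0 * dy) / y' ^+ 2 = s by field; rewrite gt_eqF.
    rewrite [RHS]surjective_pairing /s /t /eps /=; congr pair; rewrite /= /GRing.scale /=.
      by rewrite -[RHS]mulr1 -det /=; ring.
    by rewrite -[RHS]mulr1 -det /=; ring.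
  have := kP' v 1; rewrite [v 0 1]mxE /= !mxE /= => b1 E.
  by rewrite -E.
Unshelve. all: by end_near. Qed.

(** Carries [g_alpha_fiber_bound] to all charts and to the points over [y = 0]; one constant serves
    all fibres near [(x, y)]. *)
Lemma fiber_control j x y : visible j x y ->
  exists2 kappa : R, 0 < kappa & \forall p \near (x, y), forall k c v,
    dom k c -> chart_x k c = p.1 -> chart_y k c = p.2 ->
    kappa * eps (L j) (dchart_z e k c v) ^+ 2 <= bilin (g k c) v v.
Proof.
move=> vis; have [kappa k0 kP] := g_alpha_fiber_bound vis; exists kappa => //.
(* The bound is needed on a whole neighbourhood of [p], since the density argument perturbs the
   chart point. *)
apply: filterS2 (near_join kP) (near_visible vis) => -[x' y'] /= near_p vis' k c v kc xE yE.
have {}vis' : visible j x' y'.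
  apply: vis'; rewrite -?xE -?yE; [exact: chart_dom_x kc|exact: chart_dom_y kc].
apply: (chart_dense (F := fun c => kappa * eps (L j) (dchart_z e k c v) ^+ 2)
  (G := fun c => bilin (g k c) v v) kc).
- have cc i : (c' : 'rV[R]_4) 0 i @[c' --> c] --> c 0 i.
    exact: has_differential_cvg (has_differential_coord c i).
  have cv i : (v : 'rV[R]_4) 0 i @[c' --> c] --> v 0 i.
    exact: has_differential_cvg (has_differential_cst (v 0 i) c).
  have rg : regular e j k c by apply: visible_regular => //; rewrite xE yE.
  have hz : eps (L j) (dchart_z e k c' v) @[c' --> c] --> eps (L j) (dchart_z e k c v).
    exact: (@cvg_eps_dchart_z R e _ (nbhs c) _ id (fun=> v) c v j k cc cv rg).
  have hk : kappa @[c' --> c] --> kappa by exact: has_differential_cvg (has_differential_cst kappa c).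
  exact: (cvgM hk (cvg_sqr hz)).
- exact: (@cvg_bilin_metric _ _ _ _ g_riem k c v kc).
- have cx : chart_x k c' @[c' --> c] --> x'.
    by rewrite -xE; exact: has_differential_cvg (has_differential_chart_x e k c).
  have cy : chart_y k c' @[c' --> c] --> y'.
    have q0 : Num.sqrt (chart_q k c') @[c' --> c] --> y'.
      rewrite -yE (_ : chart_y k c = Num.sqrt (chart_q k c)).
        have hq := has_differential_cvg (has_differential_chart_q k c).
        exact: (cvg_comp (chart_q k) Num.sqrt hq (@sqrt_continuous R _)).
      by rewrite chart_qE sqrtr_sqr ger0_norm // (chart_dom_y kc).
    have yq : {near c, (fun c' => Num.sqrt (chart_q k c')) =1 chart_y k}.
      apply: filterS (near_chart_dom kc) => c' kc'.
      by rewrite chart_qE sqrtr_sqr ger0_norm // (chart_dom_y kc').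
    exact: (cvg_trans (@near_eq_cvg _ _ (nbhs c) _ _ _ yq) q0).
  have cxy : (chart_x k c', chart_y k c') @[c' --> c] --> (x', y') by exact: (cvg_pair cx cy).
  have near_c : \forall c' \near c, 0 < chart_y k c' -> forall dx dy dz,
      kappa * eps (L j) dz ^+ 2 <= g_alpha alpha e (chart_x k c') (chart_y k c') dx dy dz.
    exact: cxy _ near_p.
  apply: filterS near_c => c' h kc' y0.
  by rewrite (metric_chartE e3 alpha_mcf g_riem g_ext v kc' y0); exact: h.
Qed.

End FiberControl.

(** * Curves of finite length *)

Section FiniteVariation.
Variable R : realType.
Notation mu := (@lebesgue_measure R).

(* No measurability is assumed: the integral of a nonnegative function is a
   supremum over the simple functions below it. *)
Lemma ge0_le_integral_subset (A B : set R) (f h : R -> \bar R) :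
  (forall x, A x -> 0%E <= f x)%E -> (forall x, 0%E <= h x)%E -> A `<=` B ->
  (forall x, A x -> f x <= h x)%E ->
  (\int[mu]_(x in A) f x <= \int[mu]_(x in B) h x)%E.
Proof.
move=> f0 h0 AB fh; rewrite !ge0_integralE //.
apply: ereal_sup_le => _ [s sf <-]; exists s => //= x.
apply: le_trans (sf x) _; rewrite /patch.
case: ifPn => xA; last by case: ifPn.
by rewrite ifT ?fh ?inE //; [move: xA; rewrite inE|move: xA; rewrite !inE; exact: AB].
Qed.

(** The integral of [|psi'|] from a fixed time is bounded by [C * K] and increases to a supremum, so
    [psi] is Cauchy at [1]. The function [D] may change with [t], as each time comes with its own
    chart; [dpsi] glues these local derivatives. *)
Lemma cvg_at_left_of_speed (psi sp : R -> R) (a C K : R) :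
  0 <= a < 1 -> 0 < C -> (forall t, 0 <= sp t) ->
  (forall b, 0 < b < 1 -> (\int[mu]_(s in `[0%R, b]) (sp s)%:E <= K%:E)%E) ->
  (forall t, a < t < 1 -> exists D : R -> R,
    [/\ \forall s \near t, is_derive (s : R) 1 psi (D s),
        D s @[s --> t] --> D t & `|D t| <= C * sp t]) ->
  exists l : R, psi t @[t --> 1^'-] --> l.
Proof.
move=> /andP[a0 a1] C0 sp0 spK deriv.
pose dpsi := psi^`().
have dpsiE t : a < t < 1 -> is_derive t 1 psi (dpsi t).
  move=> /deriv[D [d _ _]]; have := nbhs_singleton d => dt.
  by rewrite /dpsi derive1E derive_val.
have dpsi_cont t : a < t < 1 -> dpsi s @[s --> t] --> dpsi t.
  move=> /deriv[D [d cD _]].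
  have -> : dpsi t = D t by rewrite /dpsi derive1E; have := nbhs_singleton d => dt; rewrite derive_val.
  apply: cvg_trans cD; apply: near_eq_cvg; apply: filterS d => s ds.
  by rewrite /dpsi derive1E derive_val.
have dpsi_le t : a < t < 1 -> `|dpsi t| / C <= sp t.
  move=> /deriv[D [d _ Dsp]]; rewrite ler_pdivrMr // mulrC.
  by rewrite /dpsi derive1E; have := nbhs_singleton d => dt; rewrite derive_val.
have within u v (f : R -> R) : a < u -> v < 1 ->
    (forall t, a < t < 1 -> f s @[s --> t] --> f t) -> {within `[u, v], continuous f}.
  move=> au v1 cf; apply: continuous_in_subspaceT => t; rewrite inE /= in_itv /= => /andP[ut tv].
  by apply: cf; rewrite (lt_le_trans au) // (le_lt_trans tv).
have norm_cont t : a < t < 1 -> `|dpsi s| @[s --> t] --> `|dpsi t|.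
  by move=> ht; apply: cvg_norm; exact: dpsi_cont.
have int_norm u v : a < u -> v < 1 -> mu.-integrable `[u, v] (EFin \o (fun t => `|dpsi t|)).
  move=> au v1; apply: continuous_compact_integrable; first exact: segment_compact.
  exact: within norm_cont.
have int_dpsi u v : a < u -> v < 1 -> mu.-integrable `[u, v] (EFin \o dpsi).
  move=> au v1; apply: continuous_compact_integrable; first exact: segment_compact.
  exact: within dpsi_cont.
pose H u v := \int[mu]_(t in `[u, v]) `|dpsi t|.
have psi_le_H u v : a < u -> u <= v -> v < 1 -> `|psi v - psi u| <= H u v.
  move=> au; rewrite le_eqVlt => /predU1P[->|uv] v1.
    by rewrite subrr normr0; apply: Rintegral_ge0.
  have -> : psi v - psi u = \int[mu]_(t in `[u, v]) dpsi t.
    have dc t : a < t < 1 -> psi s @[s --> t] --> psi t.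
      by move=> ht; exact: is_derive_cvg (dpsiE _ ht).
    have ha : a < u < 1 by rewrite au (lt_trans uv).
    have hb : a < v < 1 by rewrite v1 andbT (lt_trans au).
    rewrite /Rintegral (@continuous_FTC2 _ dpsi psi) // ?fineB //=.
    - exact: within dpsi_cont.
    - split.
      + move=> t; rewrite in_itv /= => /andP[ut tv].
        by have [] := dpsiE t; rewrite ?(lt_trans au) ?(lt_trans tv).
      + exact/cvg_at_right_filter/dc.
      + exact/cvg_at_left_filter/dc.
  apply: le_normr_Rintegral => //; exact: int_dpsi.
have H_add u v w : a < u -> u <= v -> v <= w -> w < 1 -> H u w = H u v + H v w.
  move=> au uv vw w1.
  have := @Rintegral_itvB _ (fun t => `|dpsi t|) (BLeft u) (BRight w) v (int_norm _ _ au w1).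
  rewrite !bnd_simp => /(_ uv vw) E.
  have E2 : \int[mu]_(t in `]v, w]) `|dpsi t| = H v w.
    rewrite Rintegral_itv_obnd_cbnd //.
    apply: (integrableS _ _ _ (int_norm v w _ w1)) => //; last exact: lt_le_trans uv.
    by move=> t /=; rewrite !in_itv /= => /andP[/ltW -> ->].
  by rewrite -E2 -E /H; ring.
have H_le u v : a < u -> u <= v -> v < 1 -> H u v <= C * K.
  move=> au uv v1.
  have i1 : mu.-integrable `[u, v] (EFin \o (fun t => `|dpsi t| / C)).
    apply: continuous_compact_integrable; first exact: segment_compact.
    by apply: within => // t ht; apply: cvgM; [exact: norm_cont|exact: cvg_cst].
  have -> : H u v = C * \int[mu]_(t in `[u, v]) (`|dpsi t| / C).
    rewrite RintegralZr //; last exact: int_norm.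
    by rewrite mulrCA divff ?mulr1 // gt_eqF.
  rewrite ler_pM2l // -lee_fin /Rintegral fineK; last exact: integrable_fin_num.
  apply: le_trans (spK v _); last by rewrite v1 andbT (lt_le_trans _ uv) // (le_lt_trans a0).
  apply: ge0_le_integral_subset.
  - by move=> t _; rewrite lee_fin divr_ge0 // ltW.
  - by move=> t; rewrite lee_fin.
  - by move=> t /=; rewrite !in_itv /= => /andP[ut ->]; rewrite (le_trans a0) // (le_trans (ltW au)).
  - move=> t /=; rewrite in_itv /= => /andP[ut tv]; rewrite lee_fin dpsi_le //.
    by rewrite (lt_le_trans au) // (le_lt_trans tv).
(* A base point strictly inside, since nothing is assumed at [a] itself. *)
pose u0 := (a + 1) / 2.
have au0 : a < u0 by rewrite /u0; lra.
have u01 : u0 < 1 by rewrite /u0; lra.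
pose E := [set H u0 t | t in `[u0, 1[].
have supE : has_sup E.
  split; first by exists (H u0 u0), u0 => //=; rewrite in_itv /= lexx.
  by exists (C * K) => _ [t /=] /[!in_itv]/= /andP[ut t1] <-; exact: H_le.
have : cvg (psi t @[t --> 1^'-]).
  apply: cauchy_cvg; apply: cauchy_exP => eps eps0.
  (* After [t0] the remaining variation is below [eps], as [H] is additive. *)
  have [_ [t0 /=] /[!in_itv]/= /andP[ut0 t01] <- Ht0] := sup_adherent eps0 supE.
  exists (psi t0); near=> t.
  have t0t : t0 <= t by apply: ltW; near: t; exact: nbhs_left_gt.
  have t1 : t < 1 by near: t; exact: nbhs_left_lt.
  rewrite /ball /= distrC; apply: le_lt_trans (psi_le_H _ _ _ t0t t1) _.
    exact: lt_le_trans ut0.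
  have Ht : H u0 t <= sup E.
    by apply: ub_le_sup; [exact: supE.2|exists t => //=; rewrite in_itv /= t1 (le_trans ut0)].
  have := H_add _ _ _ au0 ut0 t0t t1; lra.
by move=> /cvg_ex.
Unshelve. all: by end_near. Qed.

End FiniteVariation.

(** * Curves in the charts and the convergence of [x] *)

Section Curves.
Variables (R : realType) (alpha : R) (e : nat -> int).
Hypothesis e3 : forall j, (1 <= j)%N -> 3 <= e j.
Hypothesis alpha_mcf : has_mcf_expansion e alpha.
Variable g : chart_index -> 'rV[R]_4 -> 'M[R]_4.
Hypothesis g_riem : riemannian_metric alpha e g.
Hypothesis g_ext : extends_g_alpha alpha e g.
Variable Gamma : R -> manifold alpha e.
Hypothesis Gamma_smooth : smooth_curve Gamma.
Hypothesis Gamma_finite : finite_length g Gamma.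
Implicit Types (k : chart_index) (c v : 'rV[R]_4).

Local Notation chart_x := (chart_x e).
Local Notation dom := (chart_dom alpha e).
Local Notation L := (labelR R e).
Notation mu := (@lebesgue_measure R).

(* [pz] is an arbitrary representative: along a curve only periodic functions of
   the [eps (L j) pz] that make sense there are continuous. *)
Definition mcoord (P : manifold alpha e) : R * R * (R * R) :=
  get [set w | [/\ alpha < w.1.1, 0 <= w.1.2 & P = mpoint alpha e w.1.1 w.1.2 w.2]].
Definition px P := (mcoord P).1.1.
Definition py P := (mcoord P).1.2.
Definition pz P := (mcoord P).2.

Lemma mcoordP P : [/\ alpha < px P, 0 <= py P & P = mpoint alpha e (px P) (py P) (pz P)].
Proof.
have [x [y [z [ax y0 PE]]]] := mpoint_surj P.
by have := @getI _ [set w : R * R * (R * R) | [/\ alpha < w.1.1, 0 <= w.1.2 &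
  P = mpoint alpha e w.1.1 w.1.2 w.2]] ((x, y), z) (And3 ax y0 PE).
Qed.

Lemma mcoord_mpoint (x y : R) z : alpha < x -> 0 <= y -> [/\ px (mpoint alpha e x y z) = x,
  py (mpoint alpha e x y z) = y & exists K K' : int,
  collapsed e (x, y) (z - pz (mpoint alpha e x y z) + (2 * pi) *: (K%:~R, K'%:~R))].
Proof.
move=> ax y0; set P := mpoint _ _ _ _ _.
have [apx py0 /esym/mpoint_eqP] := mcoordP P.
by move=> /(_ apx py0 ax y0)[-> ->].
Qed.

(** Representatives differ by a lattice vector and a collapsed direction. The former changes the
    pairing with an integral label by a multiple of [2 pi]; the latter is [0], or a multiple of
    [L j] on the edge [j]. *)
Lemma eps_label_mpoint j (x y : R) z : visible alpha e j x y -> 0 <= y ->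
  exists K : int, eps (L j) (pz (mpoint alpha e x y z)) = eps (L j) z + 2 * pi * K%:~R.
Proof.
move=> [ax vis] y0; have [_ _ [K [K' h]]] := mcoord_mpoint z ax y0.
set z' := pz _ in h *.
have : eps (L j) (z - z' + (2 * pi) *: (K%:~R, K'%:~R)) = 0.
  move: h; rewrite /collapsed /=; case: vis => [y0'|[yE ex]].
    by rewrite y0' => ->; rewrite /eps /= !mulr0 subrr.
  rewrite yE ltxx ifF; last first.
    apply/asboolP => -[i xi].
    by have := @interior_not_corner R alpha e e3 j i _ ex; rewrite xi eqxx.
  move=> [s ->]; rewrite (edge_of_interior e3 alpha_mcf ex).
  by rewrite /eps /= /GRing.scale /=; ring.
rewrite /eps /= /GRing.scale /= => E.
exists ((mn e j).1 * K' - (mn e j).2 * K); rewrite rmorphB !rmorphM /=.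
by rewrite /mR /nR in E *; lra.
Qed.

(** First-order content of [local_expression] at an interior time, where the proviso [0 <= s < 1]
    holds at all close times. *)
Definition lifted t k (c : R -> 'rV[R]_4) : Prop :=
  [/\ dom k (c t),
      \forall s \near t, [/\ dom k (c s), derivable c s 1 & Gamma s = chart_map alpha e k (c s)],
      forall i, c s 0 i @[s --> t] --> c t 0 i &
      forall i, ('D_1 c s : 'rV[R]_4) 0 i @[s --> t] --> ('D_1 c t : 'rV[R]_4) 0 i].

Lemma local_expression_lifted (t : R) k (c : R -> 'rV[R]_4) :
  0 < t < 1 -> local_expression Gamma t k c -> lifted t k c.
Proof.
move=> /andP[t0 t1] [kc [I [openI It] smoothI] near_c].
have near_I : \forall s \near t, I s by exact: open_nbhs_nbhs.
have diffc s : I s -> differentiable c s by have [d _] := smoothI 1%N; exact: d.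
have coord (f : R -> 'rV[R]_4) i : {for t, continuous f} -> f s 0 i @[s --> t] --> f t 0 i.
  move=> cf; exact: (cvg_comp _ _ cf (has_differential_cvg (has_differential_coord (f t) i))).
have cont_c : {for t, continuous c} by apply: differentiable_continuous; exact: diffc.
have cont_dc : {for t, continuous ('D_(1 : R) c)}.
  by have [_ d] := smoothI 1%N; exact: d.
split => //.
- have near_dom : \forall s \near t, dom k (c s).
    exact: cont_c _ (near_chart_dom kc).
  have near_01 : \forall s \near t, 0 <= s < 1.
    near=> s; apply/andP; split; last by near: s; exact: lt_nbhsl.
    by apply: ltW; near: s; exact: lt_nbhsr.
  near=> s; split.
  + by near: s.
  + by apply: diff_derivable; apply: diffc; near: s.
  + have s01 : 0 <= s < 1 by near: s.
    by move: s01; near: s.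
- by move=> i; exact: coord.
- by move=> i; exact: coord.
Unshelve. all: by end_near. Qed.

(** [speed] is a choice among the values in all charts; the chart returned is one that realizes the
    chosen value. *)
Lemma speed_lifted t : 0 < t < 1 -> exists k (c : R -> 'rV[R]_4), lifted t k c /\
  speed g Gamma t = Num.sqrt (bilin (g k (c t)) ('D_1 c t) ('D_1 c t)).
Proof.
move=> t01; have [k [c kc]] : exists k (c : R -> 'rV[R]_4), local_expression Gamma t k c.
  by apply: Gamma_smooth; move/andP: t01 => [/ltW -> ->].
have [k' [c' [kc' ->]]] : [set v : R | exists k (c : R -> 'rV[R]_4), local_expression Gamma t k c /\
    v = Num.sqrt (bilin (g k (c t)) (derive1 c t) (derive1 c t))] (speed g Gamma t).
  by apply: getI; exists k, c; split; first exact: kc.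
exists k', c'; split; first exact: local_expression_lifted.
by rewrite derive1E.
Qed.

Lemma speed_ge0 t : 0 <= speed g Gamma t.
Proof.
rewrite /speed; set S := [set v : R | _].
have [[r Sr]|noS] := pselect (exists r, S r).
  by have [k [c [_ ->]]] := @getI _ S r Sr; exact: sqrtr_ge0.
(* With no local expression, [get] returns the default point of [R], which is [0]. *)
rewrite getPN; first exact: (lexx (0 : R)).
by move=> r Sr; apply: noS; exists r.
Qed.

Lemma length_bound : exists K : R, forall b, 0 < b < 1 ->
  (\int[mu]_(s in `[0%R, b]) (speed g Gamma s)%:E <= K%:E)%E.
Proof.
have [l lim] := Gamma_finite; exists l => b /andP[b0 b1].
apply: (cvge_to_ge lim); near=> t.
have bt : b <= t by apply: ltW; near: t; exact: nbhs_left_gt.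
apply: ge0_le_integral_subset => //.
- by move=> s _; rewrite lee_fin speed_ge0.
- by move=> s; rewrite lee_fin speed_ge0.
- by move=> s /=; rewrite !in_itv /= => /andP[-> sb]; exact: le_trans sb bt.
Unshelve. all: by end_near. Qed.

(** The common source of all convergence statements: a function whose derivative along the curve is
    at most [C] times the speed has a limit. [dF] must be given in every chart, because the chart
    realizing the speed is not under control. *)
Lemma curve_cvg (F : manifold alpha e -> R) (dF : chart_index -> 'rV[R]_4 -> 'rV[R]_4 -> R)
    (a C : R) : 0 <= a < 1 -> 0 < C ->
  (forall (t : R) k (c : R -> 'rV[R]_4), a < t < 1 -> lifted t k c ->
    [/\ \forall s \near t, is_derive (s : R) 1 (fun s => F (Gamma s)) (dF k (c s) ('D_1 c s)),
        dF k (c s) ('D_1 c s) @[s --> t] --> dF k (c t) ('D_1 c t) &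
        dF k (c t) ('D_1 c t) ^+ 2 <= C ^+ 2 * bilin (g k (c t)) ('D_1 c t) ('D_1 c t)]) ->
  exists l : R, F (Gamma t) @[t --> 1^'-] --> l.
Proof.
move=> a01 C0 h; have [K lenK] := length_bound.
apply: (cvg_at_left_of_speed a01 C0 speed_ge0 lenK) => t /andP[at_ t1].
have t01 : 0 < t < 1 by rewrite t1 andbT; move/andP: a01 => [a0 _]; exact: le_lt_trans a0 at_.
have at1 : a < t < 1 by rewrite at_.
have [k [c [lift ->]]] := speed_lifted t01.
have [d1 d2 d3] := h t k c at1 lift.
exists (fun s => dF k (c s) ('D_1 c s)); split => //.
have B0 : 0 <= bilin (g k (c t)) ('D_1 c t) ('D_1 c t).
  by have [kc _ _ _] := lift; exact: bilin_metric_ge0 kc.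
rewrite -sqrtr_sqr -[C]gtr0_norm // -sqrtr_sqr -sqrtrM ?sqr_ge0 //.
exact: ler_wsqrtr.
Qed.

(** [F] and [f] are quantified after the time [s], so [f] may depend on [s], as do the angle
    branches based at [c s]. *)
Lemma lifted_near (t : R) k (c : R -> 'rV[R]_4) : lifted t k c ->
  \forall s \near t, forall F : manifold alpha e -> R,
  forall f : 'rV[R]_4 -> R, forall df : 'rV[R]_4 -> R,
  (\forall s' \near s, dom k (c s') -> F (chart_map alpha e k (c s')) = f (c s')) ->
  has_differential f (c s) df -> is_derive s 1 (fun s => F (Gamma s)) (df ('D_1 c s)).
Proof.
move=> [kc nearc _ _]; apply: filterS2 nearc (near_join nearc) => s [_ ds _] nears F f df Ff hf.
apply: near_eq_is_derive (has_differential_curve hf ds).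
by apply: filterS2 nears Ff => s' [ks' _ ->] <-.
Qed.

(** The Lipschitz constant [2] is the root of the factor [4] in [dchart_x_le]. A finite limit of the
    logarithm is what keeps [x] away from [alpha]. *)
Lemma px_cvg : exists x : R, alpha < x /\ px (Gamma t) @[t --> 1^'-] --> x.
Proof.
have [l lcvg] : exists l : R, ln (px (Gamma t) - alpha) @[t --> 1^'-] --> l.
  apply: (@curve_cvg (fun P => ln (px P - alpha))
    (fun k c v => (chart_x k c - alpha)^-1 * dchart_x k c v) 0 2) => //.
    by rewrite lexx ltr01.
  move=> t k c t01 lift; have [kc nearc cc cdc] := lift.
  have Xgt s : dom k (c s) -> 0 < chart_x k (c s) - alpha.
    by move=> ks; rewrite subr_gt0 (chart_dom_x e3 alpha_mcf).
  split.
  - apply: filterS2 (lifted_near lift) nearc => s hs [ks _ _].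
    have hX := has_differentialD (has_differential_chart_x e k (c s)) (has_differential_cst (- alpha) (c s)).
    have hl := has_differential_comp hX (is_derive1_ln (Xgt s ks)).
    apply: (hs (fun P => ln (px P - alpha)) (fun c => ln (chart_x k c - alpha))
      (fun v => (chart_x k (c s) - alpha)^-1 * dchart_x k (c s) v)).
      apply: near_point => s' ks'; rewrite chart_mapE.
      by have [-> _ _] := mcoord_mpoint (chart_z e k (c s'))
        (chart_dom_x e3 alpha_mcf ks') (chart_dom_y ks').
    by apply: has_differential_eq hl _ => v /=; rewrite addr0.
  - apply: cvgM; last exact: cvg_dchart_x.
    apply: cvgV; first by rewrite gt_eqF // Xgt.
    apply: cvgB; last exact: cvg_cst.
    have [dx _] := has_differential_chart_x e k (c t).
    have : {for t, continuous c}.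
      apply: differentiable_continuous; apply/derivable1_diffP.
      by have [] := nbhs_singleton nearc.
    move=> ct; exact: (cvg_comp _ _ ct (has_differential_cvg (has_differential_chart_x e k (c t)))).
  - have X0 := Xgt t kc; have := dchart_x_le e3 alpha_mcf g_riem g_ext ('D_1 c t) kc.
    rewrite exprMn exprVn ler_pdivrMl ?exprn_gt0 // => h; apply: le_trans h _.
    by rewrite le_eqVlt; apply/orP; left; apply/eqP; ring.
exists (alpha + expR l); split; first by rewrite ltrDl expR_gt0.
have -> : (fun t => px (Gamma t)) = (fun t => alpha + expR (ln (px (Gamma t) - alpha))).
  apply/funext => t; have [ax _ _] := mcoordP (Gamma t).
  by rewrite lnK ?posrE ?subr_gt0 //; ring.
apply: cvgD; first exact: cvg_cst.
exact: (cvg_comp _ _ lcvg (@continuous_expR R l)).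
Qed.

End Curves.

Lemma at_left_interval (R : realType) (P : R -> Prop) : (\forall t \near 1^'-, P t) ->
  exists a : R, 0 <= a < 1 /\ forall t, a < t < 1 -> P t.
Proof.
move=> [d /= d0 h]; exists (Num.max 0 (1 - d)); split.
  by rewrite le_max lexx /= gt_max ltr01 ltrBlDr ltrDl.
move=> t /andP[]; rewrite gt_max => /andP[t0 td] t1; apply: h => //=.
by rewrite gtr0_norm; lra.
Qed.

(** * Convergence of [y] and of the visible angles *)

Section Curves.
Variables (R : realType) (alpha : R) (e : nat -> int).
Hypothesis e3 : forall j, (1 <= j)%N -> 3 <= e j.
Hypothesis alpha_mcf : has_mcf_expansion e alpha.
Variable g : chart_index -> 'rV[R]_4 -> 'M[R]_4.
Hypothesis g_riem : riemannian_metric alpha e g.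
Hypothesis g_ext : extends_g_alpha alpha e g.
Variable Gamma : R -> manifold alpha e.
Hypothesis Gamma_smooth : smooth_curve Gamma.
Hypothesis Gamma_finite : finite_length g Gamma.
Implicit Types (k : chart_index) (c v : 'rV[R]_4).

Local Notation chart_x := (chart_x e).
Local Notation dom := (chart_dom alpha e).
Local Notation L := (labelR R e).
Local Notation lifted := (lifted Gamma).

Lemma lifted_continuous (t : R) k (c : R -> 'rV[R]_4) : lifted t k c -> c s @[s --> t] --> c t.
Proof.
move=> [_ nearc _ _]; have [_ dc _] := nbhs_singleton nearc.
have : {for t, continuous c} by apply: differentiable_continuous; exact/derivable1_diffP.
by [].
Qed.

(** Working with [q = y^2] avoids differentiating [y] on the boundary. By [4 q <= (1 + q)^2] the
    derivative of [ln (1 + q)] is at most [2 X] times the speed, and [X < M] near time [1] since [x]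
    converges. *)
Lemma py_cvg : exists y : R, 0 <= y /\ py (Gamma t) @[t --> 1^'-] --> y.
Proof.
have [x [ax xcvg]] := px_cvg e3 alpha_mcf g_riem g_ext Gamma_smooth Gamma_finite.
pose M := x - alpha + 1; have M0 : 0 < M by rewrite /M; lra.
have [a [a01 aM]] : exists a : R, 0 <= a < 1 /\ forall t, a < t < 1 -> px (Gamma t) - alpha < M.
  apply: at_left_interval; have x1 : x < x + 1 by lra.
  by apply: filterS (cvgr_lt _ xcvg _ x1) => t; rewrite /M; lra.
have [l lcvg] : exists l : R, ln (1 + py (Gamma t) ^+ 2) @[t --> 1^'-] --> l.
  have q1 k (c : 'rV[R]_4) : 0 < 1 + chart_q k c by rewrite chart_qE ltr_wpDr ?sqr_ge0.
  apply: (@curve_cvg _ _ _ _ g_riem Gamma Gamma_smooth Gamma_finite (fun P => ln (1 + py P ^+ 2))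
    (fun k c v => (1 + chart_q k c)^-1 * dchart_q k c v) a (2 * M)) => //.
    by rewrite mulr_gt0.
  move=> t k c t01 lift; have [kc nearc cc cdc] := lift.
  split.
  - apply: filterS2 (lifted_near lift) nearc => s hs [ks _ _].
    have hX := has_differentialD (has_differential_cst 1 (c s)) (has_differential_chart_q k (c s)).
    have hl := has_differential_comp hX (is_derive1_ln (q1 k (c s))).
    apply: (hs (fun P => ln (1 + py P ^+ 2)) (fun c => ln (1 + chart_q k c))
      (fun v => (1 + chart_q k (c s))^-1 * dchart_q k (c s) v)).
      apply: near_point => s' ks'; rewrite chart_mapE chart_qE.
      by have [_ -> _] := mcoord_mpoint e (chart_z e k (c s'))
        (chart_dom_x e3 alpha_mcf ks') (chart_dom_y ks').
    by apply: has_differential_eq hl _ => v /=; rewrite add0r.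
  - apply: cvgM; last exact: cvg_dchart_q.
    apply: cvgV; first by rewrite gt_eqF.
    apply: cvgD; first exact: cvg_cst.
    exact: (cvg_comp _ _ (lifted_continuous lift) (has_differential_cvg (has_differential_chart_q k (c t)))).
  - have := dchart_q_le e3 alpha_mcf g_riem g_ext ('D_1 c t) kc.
    set B := bilin _ _ _; set X := chart_x k (c t) - alpha; set q := chart_q k (c t).
    set dq := dchart_q _ _ _ => h.
    have B0 : 0 <= B by exact: bilin_metric_ge0 kc.
    have XM : X ^+ 2 <= M ^+ 2.
      have ax' := chart_dom_x e3 alpha_mcf kc.
      rewrite ler_sqr ?nnegrE ?subr_ge0 ?ltW //; have := aM _ t01.
      have [_ _ ->] := nbhs_singleton nearc; rewrite chart_mapE.
      by have [-> _ _] := mcoord_mpoint e (chart_z e k (c t)) ax' (chart_dom_y kc).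
    rewrite exprMn exprVn ler_pdivrMl ?exprn_gt0 ?q1 //.
    apply: (le_trans h).
    have q4 : 4 * q <= (1 + q) ^+ 2.
      by rewrite -subr_ge0 (_ : _ - _ = (1 - q) ^+ 2) ?sqr_ge0 //; ring.
    have q0 : 0 <= q by rewrite /q chart_qE sqr_ge0.
    apply: ler_pM => //; first by rewrite mulr_ge0.
      by rewrite mulr_ge0 // mulr_ge0 // sqr_ge0.
    by apply: ler_wpM2r => //; rewrite exprMn (_ : 2 ^+ 2 = 4) ?ler_pM2l // -natrX.
exists (Num.sqrt (expR l - 1)); split; first exact: sqrtr_ge0.
have -> : (fun t => py (Gamma t)) = (fun t => Num.sqrt (expR (ln (1 + py (Gamma t) ^+ 2)) - 1)).
  apply/funext => t; have [_ y0 _] := mcoordP (Gamma t).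
  rewrite lnK ?posrE; last by rewrite ltr_wpDr ?sqr_ge0.
  by rewrite addrAC subrr add0r sqrtr_sqr ger0_norm.
have ecvg := cvg_comp _ _ lcvg (@continuous_expR R l).
have e1cvg : expR (ln (1 + py (Gamma t) ^+ 2)) - 1 @[t --> 1^'-] --> expR l - 1.
  by apply: cvgB; [exact: ecvg|exact: cvg_cst].
exact: (cvg_comp _ _ e1cvg (@sqrt_continuous R _)).
Qed.

(** Each angle either enters with coefficient [0], or has a valid branch near [c] and an integral
    coefficient that keeps the ambiguity in [2 pi Z]. *)
Lemma regular_near j k c : regular e j k c -> \forall c' \near c, exists K : int,
  eps (L j) (chart_z e k c') = eps (L j) (chart_z_at e c k c') + 2 * pi * K%:~R.
Proof.
have ang i l (jj : nat) : eps (L j) (L jj) = 0 \/ radius (c 0 i) (c 0 l) != 0 ->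
    \forall c' \near c, exists K : int, angle ((c' : 'rV[R]_4) 0 i) (c' 0 l) * eps (L j) (L jj) =
      angle_at c c' i l * eps (L j) (L jj) + 2 * pi * K%:~R.
  move=> [->|r0]; first by apply: near_point => c'; exists 0; rewrite !mulr0 addr0.
  have [K0 ->] := eps_label_int R e j jj.
  apply: filterS (angle_at_near r0) => c' [K ->]; exists (K * K0).
  by rewrite rmorphM /=; ring.
rewrite /chart_z /chart_z_at /pair_of; case: k => [_|i pq /= h|i /= [h1 h2]].
- by apply: near_point => c'; exists 0; rewrite mulr0 addr0.
- apply: filterS (ang _ _ _ h) => c' [K hK]; exists K.
  by rewrite !epsD hK addrAC.
- apply: filterS2 (ang _ _ _ h1) (ang _ _ _ h2) => c' [K hK] [K' hK']; exists (K + K').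
  by rewrite !epsD hK hK' rmorphD /=; ring.
Qed.

(** Periodicity absorbs the jumps of [pz]. Near the limit [fiber_control] bounds the derivative,
    with constant [kappa^(-1/2)]. *)
Lemma periodic_label_cvg (h dh : R -> R) j (x y : R) :
  (forall s (K : int), h (s + 2 * pi * K%:~R) = h s) ->
  (forall s (K : int), dh (s + 2 * pi * K%:~R) = dh s) ->
  (forall s : R, is_derive s 1 h (dh s)) -> continuous dh -> (forall s, `|dh s| <= 1) ->
  visible alpha e j x y -> px (Gamma t) @[t --> 1^'-] --> x -> py (Gamma t) @[t --> 1^'-] --> y ->
  exists l : R, h (eps (L j) (pz (Gamma t))) @[t --> 1^'-] --> l.
Proof.
move=> hP dhP dhE dhC dh1 vis xcvg ycvg.
have [kappa k0 control] := fiber_control e3 alpha_mcf g_riem g_ext vis.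
have xy : (px (Gamma t), py (Gamma t)) @[t --> 1^'-] --> (x, y) by exact: (cvg_pair xcvg ycvg).
have [a [a01 aP]] : exists a : R, 0 <= a < 1 /\ forall t, a < t < 1 ->
    visible alpha e j (px (Gamma t)) (py (Gamma t)) /\
    forall k c v, dom k c -> chart_x k c = px (Gamma t) -> chart_y k c = py (Gamma t) ->
    kappa * eps (L j) (dchart_z e k c v) ^+ 2 <= bilin (g k c) v v.
  apply: at_left_interval.
  have n1 : \forall t \near 1^'-, alpha < px (Gamma t) -> 0 <= py (Gamma t) ->
    visible alpha e j (px (Gamma t)) (py (Gamma t)) by exact: xy _ (near_visible vis).
  have n2 := xy _ control.
  by apply: filterS2 n1 n2 => t h1 h2; have [ax y0 _] := mcoordP (Gamma t); split => //; exact: h1.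
have chart_xy s k (c : 'rV[R]_4) : dom k c -> Gamma s = chart_map alpha e k c ->
    chart_x k c = px (Gamma s) /\ chart_y k c = py (Gamma s).
  move=> kc ->; rewrite chart_mapE.
  by have [-> -> _] := mcoord_mpoint e (chart_z e k c) (chart_dom_x e3 alpha_mcf kc) (chart_dom_y kc).
apply: (@curve_cvg _ _ _ _ g_riem Gamma Gamma_smooth Gamma_finite (fun P => h (eps (L j) (pz P)))
  (fun k c v => dh (eps (L j) (chart_z e k c)) * eps (L j) (dchart_z e k c v))
  a (Num.sqrt kappa)^-1) => //.
  by rewrite invr_gt0 sqrtr_gt0.
move=> t k c t01 lift; have [kc nearc cc cdc] := lift.
have reg s : a < s < 1 -> dom k (c s) -> Gamma s = chart_map alpha e k (c s) -> regular e j k (c s).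
  move=> s01 ks Gs; have [xE yE] := chart_xy s k (c s) ks Gs.
  by apply: (visible_regular e3 alpha_mcf ks); rewrite xE yE; have [] := aP s s01.
have near_a : \forall s \near t, a < s < 1.
  move/andP: t01 => [at_ t1]; near=> s; apply/andP; split; near: s; [exact: lt_nbhsr|exact: lt_nbhsl].
have has_diff_z c0 : has_differential (fun c' => eps (L j) (chart_z_at e c0 k c')) c0
    (fun v => eps (L j) (dchart_z e k c0 v)).
  have hz := has_differential_chart_z e k c0 (- (L j).2) (L j).1.
  rewrite (_ : (fun c' => _) = (fun c' => - (L j).2 * (chart_z_at e c0 k c').1 + (L j).1 * (chart_z_at e c0 k c').2)).
    by apply: has_differential_eq hz _ => v; rewrite /eps; ring.
  by apply/funext => c'; rewrite /eps; ring.
have has_diff_h c0 : has_differential (fun c' => h (eps (L j) (chart_z_at e c0 k c'))) c0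
    (fun v => dh (eps (L j) (chart_z e k c0)) * eps (L j) (dchart_z e k c0 v)).
  by apply: has_differential_comp (has_diff_z c0) _; rewrite chart_z_base.
split.
- apply: filterS3 (lifted_near lift) (near_join near_a) (near_join nearc) => s hs near_as nears.
  have [ks ds Gs] := nbhs_singleton nears.
  have cs : c s' @[s' --> s] --> c s.
    have : {for s, continuous c} by apply: differentiable_continuous; exact/derivable1_diffP.
    by [].
  have regs := reg s (nbhs_singleton near_as) ks Gs.
  (* The branch is based at [c s] itself, the only point where its differential is given by the
     formula. *)
  apply: (hs (fun P => h (eps (L j) (pz P))) (fun c' => h (eps (L j) (chart_z_at e (c s) k c')))
    (fun v => dh (eps (L j) (chart_z e k (c s))) * eps (L j) (dchart_z e k (c s) v))) => //.
  have n1 : \forall s' \near s, exists K : int, eps (L j) (chart_z e k (c s')) =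
     eps (L j) (chart_z_at e (c s) k (c s')) + 2 * pi * K%:~R by exact: cs _ (regular_near regs).
  apply: filterS3 n1 near_as nears => s' [K hK] as' [ks' _ Gs'] _; rewrite chart_mapE.
  have vis' : visible alpha e j (chart_x k (c s')) (chart_y k (c s')).
    by have [-> ->] := chart_xy s' k (c s') ks' Gs'; have [] := aP s' as'.
  have [K' ->] := eps_label_mpoint e3 alpha_mcf (chart_z e k (c s')) vis' (chart_dom_y ks').
  by rewrite hP hK hP.
- have Gt : Gamma t = chart_map alpha e k (c t) by have [] := nbhs_singleton nearc.
  have regt := reg t t01 kc Gt.
  apply: cvgM; last exact: cvg_eps_dchart_z.
  have zcvg : eps (L j) (chart_z_at e (c t) k (c s)) @[s --> t] --> eps (L j) (chart_z e k (c t)).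
    have := has_differential_cvg (has_diff_z (c t)); rewrite chart_z_base => zc.
    exact: (cvg_comp _ _ (lifted_continuous lift) zc).
  have dcvg := cvg_comp _ _ zcvg (dhC _).
  (* [chart_z] need not be continuous along the curve; the branch based at [c t] is continuous at
     [t], and [dh] does not see the difference. *)
  suff near_eq : \forall s \near t, dh (eps (L j) (chart_z_at e (c t) k (c s))) = dh (eps (L j) (chart_z e k (c s))).
    by apply: cvg_trans dcvg; exact: near_eq_cvg.
  have n1 : \forall s \near t, exists K : int, eps (L j) (chart_z e k (c s)) =
     eps (L j) (chart_z_at e (c t) k (c s)) + 2 * pi * K%:~R.
    exact: (lifted_continuous lift) _ (regular_near regt).
  by apply: filterS n1 => s [K ->]; rewrite dhP.
- have Gt : Gamma t = chart_map alpha e k (c t) by have [] := nbhs_singleton nearc.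
  have [xE yE] := chart_xy t k (c t) kc Gt.
  have := (aP t t01).2 k (c t) ('D_1 c t) kc xE yE.
  set B := bilin _ _ _; set E := eps _ _; set D := dh _ => le_B.
  rewrite exprMn exprVn sqr_sqrtr ?(ltW k0) // ler_pdivlMl //; apply: (le_trans _ le_B).
  rewrite ler_pM2l // ler_piMl ?sqr_ge0 // -real_normK ?num_real //.
  by rewrite expr_le1 // dh1.
Unshelve. all: by end_near. Qed.

End Curves.

(** * The limit point *)

(** Continuity of the quotient map together with the subspace topology of [Dbar], in plain
    coordinates. *)
Lemma near_mpoint (R : realType) (alpha : R) (e : nat -> int) (x y : R) (z : R * R)
    (A : set (manifold alpha e)) : alpha < x -> 0 <= y -> nbhs (mpoint alpha e x y z) A ->
  \forall p \near (x, y) & z' \near z, alpha < p.1 -> 0 <= p.2 -> A (mpoint alpha e p.1 p.2 z').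
Proof.
move=> ax y0 /(@pi_continuous (toric_cover alpha) _ _)[/= [B C] /= [nB nC] BC].
have [_ [[W oW <-] Wx WB]] := nB.
have xyD : (x, y) \in Dbar alpha by rewrite inE.
have W_xy : nbhs (x, y) W.
  by apply: open_nbhs_nbhs; split => //; move: Wx; rewrite /= set_valE insubdK.
exists (W, C) => // -[[x' y'] z'] /= [Wx' Cz'] ax' y0'.
apply: (BC (_, z')); split => //=; apply: WB => /=.
by rewrite set_valE insubdK // inE.
Qed.

Section Limit.
Variables (R : realType) (alpha : R) (e : nat -> int).
Hypothesis e3 : forall j, (1 <= j)%N -> 3 <= e j.
Hypothesis alpha_mcf : has_mcf_expansion e alpha.
Variable g : chart_index -> 'rV[R]_4 -> 'M[R]_4.
Hypothesis g_riem : riemannian_metric alpha e g.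
Hypothesis g_ext : extends_g_alpha alpha e g.
Variable Gamma : R -> manifold alpha e.
Hypothesis Gamma_smooth : smooth_curve Gamma.
Hypothesis Gamma_finite : finite_length g Gamma.

Local Notation L := (labelR R e).

Lemma cvg_eps_label j (z : R * R) : eps (L j) z' @[z' --> z] --> eps (L j) z.
Proof.
apply: cvgB; apply: cvgM; first exact: cvg_cst.
- exact: cvg_snd.
- exact: cvg_cst.
- exact: cvg_fst.
Qed.

Lemma reduce_angles (z : R * R) : exists2 z', (`[0, 2 * pi] `*` `[0, 2 * pi]) z' & lattice_eq z z'.
Proof.
have red (s : R) : exists K : int, 0 <= s - 2 * pi * K%:~R <= 2 * pi.
  exists (Num.floor (s / (2 * pi))).
  have p0 : 0 < 2 * pi :> R by rewrite mulr_gt0 ?pi_gt0.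
  have /andP[h1 h2] := floor_itv (s / (2 * pi)).
  rewrite subr_ge0 lerBlDr mulrC -ler_pdivlMr // h1 /=.
  by rewrite -[X in X + _]mul1r -mulrDl -ler_pdivrMr // ltW // addrC -intrD1.
have [[K hK] [K' hK']] := (red z.1, red z.2).
exists (z.1 - 2 * pi * K%:~R, z.2 - 2 * pi * K'%:~R); first by split; rewrite /= in_itv.
exists K, K'; congr pair; rewrite /= /GRing.scale /=; ring.
Qed.

Lemma lattice_eq_label j (z z' : R * R) : lattice_eq z z' ->
  exists K : int, eps (L j) z' = eps (L j) z + 2 * pi * K%:~R.
Proof.
move=> [K [K' h]]; have : eps (L j) (z' - z + (2 * pi) *: (K%:~R, K'%:~R)) = 0.
  by rewrite h /eps /= !mulr0 subrr.
rewrite /eps /= /GRing.scale /= => E.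
exists (- ((mn e j).1 * K' - (mn e j).2 * K)); rewrite rmorphN rmorphB !rmorphM /=.
by rewrite /mR /nR in E *; lra.
Qed.

(** [pz] itself need not converge. Representatives are reduced to a compact square; a [z] there
    either shares all [J]-angles with [z0], and then names the limit point, or some label of [J]
    separates it from the curve near time [1]. Compactness makes this uniform in [z]. *)
Lemma cvg_mpoint (J : set nat) (x y : R) (z0 : R * R) : alpha < x -> 0 <= y ->
  px (Gamma t) @[t --> 1^'-] --> x -> py (Gamma t) @[t --> 1^'-] --> y ->
  (forall j, J j -> cos (eps (L j) (pz (Gamma t))) @[t --> 1^'-] --> cos (eps (L j) z0) /\
    sin (eps (L j) (pz (Gamma t))) @[t --> 1^'-] --> sin (eps (L j) z0)) ->
  (forall z, (forall j, J j -> cos (eps (L j) z) = cos (eps (L j) z0) /\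
    sin (eps (L j) z) = sin (eps (L j) z0)) -> mpoint alpha e x y z = mpoint alpha e x y z0) ->
  Gamma t @[t --> 1^'-] --> mpoint alpha e x y z0.
Proof.
move=> ax y0 xcvg ycvg zcvg sep A nA.
pose same z z' := forall j, J j -> cos (eps (L j) z) = cos (eps (L j) z') /\
  sin (eps (L j) z) = sin (eps (L j) z').
(* For a representative [z] of [Gamma t] with the same label angles this puts [Gamma t] in [A]; for
   every other [z] it is void. *)
pose P t z := same z (pz (Gamma t)) -> Gamma t = mpoint alpha e (px (Gamma t)) (py (Gamma t)) z ->
  A (Gamma t).
have K_compact : compact (`[0, 2 * pi] `*` `[0, 2 * pi] : set (R * R)).
  by apply: compact_setX; exact: segment_compact.
have xy : (px (Gamma t), py (Gamma t)) @[t --> 1^'-] --> (x, y) by exact: (cvg_pair xcvg ycvg).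
have separate (f : R -> R) j z : continuous f ->
    f (eps (L j) (pz (Gamma t))) @[t --> 1^'-] --> f (eps (L j) z0) ->
    f (eps (L j) z) <> f (eps (L j) z0) ->
    \forall z' \near z & t \near 1^'-, f (eps (L j) z') <> f (eps (L j) (pz (Gamma t))).
  move=> fC fcvg neq.
  have h1 : f (eps (L j) u.1) @[u --> filter_prod (nbhs z) (1 : R)^'-] --> f (eps (L j) z).
    exact: (cvg_comp fst _ cvg_fst (cvg_comp _ _ (@cvg_eps_label j z) (fC _))).
  have h2 : f (eps (L j) (pz (Gamma u.2))) @[u --> filter_prod (nbhs z) (1 : R)^'-] --> f (eps (L j) z0).
    exact: (cvg_comp snd _ cvg_snd fcvg).
  have D0 : f (eps (L j) z) - f (eps (L j) z0) != 0 by rewrite subr_eq0; apply/eqP.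
  have := cvgr_neq0 _ (cvgB h1 h2) D0.
  move=> /(_ _ _)/filterS; apply => u /= /eqP h e0; apply: h; rewrite -[LHS]/(_ - _).
  by rewrite e0 subrr.
have /compact_near_coveringP/(_ R (1^'-) P _) cover := K_compact.
have : \forall t \near 1^'-, (`[0, 2 * pi] `*` `[0, 2 * pi]) `<=` P t.
  apply: cover => z _.
  have [eq_z|/existsNP[j /not_implyP[Jj /not_andP neq]]] := pselect (same z z0).
    have := nA; rewrite -(sep z eq_z) => /(near_mpoint ax y0)[[B C] /= [nB nC] BC].
    exists (C, [set t | B (px (Gamma t), py (Gamma t))]) => /=; first by split=> //; exact: xy.
    move=> [z' t] /= [Cz' Bt] _ ->; have [ax' y0' _] := mcoordP (Gamma t).
    exact: (BC ((px (Gamma t), py (Gamma t)), z')).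
  have [cosc sinc] := zcvg j Jj.
  case: neq => neq.
    have := separate cos j z (@continuous_cos R) cosc neq.
    by apply: filterS => -[z' t] /= ne /(_ j Jj)[].
  have := separate sin j z (@continuous_sin R) sinc neq.
  by apply: filterS => -[z' t] /= ne /(_ j Jj)[].
apply: filterS => t; have [ax' y0' GE] := mcoordP (Gamma t).
have [z' Kz' zz'] := reduce_angles (pz (Gamma t)) => /(_ z' Kz'); apply.
  by move=> j _; have [K ->] := lattice_eq_label j zz'; exact: cos_sin_int_period.
by rewrite {1}GE; exact: mpoint_lattice.
Qed.

Lemma label_angle_cvg j (x y : R) : visible alpha e j x y ->
  px (Gamma t) @[t --> 1^'-] --> x -> py (Gamma t) @[t --> 1^'-] --> y ->
  exists s : R, cos (eps (L j) (pz (Gamma t))) @[t --> 1^'-] --> cos s /\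
    sin (eps (L j) (pz (Gamma t))) @[t --> 1^'-] --> sin s.
Proof.
move=> vis xcvg ycvg.
have lim := @periodic_label_cvg _ _ _ e3 alpha_mcf _ g_riem g_ext _ Gamma_smooth Gamma_finite.
have cosP s (K : int) : cos (s + 2 * pi * K%:~R) = cos s :> R by have [] := cos_sin_int_period s K.
have sinP s (K : int) : sin (s + 2 * pi * K%:~R) = sin s :> R by have [] := cos_sin_int_period s K.
have [C Ccvg] : exists C : R, cos (eps (L j) (pz (Gamma t))) @[t --> 1^'-] --> C.
  apply: (lim cos (fun s => - sin s) j x y) => //.
  - by move=> s K; rewrite sinP.
  - by move=> s; apply: continuousN; exact: continuous_sin.
  - by move=> s; rewrite normrN; exact: sin_max.
have [S Scvg] : exists S : R, sin (eps (L j) (pz (Gamma t))) @[t --> 1^'-] --> S.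
  by apply: (lim sin cos j x y) => //; [exact: continuous_cos|exact: cos_max].
(* The limits lie on the unit circle, so they are the cosine and sine of one angle. *)
have CS : C ^+ 2 + S ^+ 2 = 1.
  have one : (1 : R) @[t --> (1 : R)^'-] --> C * C + S * S.
    apply: cvg_trans (cvgD (cvgM Ccvg Ccvg) (cvgM Scvg Scvg)); apply: near_eq_cvg.
    by apply: nearW => t; rewrite -[LHS]/(_ * _ + _ * _) -!expr2 cos2Dsin2.
  by rewrite !expr2; exact: (cvg_unique _ one (cvg_cst _)).
have [s [CE SE]] := polar_exists C S; exists s.
by move: CE SE; rewrite /radius CS sqrtr1 !mul1r => <- <-.
Qed.

(** [J] consists of labels whose angles survive at the limit and determine the point: the first two
    over [y > 0], only [j] inside the edge [j], none at a corner, where the whole torus is one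
    point. *)
Lemma curve_has_limit : exists p : manifold alpha e, Gamma t @[t --> 1^'-] --> p.
Proof.
have [x [ax xcvg]] := px_cvg e3 alpha_mcf g_riem g_ext Gamma_smooth Gamma_finite.
have [y [y0 ycvg]] := py_cvg e3 alpha_mcf g_riem g_ext Gamma_smooth Gamma_finite.
(* The first two labels are [(0, -1)] and [(1, 0)], so the pairings with them are the coordinates of
   [z]. *)
have epsL0 z : eps (L 0) z = z.1 by rewrite /eps /= /mR /nR /=; ring.
have epsL1 z : eps (L 1) z = z.2 by rewrite /eps /= /mR /nR /=; ring.
have [yp|yle] := ltP 0 y.
  have vis j : visible alpha e j x y by split => //; left.
  have [s [cs ss]] := label_angle_cvg (vis 0%N) xcvg ycvg.
  have [s' [cs' ss']] := label_angle_cvg (vis 1%N) xcvg ycvg.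
  exists (mpoint alpha e x y (s, s')).
  apply: (@cvg_mpoint [set j | (j <= 1)%N]) => //.
    by case=> [|[|j]] //= _; rewrite ?epsL0 ?epsL1.
  move=> z same.
  have [] := same 0%N isT; rewrite !epsL0 /= => /cos_sin_inj h /h[K hK].
  have [] := same 1%N isT; rewrite !epsL1 /= => /cos_sin_inj h' /h'[K' hK'].
  apply: mpoint_lattice => //; exists K, K'.
  by congr pair; rewrite /= /GRing.scale /= ?hK ?hK'; ring.
have {yle} y0 : y = 0 by apply/le_anti; rewrite yle y0.
subst y; have [j /andP[jx _] xj] := exists_edge e3 alpha_mcf ax.
have [xE|xj'] := eqVneq x (corner R e j).
  exists (mpoint alpha e x 0 0); apply: (@cvg_mpoint set0) => // z _.
  apply/mpoint_eqP => //; split => //; exists 0, 0.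
  by rewrite /collapsed /= ltxx ifT //; apply/asboolP; exists j.
have ex : edge_interior e j x.
  by apply/andP; split => //; move: jx; rewrite !lte_fin lee_fin lt_neqAle eq_sym xj'.
have [s [cs ss]] : exists s : R, cos (eps (L j) (pz (Gamma t))) @[t --> 1^'-] --> cos s /\
    sin (eps (L j) (pz (Gamma t))) @[t --> 1^'-] --> sin s.
  by apply: label_angle_cvg xcvg ycvg; split => //; right.
have det := @eps_succ R e e3 j.
(* Any vector pairing to [s] with [L j] would do, as its component along [L j] is collapsed. *)
pose z0 : R * R := s *: L j.+1.
have z0E : eps (L j) z0 = s.
  by rewrite -[RHS]mulr1 -det /z0 /eps /= /GRing.scale /=; ring.
exists (mpoint alpha e x 0 z0); apply: (@cvg_mpoint [set j]) => //.
  by move=> _ ->; rewrite z0E.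
move=> z /(_ j erefl)[+ +]; rewrite z0E => /cos_sin_inj h /h[K hK].
(* The lattice shift [2 pi K L_{j+1}] makes the pairings with [L j] agree exactly. *)
apply/mpoint_eqP => //; split => //; exists (K * (mn e j.+1).1), (K * (mn e j.+1).2).
set w := _ + _; rewrite /collapsed /= ltxx ifF; last first.
  apply/asboolP => -[i xi].
  by have := @interior_not_corner R alpha e e3 j i _ ex; rewrite xi eqxx.
rewrite (edge_of_interior e3 alpha_mcf ex).
have w0 : eps (L j) w = 0.
  have -> : w = z0 - z + (2 * pi * K%:~R) *: L j.+1.
    by congr (_ + _); congr pair; rewrite /= /GRing.scale /= rmorphM /mR /nR /=; ring.
  have -> (a : R) v : eps (L j) (z0 - z + a *: v) = eps (L j) z0 - eps (L j) z + a * eps (L j) v.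
    by rewrite /eps /= /GRing.scale /=; ring.
  by rewrite z0E hK det; ring.
(* In the basis [L j], [L j.+1] the second component of [w] is [eps (L j) w = 0], so [w] lies on the
   collapsed line. *)
exists (eps w (L j.+1)).
have det' (v : R) : v = v * eps (L j) (L j.+1) by rewrite det mulr1.
have w1 : w.1 = eps w (L j.+1) * (L j).1 + eps (L j) w * (L j.+1).1.
  by rewrite [LHS]det' /eps /=; ring.
have w2 : w.2 = eps w (L j.+1) * (L j).2 + eps (L j) w * (L j.+1).2.
  by rewrite [LHS]det' /eps /=; ring.
by rewrite [LHS]surjective_pairing w1 w2 w0 !mul0r !addr0.
Qed.

End Limit.

Theorem theorem6p1 (R : realType) (alpha : R) (e : nat -> int)
  (alpha01 : 0 < alpha < 1)
  (alpha_irr : @irrational R alpha)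
  (alpha_mcf : has_mcf_expansion e alpha)
  (e_bounded : exists N : int, forall j : nat, (1 <= j)%N -> 3 <= e j <= N)
  (g : chart_index -> 'rV[R]_4 -> 'M[R]_4)
  (g_riem : riemannian_metric alpha e g)
  (g_ext : extends_g_alpha alpha e g)
  (Gamma : R -> manifold alpha e)
  (Gamma_smooth : smooth_curve Gamma)
  (Gamma_finite : finite_length g Gamma) :
  exists p : manifold alpha e, Gamma t @[t --> 1^'-] --> p.
Proof.
have e3 j : (1 <= j)%N -> 3 <= e j.
  by have [N eN] := e_bounded => /eN/andP[].
exact (curve_has_limit e3 alpha_mcf g_riem g_ext Gamma_smooth Gamma_finite).
Qed.
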